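(* Let $E\to\mathbb{D}^m$ ($m\ge3$) be the hermitian holomorphic line bundle associated to the Hilbert module $\mathscr{M}=\mathcal{H}^{(\alpha)}(\mathbb{D}^m)$ with $\alpha=(\alpha_1,\dots,\alpha_m)\in\mathbb{R}^m_{>0}$, and let $\mathscr{M}^{(n)}$ be the submodule of holomorphic functions in $\mathscr{M}$ vanishing of order $n$ along the diagonal set $\Delta=\{z\in\mathbb{D}^m:z_1=\cdots=z_m\}$. Let $J^{(n)}E|_\Delta$ be the jet bundle of order $n$ relative to $\Delta$, associated to the Hilbert module $J^{(n)}(\mathscr{M})|_{\mathrm{res}\,\Delta}$. Then $$J^{(n)}E|_\Delta=\bigoplus_{l_{m-2}=0}^{n}\left(\bigoplus_{l_{m-3}=0}^{n-l_{m-2}}\cdots\left(\bigoplus_{l_1=0}^{n-l_{m-2}-\cdots-l_2}J^{(n-l_{m-2}-\cdots-l_2-l_1)}E_{l_1}|_\Delta\right)\right),$$ where, for $0\le l_1\le n-l_{m-2}-\cdots-l_2$, $E_{l_1}$ is the hermitian holomorphic line bundle corresponding to the Hilbert module $\mathscr{M}_{l_1}$ with the reproducing kernel $$K_{l_1}(z,w)=C_{m-2}\,(1-z_1\bar w_1)^{-\alpha_1}(1-z_2\bar w_2)^{-\alpha_2-\cdots-\alpha_m-2(l_{m-2}+\cdots+l_1)},\qquad z,w\in\mathcal{Z},$$ for some positive constant $C_{m-2}$, with $\mathcal{Z}=\{z\in\mathbb{D}^m:z_2=\cdots=z_m\}$. Moreover, $$C_1=(l_{m-2})!\sum_{i_1=0}^{l_{m-2}}(-1)^{i_1}\binom{l_{m-2}}{i_1}\frac{(\alpha_{m-1})^2_{l_{m-2}}(\alpha_m)^2_{l_{m-2}}}{(\alpha_{m-1})_{l_{m-2}-i_1}(\alpha_m)_{i_1}},$$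 and, for $2\le j\le m-2$, $$\frac{C_j}{C_{j-1}}=(l_{m-j-1})!\sum_{i_j=0}^{l_{m-j-1}}(-1)^{i_j}\binom{l_{m-j-1}}{i_j}A_j,$$ where $$A_j=\frac{(\alpha_{m-j})^2_{l_{m-j-1}}\,\bigl(\alpha_{m-j+1}+\cdots+\alpha_m+2(l_{m-2}+\cdots+l_{m-j})\bigr)_{l_{m-j-1}-i_j}}{(\alpha_{m-j})^2_{l_{m-j-1}}\,\bigl(\alpha_{m-j+1}+\cdots+\alpha_m+2(l_{m-2}+\cdots+l_{m-j})\bigr)_{i_j}}.$$ Moreover, the jet bundles $J^{(n-l_{m-2}-\cdots-l_2-l_1)}E_{l_1}|_\Delta\to\Delta$, for $0\le l_{m-2}\le l_{m-2}+l_{m-3}\le\cdots\le l_{m-2}+\cdots+l_2+l_1\le n$, are irreducible as hermitian holomorphic vector bundles.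
   Context: $\mathcal{H}^{(\alpha)}(\mathbb{D}^m)$ is the reproducing kernel Hilbert space on $\mathbb{D}^m$ with kernel $K(z,w)=\prod_{j=1}^m(1-z_j\bar w_j)^{-\alpha_j}$, a Hilbert module under pointwise multiplication. $E\to\mathbb{D}^m$ is the line bundle with global holomorphic frame $s(w)=K(\cdot,\bar w)$ and metric inherited from $\mathscr{M}$. $(x)_k=x(x+1)\cdots(x+k-1)$, $(x)_0=1$, and $(x)_k^2$ is the square of $(x)_k$. $J^{(n)}(\mathscr{M})$ is the space of tuples $(\partial_2^{a_2}\cdots\partial_m^{a_m}h)_{a_2+\cdots+a_m<n}$, $h\in\mathscr{M}$, with the inner product transported from $\mathscr{M}$; its restriction $J^{(n)}(\mathscr{M})|_{\mathrm{res}\,\Delta}$ to $\Delta$ is unitarily equivalent to the quotient module $\mathscr{M}\ominus\mathscr{M}^{(n)}$. $J^{(n)}E|_\Delta$ is the hermitian holomorphic bundle over $\Delta$ with global holomorphic frame $\{\partial_2^{a_2}\cdots\partial_m^{a_m}s(w):a_i\ge0,\ a_2+\cdots+a_m<n\}$, $w\in\Delta$, and metric inherited from $\mathscr{M}$. $\mathcal{Z}$ is identified with $\mathbb{D}^2$ by $z\mapsto(z_1,z_2)$. The kernel $K_{l_1}$ and bundle $E_{l_1}\to\mathcal{Z}$ depend on all of $l_1,\dots,l_{m-2}$. The line bundle over $\mathcal{Z}$ corresponding to a kernel $\kappa$ on $\mathcal{Z}$ has frame $t(w)=\kappa(\cdot,\bar w)$ and metric $\|t(w)\|^2=\kappa(\bar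 w,\bar w)$. Its jet bundle of order $r$ relative to $\Delta\subset\mathcal{Z}$ has frame $\{\delta^it(w):0\le i\le r-1\}$, $w\in\Delta$, where $\delta=\sum_{j=2}^m\partial_j$ (that is, $\partial/\partial w_2$ in the coordinates $(w_1,w_2)$ of $\mathcal{Z}$), with Gram matrix $\langle\delta^it,\delta^jt\rangle=\delta^i\bar\delta^j\kappa(\bar w,\bar w)$; for $r=0$ it is the zero bundle. Direct sums are orthogonal direct sums, and equality is equality (isometric holomorphic isomorphism over the identity of $\Delta$) of hermitian holomorphic bundles. A hermitian holomorphic vector bundle is irreducible if it is not the orthogonal direct sum of two nonzero holomorphic subbundles.
   Formalization: The constants are corrected: the signs (-1)^{i_j} are dropped and A_j gets the same form as the summand of C_1, (α_{m-j})_l^2 (B)_l^2/((α_{m-j})_{l-i}(B)_i), since the printed C_1 is 0 for m=3, α_2=α_3, l_1=1, contradicting positivity. *)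

(* Defs.v *)
From HB Require Import structures.
From mathcomp Require Import all_boot all_order all_algebra.
From mathcomp Require Import complex.
From mathcomp Require Import all_classical all_reals all_analysis.

Set Implicit Arguments.
Unset Strict Implicit.
Unset Printing Implicit Defensive.
Import Order.TTheory GRing.Theory Num.Theory numFieldNormedType.Exports.

Local Open Scope ring_scope.
Local Open Scope complex_scope.
Local Open Scope classical_set_scope.

(* Naming the numClosedFieldType, instead of writing R[i], is what lets the
   topology and the complex derivatives of MathComp-Analysis be inferred. *)
Definition Cx (R : realType) : numClosedFieldType := R[i].

Definition cexp (R : realType) (z : Cx R) : Cx R :=
  (expR (complex.Re z) * cos (complex.Im z)) +i*
  (expR (complex.Re z) * sin (complex.Im z)).

(* The principal logarithm; the argument is given by atan only on the right
   half-plane, which contains every 1 - z * w^* with |z|, |w| < 1. *)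
Definition clog (R : realType) (u : Cx R) : Cx R :=
  ln (complex.Re `|u|) +i* atan (complex.Im u / complex.Re u).

Definition cpow (R : realType) (u : Cx R) (a : R) : Cx R :=
  cexp (a%:C * clog u).

Definition disc (R : realType) : set (Cx R) := [set w | `|w| < 1].

Definition polydisc (R : realType) (m : nat) : set 'rV[Cx R]_m :=
  [set z | forall j, `|z ord0 j| < 1].

(* [rk_inner] is linear in its first argument; its values are irrelevant
   unless both arguments belong to [rk_space]. *)
Record rkhs (R : realType) (T : Type) (K : T -> T -> Cx R) := Rkhs {
  rk_space : set (T -> Cx R);
  rk_inner : (T -> Cx R) -> (T -> Cx R) -> Cx R;
  rk_space0 : rk_space (fun=> 0);
  rk_spaceP : forall (a : Cx R) f g, rk_space f -> rk_space g ->
    rk_space (fun x => a * f x + g x);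
  rk_linear : forall (a : Cx R) f g h,
    rk_space f -> rk_space g -> rk_space h ->
    rk_inner (fun x => a * f x + g x) h = a * rk_inner f h + rk_inner g h;
  rk_conj : forall f g, rk_space f -> rk_space g ->
    rk_inner g f = Num.conj (rk_inner f g);
  rk_ge0 : forall f, rk_space f -> 0 <= rk_inner f f;
  rk_eq0 : forall f, rk_space f -> rk_inner f f = 0 -> f = (fun=> 0);
  rk_complete : forall u : nat -> T -> Cx R,
    (forall i, rk_space (u i)) ->
    (forall e : R, 0 < e -> exists N : nat, forall i j, (N <= i)%N -> (N <= j)%N ->
       rk_inner (fun x => u i x - u j x) (fun x => u i x - u j x) < e%:C) ->
    exists2 f, rk_space f &
      forall e : R, 0 < e -> exists N : nat, forall i, (N <= i)%N ->
        rk_inner (fun x => u i x - f x) (fun x => u i x - f x) < e%:C;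
  rk_kernel : forall w, rk_space (fun z => K z w);
  rk_reproducing : forall f w, rk_space f -> rk_inner f (fun z => K z w) = f w
}.

Definition polydisc_kernel (R : realType) (m : nat) (alpha : 'I_m -> R)
    (z w : 'rV[Cx R]_m) : Cx R :=
  \prod_(j < m) cpow (1 - z ord0 j * Num.conj (w ord0 j)) (- alpha j).

Definition Halpha (R : realType) (m : nat) (alpha : 'I_m -> R) : Type :=
  @rkhs R (@polydisc R m)
    (fun z w => polydisc_kernel alpha (\val z) (\val w)).

(* A bundle with a global holomorphic frame e_0, ..., e_(r-1) is recorded by
   the Gram matrix (<e_i(w), e_j(w)>)_(i,j) for w in the disc.  The diagonal of
   a polydisc is identified with the disc by w |-> (w, ..., w). *)
Record hbundle (R : realType) := HBundle {
  hb_rank : nat;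
  hb_gram : Cx R -> 'M[Cx R]_hb_rank
}.

(* Row i of A w lists the coordinates, in the frame of F over w, of the image
   of the i-th frame vector of E. *)
Definition hb_iso (R : realType) (E F : hbundle R) : Prop :=
  exists A : Cx R -> 'M[Cx R]_(hb_rank E, hb_rank F),
    [/\ forall w, disc w -> forall i j, derivable (fun v => A v i j) w 1,
        forall w, disc w ->
          exists2 B, A w *m B = 1%:M & B *m A w = 1%:M
      & forall w, disc w ->
          hb_gram E w = A w *m hb_gram F w *m (A w ^t*)%sesqui].

Definition hb_dsum (R : realType) (T : finType) (B : T -> hbundle R) :
    hbundle R :=
  HBundle (fun w => \mxdiag_(t < #|T|) hb_gram (B (enum_val t)) w).

(* V w is the matrix whose row space is the fibre over w, in the coordinates
   of the frame. *)
Definition hol_subbundle (R : realType) (r : nat) (V : Cx R -> 'M[Cx R]_r) :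
    Prop :=
  forall w0, disc w0 -> exists k (F : Cx R -> 'M[Cx R]_(k, r)),
    \forall w \near w0,
      [/\ forall i j, derivable (fun v => F v i j) w 1,
          row_free (F w) & (F w == V w)%MS].

Definition orthogonal_split (R : realType) (E : hbundle R)
    (V W : Cx R -> 'M[Cx R]_(hb_rank E)) : Prop :=
  forall w, disc w ->
    [/\ (V w + W w == 1%:M)%MS, (V w :&: W w)%MS = 0
      & V w *m hb_gram E w *m (W w ^t*)%sesqui = 0].

Definition hb_irreducible (R : realType) (E : hbundle R) : Prop :=
  ~ exists V W : Cx R -> 'M[Cx R]_(hb_rank E),
      [/\ hol_subbundle V, hol_subbundle W,
          (exists2 w, disc w & V w != 0), (exists2 w, disc w & W w != 0)
        & orthogonal_split V W].

Definition pderiv (R : realType) (m : nat) (j : 'I_m)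
    (F : 'rV[Cx R]_m -> Cx R) : 'rV[Cx R]_m -> Cx R :=
  fun w => 'D_(delta_mx ord0 j) F w.

Definition mderiv (R : realType) (m n : nat) (a : {ffun 'I_m -> 'I_n})
    (F : 'rV[Cx R]_m -> Cx R) : 'rV[Cx R]_m -> Cx R :=
  foldr (fun j G => iter (a j) (pderiv j) G) F (enum 'I_m).

(* Multi-indices (a_2, ..., a_m) with a_2 + ... + a_m < n, padded by a_1 = 0. *)
Definition transverse (m n : nat) : Type :=
  {a : {ffun 'I_m -> 'I_n} |
     [forall j : 'I_m, (j == 0 :> nat) ==> (a j == 0 :> nat)] &&
     (\sum_j (a j : nat) < n)%N}.

(* The vector (d_2^(a_2) ... d_m^(a_m) s)(w, ..., w), where
   s(w) = K(., w^* ). *)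
Definition jet_vector (R : realType) (m n : nat) (alpha : 'I_m -> R)
    (a : transverse m n) (w : Cx R) : @polydisc R m -> Cx R :=
  fun z => mderiv (val a)
    (fun v => polydisc_kernel alpha (\val z) (map_mx Num.conj v)) (const_mx w).

Definition jet_bundle (R : realType) (m : nat) (alpha : 'I_m -> R)
    (M : Halpha alpha) (n : nat) : hbundle R :=
  @HBundle R #|{: transverse m n}| (fun w => \matrix_(i, j)
    rk_inner M (jet_vector alpha (enum_val i) w)
               (jet_vector alpha (enum_val j) w)).

(* For a kernel k on the bidisc, the (i, j) entry is
   delta^i deltabar^j k(w^*, w^* ) on the diagonal: the holomorphic variable is
   in the second argument of k and the antiholomorphic one in the first, so
   that deltabar differentiates k with respect to u = w_2^* there. *)
Definition jet_bundle2 (R : realType) (k : Cx R * Cx R -> Cx R * Cx R -> Cx R)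
    (r : nat) : hbundle R :=
  @HBundle R r (fun w => \matrix_(i < r, j < r)
    (fun u => (fun v => k (Num.conj w, u) (Num.conj w, Num.conj v))^`(i) w)^`(j)
      (Num.conj w)).

(* The entry f_j of (f_1, ..., f_k), numbered from 1. *)
Definition entry (A : Type) (x0 : A) (k : nat) (f : 'I_k -> A) (j : nat) : A :=
  oapp f x0 (insub j.-1).

(* The tuples (l_1, ..., l_(m-2)) with l_1 + ... + l_(m-2) <= n: the index set
   of the nested sums over l_(m-2) <= n, l_(m-3) <= n - l_(m-2), ... *)
Definition levels (m n : nat) : Type :=
  {l : {ffun 'I_(m - 2) -> 'I_n.+1} | (\sum_i (l i : nat) <= n)%N}.

Definition level (m n : nat) (l : levels m n) (j : nat) : nat :=
  entry 0%N (fun i => val l i : nat) j.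

Definition level_sum (m n : nat) (l : levels m n) : nat :=
  (\sum_(1 <= j < m.-1) level l j)%N.

Definition rising (R : realType) (x : R) (k : nat) : R :=
  \prod_(i < k) (x + i%:R).

(* The squared norm of (x)_k (y)_k (z_1 - z_2)^k in the Hilbert space with
   kernel (1 - z_1 w_1^* )^(-x) (1 - z_2 w_2^* )^(-y), in which
   |z_1^i z_2^j|^2 = i! j! / ((x)_i (y)_j).  Being a squared norm it has no
   alternating signs; with the factor (-1)^i it would be 0 for x = y, k odd. *)
Definition sq_norm (R : realType) (x y : R) (k : nat) : R :=
  k`!%:R * \sum_(0 <= i < k.+1) 'C(k, i)%:R *
    (rising x k ^+ 2 * rising y k ^+ 2 / (rising x (k - i) * rising y i)).

Definition constants (R : realType) (m n : nat) (alpha : 'I_m -> R)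
    (l : levels m n) (C : nat -> R) : Prop :=
  C 1%N = sq_norm (entry 0 alpha m.-1) (entry 0 alpha m) (level l (m - 2)) /\
  forall j, (2 <= j <= m - 2)%N ->
    C j / C j.-1 =
    sq_norm (entry 0 alpha (m - j))
      (\sum_(m - j + 1 <= i < m.+1) entry 0 alpha i +
       2 * (\sum_(m - j <= i < m.-1) level l i)%N%:R)
      (level l (m - j - 1)).

(* The kernel of E_(l_1), with the subvariety z_2 = ... = z_m identified with
   the bidisc by (z_1, z_2). *)
Definition level_kernel (R : realType) (m n : nat) (alpha : 'I_m -> R)
    (l : levels m n) (c : R) (z w : Cx R * Cx R) : Cx R :=
  c%:C * cpow (1 - z.1 * Num.conj w.1) (- entry 0 alpha 1) *
  cpow (1 - z.2 * Num.conj w.2)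
    (- (\sum_(2 <= i < m.+1) entry 0 alpha i + 2 * (level_sum l)%:R)).

(* Main.v *)
Require Import Defs.
From HB Require Import structures.
From mathcomp Require Import all_boot all_order all_algebra.
From mathcomp Require Import perm complex ring lra zify.
From mathcomp Require Import all_classical all_reals all_analysis.

(* The inner product of the jets d^a s and d^b s at (w, ..., w) is
   the product over j of the derivatives d_w^(a_j) dbar_w^(b_j) of
   (1 - w w^* )^(-alpha_j).  As in the Clebsch-Gordan decomposition of a
   tensor product of discrete series, the transvectants (Rankin-Cohen
   brackets) are constant linear combinations of these jets, mutually
   orthogonal for different orders, and the derivatives of the transvectant of
   order k of the weights x and y have a Gram matrix proportional to that of
   the jets of (1 - w w^* )^(-(x + y + 2 k)).  Coupling the transverse variables
   one after the other, starting from the last two, gives a constant change of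
   frame that makes the Gram matrix block diagonal; rescaling each block gives
   any prescribed positive constants.

   For irreducibility, a splitting yields a holomorphic idempotent P with
   P G = G P^*, where G is the Gram matrix of the jets of one variable.
   Differentiating this relation expresses P' as a linear function of P plus
   the last column of P times coordinates that are not holomorphic; as P' is
   holomorphic, the last column of P vanishes off the diagonal.  The same
   relation then makes P lower triangular with constant diagonal, so the
   idempotent P is 0 or 1. *)

Import Order.TTheory GRing.Theory Num.Theory numFieldNormedType.Exports.

Local Open Scope ring_scope.

Set Implicit Arguments.
Unset Strict Implicit.
Unset Printing Implicit Defensive.
Local Open Scope classical_set_scope.
Local Open Scope complex_scope.

(** The Hilbert space is given only by its axioms, so membership of the jets and the formula for
    their inner products have to be proved. Sections of the kernel lie in the space; their
    derivatives are limits of difference quotients whose mutual inner products are second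
    differences of the kernel, so that completeness applies. On the diagonal the Gram entries are
    functions of w and of its conjugate, which is why the calculus carries two derivatives, the
    holomorphic functions being those with the second one zero. The constant change of frame is
    never inverted explicitly: the ranks agree by counting multi-indices, and the Gram matrix of the
    direct sum is invertible at 0, which forces the change of frame to be invertible. For
    irreducibility the idempotent exists only locally, since subbundles are given by local frames;
    connectedness of the disc makes the local alternatives consistent. *)

Lemma is_deriveP (K : numFieldType) (f : K -> K) (x l : K) :
  is_derive x 1 f l <->
  forall e : K, 0 < e -> \forall h \near (0 : K), `|f (x + h) - f x - l * h| <= e * `|h|.
Proof.
have E : is_derive x 1 f l <-> h^-1 *: (f (h *: (1 : K) + x) - f x) @[h --> 0^'] --> l.
  split; first by move=> [d <-]; apply: d.
  by move=> c; split; [apply/cvg_ex; exists l | apply: cvg_lim].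
rewrite E; have rew h : h != 0 ->
    `|l - h^-1 *: (f (h *: (1 : K) + x) - f x)| * `|h| = `|f (x + h) - f x - l * h|.
  move=> h0; rewrite -normrM mulrBl [_ *: _ * h]mulrC /= mulrA mulfV // mul1r.
  by rewrite distrC [h *: _]mulr1 (addrC h).
split=> [/cvgrPdist_le c e e0|c].
  have := c e e0; rewrite !near_withinE; apply: filterS => h H.
  have [->|h0] := eqVneq h 0; first by rewrite addr0 subrr mulr0 subr0 !normr0 mulr0.
  by rewrite -rew // ler_wpM2r // H.
apply/cvgrPdist_le => e e0; rewrite near_withinE.
have := c e e0; apply: filterS => h H h0.
by rewrite -(ler_pM2r (_ : 0 < `|h|)) ?normr_gt0 // rew.
Qed.

(** * Wirtinger derivatives *)

Section wirtinger.
Variable R : realType.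
Local Notation C := (Cx R).
Implicit Types (f g : C -> C) (w a b c : C).

(* Real differentiability at w, with Wirtinger derivatives a in w and b in the
   conjugate of w: Gram matrices are not holomorphic. *)
Definition wder f w a b := forall e : C, 0 < e ->
  \forall h \near (0 : C),
    `|f (w + h) - f w - (a * h + b * Num.conj h)| <= e * `|h|.

Lemma wder_is_derive f w a : wder f w a 0 <-> is_derive w 1 f a.
Proof.
rewrite is_deriveP; split=> H e e0; have := H e e0; apply: filterS => h.
  by rewrite mul0r addr0.
by rewrite mul0r addr0.
Qed.

Lemma wder_le (M : C) f w a b : 0 <= M ->
  (forall e : C, 0 < e -> \forall h \near (0 : C),
    `|f (w + h) - f w - (a * h + b * Num.conj h)| <= M * e * `|h|) ->
  wder f w a b.
Proof.
move=> M0 H e e0.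
have M1 : 0 < M + 1 by rewrite ltr_wpDl.
have := H (e / (M + 1)) (divr_gt0 e0 M1); apply: filterS => h /le_trans; apply.
rewrite ler_wpM2r // mulrA ler_pdivrMr // mulrC ler_pM2l //.
by rewrite lerDl.
Qed.

Lemma near_wder f g w a b : (\forall v \near w, f v = g v) ->
  wder f w a b -> wder g w a b.
Proof.
move=> fg H e e0; have fgw : f w = g w := nbhs_singleton fg.
have : \forall h \near (0 : C), f (w + h) = g (w + h).
  by move: fg; rewrite (near_shift (0 : C)) /=; apply: filterS => h; rewrite subr0 addrC.
have := H e e0; apply: filterS2 => h H1 H2; by rewrite -H2 -fgw.
Qed.

Lemma wder_cst c w : wder (fun=> c) w 0 0.
Proof.
move=> e e0; apply: filterE => h.
by rewrite subrr !mul0r addr0 subr0 normr0 mulr_ge0 // ltW.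
Qed.

Lemma wder_id w : wder id w 1 0.
Proof.
move=> e e0; apply: filterE => h.
have -> : w + h - w - (1 * h + 0 * Num.conj h) = 0 by ring.
by rewrite normr0 mulr_ge0 // ltW.
Qed.

Lemma wder_conj f w a b : wder f w a b ->
  wder (fun v => Num.conj (f v)) w (Num.conj b) (Num.conj a).
Proof.
move=> H e e0; have := H e e0; apply: filterS => h.
by rewrite -norm_conjC !rmorphB !rmorphD !rmorphM /= conjCK [X in _ - X]addrC.
Qed.

Lemma wderD f g w a b a' b' : wder f w a b -> wder g w a' b' ->
  wder (fun v => f v + g v) w (a + a') (b + b').
Proof.
move=> Hf Hg; apply: (@wder_le 2) => // e e0.
have := Hg e e0; have := Hf e e0; apply: filterS2 => h H1 H2.
have -> : f (w + h) + g (w + h) - (f w + g w) - ((a + a') * h + (b + b') * Num.conj h)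
 = (f (w + h) - f w - (a * h + b * Num.conj h)) +
   (g (w + h) - g w - (a' * h + b' * Num.conj h)) by ring.
apply: (le_trans (ler_normD _ _)); apply: (le_trans (lerD H1 H2)).
by rewrite -mulr2n mulr_natl mulrnAl.
Qed.

Lemma wder_lin_le a b (h : C) : `|a * h + b * Num.conj h| <= (`|a| + `|b|) * `|h|.
Proof.
apply: (le_trans (ler_normD _ _)).
by rewrite !normrM norm_conjC mulrDl.
Qed.

Lemma wder_lip f w a b : wder f w a b ->
  \forall h \near (0 : C), `|f (w + h) - f w| <= (`|a| + `|b| + 1) * `|h|.
Proof.
move=> H; have := H 1 ltr01; apply: filterS => h H1.
have -> : f (w + h) - f w = (f (w + h) - f w - (a * h + b * Num.conj h)) +
  (a * h + b * Num.conj h) by ring.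
apply: (le_trans (ler_normD _ _)); apply: (le_trans (lerD H1 (wder_lin_le a b h))).
by rewrite -mulrDl addrC.
Qed.

Lemma wder_cont f w a b : wder f w a b ->
  forall e : C, 0 < e -> \forall h \near (0 : C), `|f (w + h) - f w| <= e.
Proof.
move=> H e e0; set M := `|a| + `|b| + 1.
have M0 : 0 < M by rewrite ltr_wpDl // addr_ge0.
have := nbhs0_le (divr_gt0 e0 M0) : \forall h \near (0 : C), `|h| <= e / M.
have := wder_lip H; apply: filterS2 => h H1 H2; apply: (le_trans H1).
by rewrite -ler_pdivlMl // mulrC.
Qed.

Lemma wderM f g w a b a' b' : wder f w a b -> wder g w a' b' ->
  wder (fun v => f v * g v) w (a * g w + f w * a') (b * g w + f w * b').
Proof.
move=> Hf Hg.
apply: (@wder_le ((`|g w| + 1) + (`|a| + `|b|) + `|f w|)).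
  by rewrite !addr_ge0.
move=> e e0.
have H3 := wder_cont Hg e0; have H4 := wder_cont Hg ltr01.
apply: filterS2 (filterI (Hf e e0) (Hg e e0)) (filterI H3 H4) => h [H1 H2] [{}H3 {}H4].
set A := a * h + b * Num.conj h in H1; set B := a' * h + b' * Num.conj h in H2.
have -> : f (w + h) * g (w + h) - f w * g w - ((a * g w + f w * a') * h +
  (b * g w + f w * b') * Num.conj h) =
  (f (w + h) - f w - A) * g (w + h) + A * (g (w + h) - g w) +
  f w * (g (w + h) - g w - B) by rewrite /A /B; ring.
have dist (p q s t u : C) : (p + q + s) * t * u = p * t * u + q * t * u + s * t * u by ring.
rewrite dist; apply: (le_trans (ler_normD _ _)); apply: lerD; last first.
  by rewrite normrM -mulrA ler_wpM2l.
apply: (le_trans (ler_normD _ _)); apply: lerD; rewrite normrM.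
  rewrite -mulrA mulrC ler_pM //.
  have -> : g (w + h) = g w + (g (w + h) - g w) by ring.
  by apply: (le_trans (ler_normD _ _)); rewrite lerD2l.
rewrite mulrAC ler_pM //; exact: wder_lin_le.
Qed.

Lemma wderZ c f w a b : wder f w a b -> wder (fun v => c * f v) w (c * a) (c * b).
Proof. by move=> H; have := wderM (wder_cst c w) H; rewrite !mul0r !add0r. Qed.

Lemma wderN f w a b : wder f w a b -> wder (fun v => - f v) w (- a) (- b).
Proof.
move=> /(wderZ (-1)); rewrite !mulN1r; apply: near_wder.
by apply: filterE => v; rewrite mulN1r.
Qed.

Lemma wderB f g w a b a' b' : wder f w a b -> wder g w a' b' ->
  wder (fun v => f v - g v) w (a - a') (b - b').
Proof. by move=> Hf /wderN; apply: wderD. Qed.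

Lemma wder_sum (I : Type) (r : seq I) (P : pred I) (f : I -> C -> C) w (a b : I -> C) :
  (forall i, P i -> wder (f i) w (a i) (b i)) ->
  wder (fun v => \sum_(i <- r | P i) f i v) w
    (\sum_(i <- r | P i) a i) (\sum_(i <- r | P i) b i).
Proof.
move=> H; elim: r => [|i r IH].
  rewrite !big_nil; apply: near_wder (wder_cst 0 w).
  by apply: filterE => v; rewrite big_nil.
rewrite !big_cons; case: ifPn => Pi.
  apply: near_wder (wderD (H i Pi) IH).
  by apply: filterE => v; rewrite big_cons Pi.
apply: near_wder IH; by apply: filterE => v; rewrite big_cons (negbTE Pi).
Qed.

Lemma wderX f n w a b : wder f w a b ->
  wder (fun v => f v ^+ n) w (n%:R * f w ^+ n.-1 * a) (n%:R * f w ^+ n.-1 * b).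
Proof.
move=> H; elim: n => [|n IH].
  by rewrite !mul0r; apply: near_wder (wder_cst 1 w); apply: filterE => v; rewrite expr0.
have := wderM IH H.
suff E c : n%:R * f w ^+ n.-1 * c * f w + f w ^+ n * c = n.+1%:R * f w ^+ n.+1.-1 * c.
  by rewrite !E; apply: near_wder; apply: filterE => v; rewrite exprSr.
case: n {IH} => [|n] /=; first by rewrite expr0; ring.
by rewrite exprSr -[n.+2%:R]natr1; ring.
Qed.

Lemma wder_comp f (g : C -> C) w a b c :
  wder f w a b -> wder g (f w) c 0 -> wder (fun v => g (f v)) w (c * a) (c * b).
Proof.
move=> Hf Hg; apply: (@wder_le (`|c| + (`|a| + `|b| + 1))).
  by rewrite !addr_ge0.
move=> e e0.
have [d /= d0 Hd] := (nbhs_normP _ _).1 (Hg e e0).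
have d20 : 0 < d / 2 by rewrite divr_gt0.
apply: filterS2 (Hf e e0) (filterI (wder_lip Hf) (wder_cont Hf d20)) => h H1 [H2 H3].
set k := f (w + h) - f w in H1 H2 H3.
have -> : f (w + h) = f w + k by rewrite /k; ring.
have Hk := Hd k; rewrite /= sub0r normrN in Hk.
have -> : g (f w + k) - g (f w) - (c * a * h + c * b * Num.conj h) =
  (g (f w + k) - g (f w) - (c * k + 0 * Num.conj k)) +
  c * (k - (a * h + b * Num.conj h)) by ring.
apply: (le_trans (ler_normD _ _)); rewrite addrC 2!mulrDl.
apply: lerD.
  by rewrite normrM -mulrA ler_wpM2l.
apply: (le_trans (Hk _)); last by rewrite mulrAC mulrC ler_pM2r.
by rewrite (le_lt_trans H3) // ltr_pdivrMr // ltr_pMr // ltr1n.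
Qed.

(** The real-linear part of a locally zero function vanishes on 1 and on i, which gives a + b = 0
    and a = b. The resulting uniqueness is how identities between functions are differentiated
    later. *)
Lemma wder0_eq0 f w a b : (\forall v \near w, f v = 0) -> wder f w a b ->
  a = 0 /\ b = 0.
Proof.
move=> f0 H.
have {}H : wder (fun=> 0) w a b by apply: near_wder H.
have E (h : C) : h != 0 -> (forall t : C, 0 < t -> a * (t * h) + b * Num.conj (t * h) = t * (a * h + b * Num.conj h)) -> a * h + b * Num.conj h = 0.
  move=> h0 lin; apply/eqP; rewrite -normr_le0; apply/ler_addgt0Pl => e e0.
  rewrite addr0.
  have h1 : 0 < `|h| by rewrite normr_gt0.
  have [d /= d0 Hd] := (nbhs_normP _ _).1 (H (e / `|h|) (divr_gt0 e0 h1)).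
  have [t t0 td] : exists2 t : C, 0 < t & `|t * h| < d.
    exists (d / (2 * `|h|)); first by rewrite divr_gt0 // mulr_gt0.
    rewrite normrM gtr0_norm ?divr_gt0 ?mulr_gt0 // invfM mulrA divfK ?gt_eqF //.
    by rewrite ltr_pdivrMr // ltr_pMr // ltr1n.
  have := Hd (t * h); rewrite /= sub0r normrN subrr sub0r normrN lin // => /(_ td).
  by rewrite !normrM (gtr0_norm t0) [_ * (t * _)]mulrCA ler_pM2l // divfK ?gt_eqF.
have lin (h t : C) : 0 < t -> a * (t * h) + b * Num.conj (t * h) = t * (a * h + b * Num.conj h).
  by move=> t0; rewrite rmorphM /= (CrealP (gtr0_real t0)); ring.
have := E 1 (oner_neq0 _) (fun t => @lin 1 t).
rewrite rmorph1 !mulr1 => e1.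
have := E 'i (neq0Ci _) (fun t => @lin 'i t).
rewrite conjCi mulrN -mulrBl => /eqP; rewrite mulf_eq0 (negbTE (neq0Ci _)) orbF subr_eq0 => /eqP e2.
move: e1; rewrite e2 -mulr2n => /eqP; rewrite mulrn_eq0 /= => /eqP ->; by [].
Qed.

Lemma wder_unique f w a b a' b' : wder f w a b -> wder f w a' b' -> a = a' /\ b = b'.
Proof.
move=> H1 H2; have := wderB H1 H2 => /wder0_eq0[].
  by apply: filterE => v; rewrite subrr.
by move=> /subr0_eq -> /subr0_eq ->.
Qed.

End wirtinger.

(** * Complex exponential, logarithm and powers *)

Section complex_exponential.
Variable R : realType.
Local Notation C := (Cx R).
Implicit Types (z u w : C) (a b : R).

Lemma near0_add (P : C -> Prop) w : (\forall v \near w, P v) ->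
  \forall h \near (0 : C), P (w + h).
Proof.
by rewrite (near_shift (0 : C)) /=; apply: filterS => h; rewrite subr0 addrC.
Qed.

Lemma cx_gt0E (e : C) : 0 < e -> 0 < complex.Re e /\ e = (complex.Re e)%:C.
Proof.
case: e => x y; rewrite ltcE /= => /andP[/eqP y0 x0]; split=> //.
by rewrite y0.
Qed.

Lemma Im_le_norm z : `|complex.Im z|%:C <= `|z|.
Proof. by rewrite normc_def lecR -sqrtr_sqr ler_wsqrtr // lerDr sqr_ge0. Qed.

Lemma norm_le_ReIm z : `|z| <= (`|complex.Re z| + `|complex.Im z|)%:C.
Proof.
rewrite {1}(complexE z) rmorphD /=; apply: (le_trans (ler_normD _ _)); apply: lerD.
  by rewrite normc_def /= expr0n addr0 sqrtr_sqr.
rewrite normrM normc_def /= expr0n /= expr1n add0r sqrtr1 mul1r.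
by rewrite normc_def /= expr0n addr0 sqrtr_sqr.
Qed.

Lemma normc_real a : `|a%:C : C| = `|a|%:C.
Proof. by rewrite normc_def /= expr0n addr0 sqrtr_sqr. Qed.

Lemma continuous_Re : continuous (fun z => complex.Re z : R).
Proof.
move=> z P /nbhs_normP[d /= d0 H]; apply/nbhs_normP; exists d%:C; first by rewrite /= ltcR.
move=> h /= hd; apply: H => /=; rewrite -ltcR; apply: le_lt_trans hd.
have -> : complex.Re z - complex.Re h = complex.Re (z - h) by case: z h => [? ?] [? ?].
exact: normc_ge_Re.
Qed.

Lemma continuous_Im : continuous (fun z => complex.Im z : R).
Proof.
move=> z P /nbhs_normP[d /= d0 H]; apply/nbhs_normP; exists d%:C; first by rewrite /= ltcR.
move=> h /= hd; apply: H => /=; rewrite -ltcR; apply: le_lt_trans hd.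
have -> : complex.Im z - complex.Im h = complex.Im (z - h) by case: z h => [? ?] [? ?].
exact: Im_le_norm.
Qed.

Lemma cexpD z w : cexp (z + w) = cexp z * cexp w.
Proof.
case: z w => [a b] [c d]; rewrite /cexp /= expRD cosD sinD.
by apply/eqP; rewrite eq_complex /=; apply/andP; split; apply/eqP; ring.
Qed.

Lemma cexp0 : cexp (0 : C) = 1.
Proof. by rewrite /cexp /= expR0 cos0 sin0 mulr0 mulr1. Qed.

Lemma cexp_neq0 z : cexp z != 0.
Proof.
apply/eqP => z0; have := cexpD z (- z); rewrite z0 subrr cexp0 mul0r => /eqP.
by rewrite oner_eq0.
Qed.

Lemma norm_i z : `|'i%C * z| = `|z|.
Proof. by rewrite normrM normc_def /= expr0n /= expr1n add0r sqrtr1 mul1r. Qed.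

(** With h = x + i y and r = cos y + i sin y, the remainder is (e^x - 1 - x) r + (r - 1 - i y) + x
    (r - 1); the three terms are at most 1, 2 and 3 times d |h|, whence the 6. *)
Lemma wder_cexp0 : wder (@cexp R) 0 1 0.
Proof.
apply: (@wder_le _ 6%:R) => // e /cx_gt0E[e0 ->]; set d := complex.Re e in e0 *.
have d1 : 0 < Num.min d 1 by rewrite lt_min e0 ltr01.
have HE := (is_deriveP _ _ _).1 (is_derive_expR (0 : R)) _ e0.
have HS := (is_deriveP _ _ _).1 (is_derive_sin (0 : R)) _ d1.
have HC := (is_deriveP _ _ _).1 (is_derive_cos (0 : R)) _ d1.
have L1 : \forall h \near (0 : C), `|h| <= d%:C by apply: nbhs0_le; rewrite ltcR.
have L2 : \forall h \near (0 : C), `|h| <= 1 by apply: nbhs0_le.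
have nRe (P : R -> Prop) : (\forall t \near (0 : R), P t) ->
  \forall h \near (0 : C), P (complex.Re h) by exact: (@continuous_Re 0 P).
have nIm (P : R -> Prop) : (\forall t \near (0 : R), P t) ->
  \forall h \near (0 : C), P (complex.Im h) by exact: (@continuous_Im 0 P).
apply: filterS2 (filterI (nRe _ HE) (nIm _ HC)) (filterI (nIm _ HS) (filterI L1 L2)).
move=> h [H1 H2] [H3 [L3 L4]].
move: H1 H2 H3; rewrite !add0r expR0 sin0 cos0 !oppr0 mul0r !mul1r !subr0 addr0 => H1 H2 H3.
have Re_h := normc_ge_Re h; have Im_h := Im_le_norm h.
have leIm (t : R) : t <= `|complex.Im h| * Num.min d 1 -> t%:C <= d%:C * `|h|.
  rewrite -lecR => /le_trans; apply; rewrite rmorphM /= mulrC.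
  by apply: ler_pM => //; rewrite lecR ?normr_ge0 // ?ge_min ?lexx // le_min ltW //= ler01.
set x := complex.Re h; set y := complex.Im h.
pose r := cos y +i* sin y : C.
have rE : cexp h = (expR x)%:C * r.
  by rewrite /cexp /r; apply/eqP; rewrite eq_complex /= !mul0r subr0 addr0 !eqxx.
have r1 : `|r| = 1 by rewrite normc_def /= cos2Dsin2 sqrtr1.
have r2 : `|r - 1 - 'i%C * y%:C| <= 2 * (d%:C * `|h|).
  apply: (le_trans (norm_le_ReIm _)).
  have -> : complex.Re (r - 1 - 'i%C * y%:C) = cos y - 1 by rewrite /=; ring.
  have -> : complex.Im (r - 1 - 'i%C * y%:C) = sin y - y by rewrite /=; ring.
  by rewrite rmorphD mulr_natl mulr2n; apply: lerD; apply: leIm; rewrite [leRHS]mulrC.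
have r3 : `|r - 1| <= 3 * d%:C.
  have -> : r - 1 = (r - 1 - 'i%C * y%:C) + 'i%C * y%:C by ring.
  apply: (le_trans (ler_normD _ _)).
  have -> : 3 * d%:C = 2 * d%:C + d%:C :> C by ring.
  apply: lerD.
    apply: (le_trans r2); rewrite ler_wpM2l // -[leRHS]mulr1 ler_wpM2l // lecR ltW //.
  rewrite norm_i; apply: le_trans L3; apply: le_trans Im_h.
  by rewrite normc_def /= expr0n addr0 sqrtr_sqr.
have -> : cexp h - cexp 0 - (h + 0 * Num.conj h) =
  (expR x - 1 - x)%:C * r + (r - 1 - 'i%C * y%:C) + x%:C * (r - 1).
  have key (E r' X Y H H' : C) : H = X + Y -> E * r' - 1 - (H + 0 * H') =
    (E - 1 - X) * r' + (r' - 1 - Y) + X * (r' - 1) by move=> ->; ring.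
  by rewrite cexp0 rE (key _ _ _ _ _ _ (complexE h)) !rmorphB rmorph1.
have -> : 6%:R * d%:C * `|h| = d%:C * `|h| + 2 * (d%:C * `|h|) + `|h| * (3 * d%:C) by ring.
apply: (le_trans (ler_normD _ _)); apply: lerD; last first.
  by rewrite normrM ler_pM // normc_real.
apply: (le_trans (ler_normD _ _)); apply: lerD => //.
rewrite normrM r1 mulr1 normc_real.
move: H1; rewrite -lecR => /le_trans; apply.
by rewrite rmorphM /= ler_wpM2l // lecR ltW.
Qed.

Lemma wder_shift_cst z w : wder (fun v : C => v - z) w 1 0.
Proof. by have := wderB (wder_id w) (wder_cst z w); rewrite !subr0. Qed.

Lemma wder_cexp z : wder (@cexp R) z (cexp z) 0.
Proof.
have H0 : wder (@cexp R) (z - z) 1 0 by rewrite subrr; apply: wder_cexp0.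
have := wderZ (cexp z) (wder_comp (wder_shift_cst z z) H0).
rewrite !mulr1 !mulr0; apply: near_wder; apply: filterE => v.
by rewrite -cexpD addrC subrK.
Qed.

Lemma Re_norm u : complex.Re `|u| = Num.sqrt (complex.Re u ^+ 2 + complex.Im u ^+ 2).
Proof. by rewrite normc_def. Qed.

Lemma clogK u : 0 < complex.Re u -> cexp (clog u) = u.
Proof.
case: u => x y /= x0; rewrite /clog Re_norm.
have cexpE a b : cexp (a +i* b : C) = (expR a * cos b) +i* (expR a * sin b) by [].
rewrite cexpE /=; set s := Num.sqrt _.
have s0 : 0 < s by rewrite sqrtr_gt0 ltr_pwDl ?exprn_gt0 ?sqr_ge0.
have E : Num.sqrt (1 + (y / x) ^+ 2) = s / x.
  have -> : 1 + (y / x) ^+ 2 = (x ^+ 2 + y ^+ 2) / x ^+ 2 by field; rewrite gt_eqF.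
  by rewrite sqrtrM ?addr_ge0 ?sqr_ge0 // sqrtrV ?sqr_ge0 // sqrtr_sqr gtr0_norm.
have c : cos (atan (y / x)) = x / s by rewrite cos_atan E invf_div.
have t : sin (atan (y / x)) = y / s.
  have := atanK (y / x); rewrite /tan c => /(canRL (divfK _)) ->.
    by field; rewrite !gt_eqF.
  by rewrite mulf_neq0 ?invr_eq0 ?gt_eqF.
rewrite c t lnK ?posrE //; apply/eqP; rewrite eq_complex /=.
by apply/andP; split; rewrite mulrC divfK // gt_eqF.
Qed.

Lemma clog_cont u : 0 < complex.Re u ->
  forall e : C, 0 < e -> \forall h \near (0 : C), `|clog (u + h) - clog u| <= e.
Proof.
move=> u0 e /cx_gt0E[e0 ->]; set d := complex.Re e in e0 *.
have cRe := @continuous_Re u; have cIm := @continuous_Im u.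
pose sq (v : C) := Num.sqrt (complex.Re v ^+ 2 + complex.Im v ^+ 2).
have csq : sq v @[v --> u] --> sq u.
  apply: (@cvg_comp _ _ _ (fun v : C => complex.Re v ^+ 2 + complex.Im v ^+ 2) (@Num.sqrt R)
    _ _ _ _ (@sqrt_continuous R _)).
  have csqr (f : C -> R) : f v @[v --> u] --> f u -> f v ^+ 2 @[v --> u] --> f u ^+ 2.
    by move=> H; apply: (@cvg_comp _ _ _ f (fun x => x ^+ 2) _ _ _ H (@exprn_continuous _ 2 _)).
  exact: (cvgD (csqr _ cRe) (csqr _ cIm)).
have c1 : ln (sq v) @[v --> u] --> ln (sq u).
  apply: (@cvg_comp _ _ _ sq (@ln R) _ _ _ csq).
  by apply: continuous_ln; rewrite sqrtr_gt0 ltr_pwDl ?exprn_gt0 ?sqr_ge0.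
have c2 : atan (complex.Im v / complex.Re v) @[v --> u] --> atan (complex.Im u / complex.Re u).
  apply: (@cvg_comp _ _ _ (fun v : C => complex.Im v / complex.Re v) (@atan R)
    _ _ _ _ (@continuous_atan R _)).
  by apply: (cvgM cIm (cvgV _ cRe)); rewrite gt_eqF.
have d2 : 0 < d / 2 by rewrite divr_gt0.
move/cvgrPdist_le/(_ _ d2)/near0_add : c1 => c1.
move/cvgrPdist_le/(_ _ d2)/near0_add : c2 => c2.
apply: filterS2 c1 c2 => h H1 H2.
rewrite /clog !Re_norm; apply: (le_trans (norm_le_ReIm _)); rewrite lecR /=.
have -> : d = d / 2 + d / 2 by field.
by apply: lerD; rewrite -normrN opprB.
Qed.

(** For k = f (w + h) - f w one has h = c k + o(k). An error of at most |c| |k| / 2 already gives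
    |k| <= 2 |h| / |c|, so that o(k) is o(h); hence the minimum with |c| / 2. *)
Lemma wder_inverse (f g : C -> C) w c : c != 0 ->
  (\forall v \near w, g (f v) = v) -> wder g (f w) c 0 ->
  (forall e : C, 0 < e -> \forall h \near (0 : C), `|f (w + h) - f w| <= e) ->
  wder f w c^-1 0.
Proof.
move=> c0 gf Hg fc; have nc : 0 < `|c| by rewrite normr_gt0.
apply: (@wder_le _ (2 / `|c| ^+ 2)); first by rewrite divr_ge0 // exprn_ge0.
move=> e e0.
have e1 : 0 < Num.min e (`|c| / 2).
  by rewrite comparable_lt_min ?e0 ?divr_gt0 // real_comparable // gtr0_real // divr_gt0.
have [d /= d0 Hd] := (nbhs_normP _ _).1 (Hg _ e1).
have d2 : 0 < d / 2 by rewrite divr_gt0.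
have gfw := nbhs_singleton gf.
apply: filterS2 (near0_add gf) (fc _ d2) => h E Hk.
set k := f (w + h) - f w in Hk.
have Ek : f (w + h) = f w + k by rewrite /k; ring.
have := Hd k; rewrite /= sub0r normrN -Ek E gfw mul0r addr0.
have -> : w + h - w - c * k = h - c * k by ring.
move=> H.
have {}H : `|h - c * k| <= Num.min e (`|c| / 2) * `|k|.
  by apply: H; rewrite (le_lt_trans Hk) // ltr_pdivrMr // ltr_pMr // ltr1n.
have H1 : `|h - c * k| <= e * `|k|.
  apply: (le_trans H); rewrite ler_wpM2r //; rewrite comparable_ge_min ?lexx //.
  by rewrite real_comparable // gtr0_real // divr_gt0.
have H2 : `|h - c * k| <= `|c| / 2 * `|k|.
  apply: (le_trans H); rewrite ler_wpM2r //; rewrite comparable_ge_min ?lexx ?orbT //.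
  by rewrite real_comparable // gtr0_real // divr_gt0.
have H3 : `|k| <= 2 / `|c| * `|h|.
  have : `|c| * `|k| <= `|h| + `|c| / 2 * `|k|.
    rewrite -normrM; have -> : c * k = h - (h - c * k) by ring.
    by apply: (le_trans (ler_normB _ _)); rewrite lerD2l.
  have -> : `|c| * `|k| = `|c| / 2 * `|k| + `|c| / 2 * `|k| by field.
  rewrite lerD2r => H4.
  have -> : `|k| = 2 / `|c| * (`|c| / 2 * `|k|) by field; rewrite gt_eqF.
  by rewrite ler_wpM2l // divr_ge0.
have -> : k - (c^-1 * h + 0 * Num.conj h) = - (c^-1 * (h - c * k)) by field.
rewrite normrN normrM normfV.
apply: le_trans (_ : `|c|^-1 * (e * (2 / `|c| * `|h|)) <= _).
  rewrite ler_pM2l ?invr_gt0 //; apply: (le_trans H1); by rewrite ler_pM2l.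
by rewrite le_eqVlt; apply/orP; left; apply/eqP; field; rewrite gt_eqF.
Qed.

Lemma wder_clog u : 0 < complex.Re u -> wder (@clog R) u u^-1 0.
Proof.
move=> u0; apply: (@wder_inverse _ (@cexp R)).
- by apply: contraTneq u0 => ->; rewrite ltxx.
- by apply: filterS (cvgr_gt _ (@continuous_Re u) 0 u0) => v; apply: clogK.
- by rewrite -{2}(clogK u0); apply: wder_cexp.
- exact: clog_cont.
Qed.

Lemma cpowD u a b : cpow u (a + b) = cpow u a * cpow u b.
Proof. by rewrite /cpow -cexpD rmorphD mulrDl. Qed.

Lemma cpow0 u : cpow u 0 = 1.
Proof. by rewrite /cpow mul0r cexp0. Qed.

Lemma cpow_neq0 u a : cpow u a != 0.
Proof. exact: cexp_neq0. Qed.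

Lemma cpow1 u : 0 < complex.Re u -> cpow u 1 = u.
Proof. by move=> u0; rewrite /cpow mul1r clogK. Qed.

Lemma cpowN u a : cpow u (- a) = (cpow u a)^-1.
Proof.
apply: (mulIf (cpow_neq0 u a)); rewrite -cpowD addNr cpow0 mulVf //.
exact: cpow_neq0.
Qed.

Lemma cpow_nat u n : 0 < complex.Re u -> cpow u n%:R = u ^+ n.
Proof.
move=> u0; elim: n => [|n IH]; first by rewrite cpow0 expr0.
by rewrite -natr1 cpowD IH cpow1 // exprSr.
Qed.

Lemma cpow_conj u a : 0 < complex.Re u -> Num.conj (cpow u a) = cpow (Num.conj u) a.
Proof.
case: u => x y /= x0; rewrite /cpow /clog !Re_norm /= sqrrN mulNr atanN /cexp /=.
by rewrite !mul0r !subr0 !addr0 !mulrN cosN sinN mulrN.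
Qed.

Lemma wder_cpow u a : 0 < complex.Re u ->
  wder (fun v => cpow v a) u (a%:C * cpow u (a - 1)) 0.
Proof.
move=> u0; have := wder_comp (wderZ a%:C (wder_clog u0)) (wder_cexp (a%:C * clog u)).
by rewrite !mulr0 cpowD cpowN cpow1 // -/(cpow u a) mulrCA.
Qed.

End complex_exponential.

(** * Derivatives of the kernel (1 - X U)^(-x) *)

Section rising_factorial.
Variable R : realType.
Implicit Types (x : R).

Lemma rising0 x : rising x 0 = 1.
Proof. by rewrite /rising big_ord0. Qed.

Lemma risingS x k : rising x k.+1 = rising x k * (x + k%:R).
Proof. by rewrite /rising big_ord_recr. Qed.

Lemma rising_gt0 x k : 0 < x -> 0 < rising x k.
Proof. by move=> x0; apply: prodr_gt0 => i _; rewrite ltr_wpDr. Qed.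

(** Coefficients of the numerator of d_X^a d_U^b (1 - X U)^(-x). Each is a product of a factor in
    (a, k), one in (b, k) and one in k; this gives the triangular factorization of the Gram matrix
    and separates the two alternating sums for transvectants. *)
Definition gcoef x a b k : R :=
  k`!%:R * 'C(a, k)%:R * 'C(b, k)%:R * (rising x a * rising x b / rising x k).

Lemma gcoefC x a b k : gcoef x a b k = gcoef x b a k.
Proof. by rewrite /gcoef; ring. Qed.

Lemma gcoef_gtl x a b k : (a < k)%N -> gcoef x a b k = 0.
Proof. by move=> ak; rewrite /gcoef bin_small // mulr0 !mul0r. Qed.

Lemma gcoef_gtr x a b k : (b < k)%N -> gcoef x a b k = 0.
Proof. by rewrite gcoefC; apply: gcoef_gtl. Qed.

Lemma bin_subr (a k : nat) : ((a - k)%:R * 'C(a, k)%:R : R) = (a%:R - k%:R) * 'C(a, k)%:R.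
Proof.
have [ka|ak] := leqP k a; first by rewrite natrB.
by rewrite bin_small // !mulr0.
Qed.

Lemma bin_leftr (a k : nat) : (k.+1%:R * 'C(a, k.+1)%:R : R) = (a%:R - k%:R) * 'C(a, k)%:R.
Proof. by rewrite -natrM mul_bin_left natrM bin_subr. Qed.

Lemma gcoefS0 x a b : gcoef x a.+1 b 0 = gcoef x a b 0 * (x + a%:R).
Proof. by rewrite /gcoef !bin0 risingS rising0; field. Qed.

(** With N the numerator of [jetk], one derivative in X replaces it by (x + a + b) U N + (1 - X U)
    N'; comparing coefficients gives this recurrence. *)
Lemma gcoefSS x a b k : 0 < x ->
  gcoef x a.+1 b k.+1 = gcoef x a b k.+1 * (x + a%:R + k.+1%:R) + gcoef x a b k * (b - k)%:R.
Proof.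
move=> x0; have xk : x + k%:R != 0 by rewrite gt_eqF // ltr_wpDr.
have rk : rising x k != 0 by rewrite gt_eqF // rising_gt0.
rewrite /gcoef binS !risingS factS natrM natrD.
have := bin_leftr a k; have := bin_leftr b k; have := bin_subr b k.
move: ('C(a, k)%:R) ('C(a, k.+1)%:R) ('C(b, k)%:R) ('C(b, k.+1)%:R) ((b - k)%:R) => A A' B B' D.
move=> e1 e2 e3.
have -> : k`!%:R * A * B * (rising x a * rising x b / rising x k) * D =
  k`!%:R * A * (D * B) * (rising x a * rising x b / rising x k) by ring.
rewrite e1 -e2.
have -> : k.+1%:R * k`!%:R * A' * B' * (rising x a * rising x b / (rising x k * (x + k%:R))) *
  (x + a%:R + k.+1%:R) = k`!%:R * B' * (rising x a * rising x b / (rising x k * (x + k%:R))) * k.+1%:R *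
  (A' * (x + a%:R) + k.+1%:R * A') by ring.
by rewrite e3; field; apply/andP.
Qed.

End rising_factorial.

Section cvg_numField.
Variables (K : numFieldType) (T : Type) (F : set_system T).
Context {FF : Filter F}.
Implicit Types (f h : T -> K) (x y : K).

Lemma cvg_1subM f h x y : f t @[t --> F] --> x -> h t @[t --> F] --> y ->
  1 - f t * h t @[t --> F] --> 1 - x * y.
Proof. by move=> c1 c2; apply: cvgB; [exact: cvg_cst | exact: cvgM]. Qed.

Lemma cvg_exprn f x n : f t @[t --> F] --> x -> f t ^+ n @[t --> F] --> x ^+ n.
Proof.
move=> fx; elim: n => [|n IH].
  rewrite expr0 [X in X @ _](_ : _ = cst 1); first exact: cvg_cst.
  by apply/funext => p; rewrite expr0.
rewrite exprS [X in X @ _](_ : _ = fun p => f p * f p ^+ n); first exact: cvgM.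
by apply/funext => p; rewrite exprS.
Qed.

Lemma cvg_bipoly f h x y n (c : nat -> K) (p q : nat -> nat) :
  f t @[t --> F] --> x -> h t @[t --> F] --> y ->
  (\sum_(k < n) c k * h t ^+ p k * f t ^+ q k) @[t --> F] -->
  \sum_(k < n) c k * y ^+ p k * x ^+ q k.
Proof.
move=> c1 c2; elim: n => [|n IH].
  rewrite big_ord0 [X in X @ _](_ : _ = cst 0); first exact: cvg_cst.
  by apply/funext => t; rewrite big_ord0.
rewrite big_ord_recr /= [X in X @ _](_ : _ = fun t =>
  (\sum_(k < n) c k * h t ^+ p k * f t ^+ q k) + c n * h t ^+ p n * f t ^+ q n).
  apply: cvgD => //; apply: cvgM; last exact: cvg_exprn.
  by apply: cvgM; [exact: cvg_cst | exact: cvg_exprn].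
by apply/funext => t; rewrite big_ord_recr.
Qed.

End cvg_numField.

Section jet_kernel.
Variable R : realType.
Local Notation C := (Cx R).
Implicit Types (x : R) (X U w : C) (a b k : nat).

(* Closed form of d_X^a d_U^b (1 - X U)^(-x). *)
Definition jetk x a b X U : C :=
  cpow (1 - X * U) (- (x + (a + b)%:R)) *
  \sum_(k < a.+1) (gcoef x a b k)%:C * U ^+ (a - k) * X ^+ (b - k).

Lemma jetk_widen N x a b X U : (a < N)%N ->
  jetk x a b X U = cpow (1 - X * U) (- (x + (a + b)%:R)) *
    \sum_(k < N) (gcoef x a b k)%:C * U ^+ (a - k) * X ^+ (b - k).
Proof.
move=> aN; congr (_ * _).
rewrite (big_ord_widen N (fun k => (gcoef x a b k)%:C * U ^+ (a - k) * X ^+ (b - k))) //.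
rewrite [RHS](bigID (fun k : 'I_N => k < a.+1)%N) /=.
rewrite [X in _ = _ + X]big1 ?addr0 // => k; rewrite -leqNgt => ak.
by rewrite gcoef_gtl // rmorph0 !mul0r.
Qed.

Lemma jetkC x a b X U : jetk x a b X U = jetk x b a U X.
Proof.
rewrite (@jetk_widen (a + b).+1) ?ltnS ?leq_addr //.
rewrite (@jetk_widen (a + b).+1 _ b) ?ltnS ?leq_addl // (addnC b) (mulrC U X).
by congr (_ * _); apply: eq_bigr => k _; rewrite gcoefC mulrAC.
Qed.

Lemma jetk00 x X U : jetk x 0 0 X U = cpow (1 - X * U) (- x).
Proof.
by rewrite /jetk big_ord1 /= /gcoef rising0 !bin0 fact0 invr1 !mulr1 addr0.
Qed.

Lemma Re_1subM_gt0 X U : `|X| < 1 -> `|U| < 1 -> 0 < complex.Re (1 - X * U).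
Proof.
move=> X1 U1; have : `|X * U| < 1.
  by rewrite normrM; apply: (le_lt_trans _ X1); rewrite ler_piMr // ltW.
move: (X * U) => Z Z1; rewrite -ltcR.
have -> : (complex.Re (1 - Z))%:C = 1 - (complex.Re Z)%:C :> C.
  by apply/eqP; rewrite eq_complex /= oppr0 addr0; case: Z {Z1} => ? ? /=; rewrite !eqxx.
rewrite subr_gt0; apply: le_lt_trans Z1; apply: le_trans (normc_ge_Re Z).
by rewrite lecR ler_norm.
Qed.

Lemma wder_jetk x a b X U : 0 < x -> `|X| < 1 -> `|U| < 1 ->
  wder (fun v => jetk x a b v U) X (jetk x a.+1 b X U) 0.
Proof.
move=> x0 X1 U1; have rho0 := Re_1subM_gt0 X1 U1.
have drho : wder (fun v => 1 - v * U) X (- U) 0.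
  have := wderB (wder_cst 1 X) (wderZ U (wder_id X)).
  rewrite mulr1 mulr0 sub0r subrr; apply: near_wder.
  by apply: filterE => v; rewrite /= mulrC.
have dpow := wder_comp drho (wder_cpow (- (x + (a + b)%:R)) rho0).
rewrite mulr0 in dpow.
have dsum : wder (fun v => \sum_(k < a.+1) (gcoef x a b k)%:C * U ^+ (a - k) * v ^+ (b - k)) X
    (\sum_(k < a.+1) (gcoef x a b k)%:C * U ^+ (a - k) * ((b - k)%:R * X ^+ (b - k).-1)) 0.
  have := @wder_sum R 'I_a.+1 (index_enum _) xpredT _ X _ _ (fun (k : 'I_a.+1) _ =>
    wderZ ((gcoef x a b k)%:C * U ^+ (a - k)) (wderX (b - k) (wder_id X))).
  rewrite [X in wder _ _ _ X]big1 => [|k _]; last by rewrite !mulr0.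
  by under eq_bigr do rewrite mulr1.
have := wderM dpow dsum; rewrite mul0r mulr0 addr0.
suff -> : (- (x + (a + b)%:R))%:C * cpow (1 - X * U) (- (x + (a + b)%:R) - 1) * - U *
  (\sum_(k < a.+1) (gcoef x a b k)%:C * U ^+ (a - k) * X ^+ (b - k)) +
  cpow (1 - X * U) (- (x + (a + b)%:R)) *
  (\sum_(k < a.+1) (gcoef x a b k)%:C * U ^+ (a - k) * ((b - k)%:R * X ^+ (b - k).-1))
  = jetk x a.+1 b X U by [].
have -> : cpow (1 - X * U) (- (x + (a + b)%:R)) =
    cpow (1 - X * U) (- (x + (a + b)%:R) - 1) * (1 - X * U).
  by rewrite -{3}(cpow1 rho0) -cpowD subrK.
rewrite /jetk addSn -[(a + b).+1%:R]natr1 addrA [- (_ + 1)]opprD.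
rewrite -[_ * _ * - U]mulrA [_%:C * _]mulrC -!mulrA -mulrDr; congr (_ * _).
rewrite [RHS]big_ord_recl /= gcoefS0.
under [X in _ = _ + X]eq_bigr => k _ do rewrite /bump /= add1n gcoefSS // rmorphD !mulrDl subSS.
rewrite big_split /= addrA.
have -> : (gcoef x a b 0 * (x + a%:R))%:C * U ^+ (a.+1 - 0) * X ^+ (b - 0) +
  \sum_(i < a.+1) (gcoef x a b i.+1 * (x + a%:R + i.+1%:R))%:C * U ^+ (a - i) * X ^+ (b - i.+1) =
  \sum_(i < a.+1) (gcoef x a b i * (x + a%:R + i%:R))%:C * U ^+ (a.+1 - i) * X ^+ (b - i).
  rewrite [in LHS]big_ord_recr /= (@gcoef_gtl _ _ _ _ a.+1) // mul0r rmorph0 !mul0r addr0.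
  by rewrite [RHS]big_ord_recl /= addr0.
rewrite !mulrA !mulr_sumr -!big_split /=; apply: eq_bigr => k _.
have ka : (k <= a)%N by rewrite -ltnS.
(* Exponents are truncated at 0: for b < k the coefficient is 0, for b = k the factor b - k is 0,
   and only for k < b is the predecessor a true difference. *)
rewrite (subSn ka) exprS; have [bk|] := ltnP b k.
  by rewrite gcoef_gtr // !mul0r ?mulr0 ?mul0r ?addr0.
rewrite leq_eqVlt => /orP[/eqP kb|kb].
  rewrite -kb subnn; move: (gcoef _ _ _ _) => c.
  rewrite !rmorphM !rmorphN !rmorphD !rmorph_nat /=; ring.
have -> : (b - k.+1 = (b - k).-1)%N by rewrite subnS.
have bE : (b = k + (b - k))%N by rewrite subnKC // ltnW.
rewrite [in (a + b)%:R]bE; move: (gcoef _ _ _ _) => c.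
have : (0 < b - k)%N by rewrite subn_gt0.
case: (b - k)%N => // p _; move: (a - k)%N => q /=.
rewrite !natrD !rmorphM !rmorphN !rmorphD !rmorph_nat /= exprS; ring.
Qed.

Lemma wder_jetkr x a b X U : 0 < x -> `|X| < 1 -> `|U| < 1 ->
  wder (jetk x a b X) U (jetk x a b.+1 X U) 0.
Proof.
move=> x0 X1 U1; rewrite jetkC; have := wder_jetk b a x0 U1 X1.
by apply: near_wder; apply: filterE => v; rewrite jetkC.
Qed.

Lemma cvg_cpow (T : Type) (F : set_system T) (FF : Filter F) (f : T -> C) (u : C) (g : R) :
  0 < complex.Re u -> f t @[t --> F] --> u -> cpow (f t) g @[t --> F] --> cpow u g.
Proof.
move=> u0 fu; have : differentiable ((fun v => cpow v g) : C -> C) u.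
  by apply/derivable1_diffP; have /wder_is_derive[] := wder_cpow g u0.
move=> /differentiable_continuous cg.
exact: (cvg_comp f _ fu cg).
Qed.

Lemma cvg_jetk (T : Type) (F : set_system T) (FF : Filter F) (f h : T -> C) x a b (X U : C) :
  `|X| < 1 -> `|U| < 1 -> f t @[t --> F] --> X -> h t @[t --> F] --> U ->
  jetk x a b (f t) (h t) @[t --> F] --> jetk x a b X U.
Proof.
move=> X1 U1 c1 c2; have rho0 := Re_1subM_gt0 X1 U1.
have c3 := cvg_cpow FF (g := - (x + (a + b)%:R)) rho0 (cvg_1subM c1 c2).
have c4 := cvg_bipoly (n := a.+1) (c := fun k => (gcoef x a b k)%:C)
  (p := fun k => (a - k)%N) (q := fun k => (b - k)%N) c1 c2.
exact: (cvgM (c3 FF) (c4 FF)).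
Qed.

End jet_kernel.

Section jet_kernel_continuity.
Variable R : realType.
Local Notation C := (Cx R).
Implicit Types (x : R) (X U : C) (a b : nat).

Lemma jetk_continuous x a b X U (e : C) : `|X| < 1 -> `|U| < 1 -> 0 < e ->
  exists2 d : C, 0 < d & forall s t : C, `|s| < d -> `|t| < d ->
    [/\ `|X + s| < 1, `|U + t| < 1 & `|jetk x a b (X + s) (U + t) - jetk x a b X U| <= e].
Proof.
move=> X1 U1 e0.
have c1 : (p : C * C).1 @[p --> (X, U)] --> X by apply: cvg_fst.
have c2 : (p : C * C).2 @[p --> (X, U)] --> U by apply: cvg_snd.
have /cvgrPdist_le/(_ e e0)H : jetk x a b p.1 p.2 @[p --> (X, U)] --> jetk x a b X U.
  exact: (@cvg_jetk R (C * C)%type _ _ fst snd x a b X U X1 U1 c1 c2).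

have N1 : \forall p \near ((X, U) : C * C), `|p.1| < 1 by exact: (cvgr_norm_lt _ c1).
have N2 : \forall p \near ((X, U) : C * C), `|p.2| < 1 by exact: (cvgr_norm_lt _ c2).
have [[A B] /= [XA UB] AB] := filterI H (filterI N1 N2).
have [d /= d0 Hd] := (nbhs_normP _ _).1 (filterI (near0_add XA) (near0_add UB)).
exists d => // s t sd td.
have [|As _] := Hd s; first by rewrite /= sub0r normrN.
have [|_ Bt] := Hd t; first by rewrite /= sub0r normrN.
by have [|H1 [H2 H3]] := AB (X + s, U + t); rewrite // distrC.
Qed.

End jet_kernel_continuity.

(** * Mean value inequalities and second differences *)

Section complex_mean_value.
Variable R : realType.
Local Notation C := (Cx R).

Lemma Re_normE (z : C) : (complex.Re `|z|)%:C = `|z|.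
Proof. by rewrite normc_def. Qed.

Lemma Re_norm_ge0 (z : C) : 0 <= complex.Re `|z|.
Proof. by have := normr_ge0 z; rewrite -[X in _ <= X]Re_normE lecR. Qed.

Lemma is_derive_line (f : C -> C) (x h a c : C) (t : R) :
  wder f (x + t%:C * h) a 0 ->
  is_derive t 1 (fun s : R => complex.Re (c * f (x + s%:C * h))) (complex.Re (c * (a * h))).
Proof.
move=> Hf; apply/is_deriveP => e e0.
pose M := complex.Re (`|c| * `|h|) + 1.
have M0 : 0 < M by rewrite ltr_wpDl // -normrM Re_norm_ge0.
have ME : `|c| * `|h| <= M%:C.
  by rewrite /M -normrM rmorphD /= Re_normE lerDl ler01.
have eM : 0 < (e / M)%:C :> C by rewrite ltcR divr_gt0.
have [d /= /cx_gt0E[d0 ->] Hd] := (nbhs_normP _ _).1 (Hf _ eM).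
have [N /= N0 NE] : exists2 N : R, 0 < N & `|h| <= N%:C.
  exists (complex.Re `|h| + 1); first by rewrite ltr_wpDl // Re_norm_ge0.
  by rewrite rmorphD /= Re_normE lerDl ler01.
apply/nbhs_normP; exists (complex.Re d / N); first by rewrite /= divr_gt0.
move=> s /=; rewrite sub0r normrN => sd.
have sh : `|s%:C * h| <= `|s|%:C * N%:C by rewrite normrM normc_real ler_wpM2l // lecR.
have := Hd (s%:C * h); rewrite /= sub0r normrN mul0r addr0 => H.
have {}H : `|f (x + t%:C * h + s%:C * h) - f (x + t%:C * h) - a * (s%:C * h)| <=
    (e / M)%:C * `|s%:C * h|.
  by apply: H; apply: (le_lt_trans sh); rewrite -rmorphM ltcR -ltr_pdivlMr.
rewrite rmorphD mulrDl addrA.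
have -> : complex.Re (c * f (x + t%:C * h + s%:C * h)) - complex.Re (c * f (x + t%:C * h)) -
  complex.Re (c * (a * h)) * s =
  complex.Re (c * (f (x + t%:C * h + s%:C * h) - f (x + t%:C * h) - a * (s%:C * h))).
  move: (f (x + _ + _)) (f (x + _)) => [y1 y2] [z1 z2]; case: (c) (a) (h) => [? ?] [? ?] [? ?].
  by rewrite /=; ring.
rewrite -lecR; apply: (le_trans (normc_ge_Re _)).
rewrite normrM; apply: le_trans (ler_wpM2l _ H) _ => //.
rewrite normrM normc_real !rmorphM.
have -> : `|c| * (e%:C * (M^-1)%:C * (`|s|%:C * `|h|)) = (`|c| * `|h|) * ((e%:C * (M^-1)%:C) * `|s|%:C) by ring.
have -> : e%:C * `|s|%:C = M%:C * ((e%:C * (M^-1)%:C) * `|s|%:C) :> C.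
  by rewrite -!rmorphM; congr (_%:C); field; rewrite gt_eqF.
apply: ler_wpM2r => //; rewrite -!rmorphM lecR !mulr_ge0 ?invr_ge0 //; exact: ltW.
Qed.

(** For D the remainder to be bounded, the real mean value theorem is applied to the real part of
    conj D (f v - L v) along the segment: its increment is |D|^2 and its derivative at most |D| e
    |h|, so one factor |D| cancels. *)
Lemma complex_mvt (f f' : C -> C) (x h L e : C) :
  (forall t : R, 0 <= t <= 1 -> wder f (x + t%:C * h) (f' (x + t%:C * h)) 0) ->
  (forall t : R, 0 <= t <= 1 -> `|f' (x + t%:C * h) - L| <= e) ->
  `|f (x + h) - f x - L * h| <= e * `|h|.
Proof.
move=> df be; set D := _ - _ - _.
have e0 : 0 <= e by apply: le_trans (be 0 _); rewrite ?lexx ?ler01.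
pose c := Num.conj D; pose F (v : C) := f v - L * v.
pose psi (s : R) := complex.Re (c * F (x + s%:C * h)).
pose dpsi (s : R) := complex.Re (c * ((f' (x + s%:C * h) - L) * h)).
have dF (t : R) : 0 <= t <= 1 -> is_derive t 1 psi (dpsi t).
  move=> t01; apply: is_derive_line; have := wderB (df t t01) (wderZ L (wder_id (x + t%:C * h))).
  by rewrite mulr1 mulr0 subr0.
have [||t t01 E] := @MVT_segment R psi dpsi 0 1 ler01.
- by move=> t; rewrite in_itv /= => /andP[t0 t1]; apply: dF; rewrite !ltW.
- apply: derivable_within_continuous => t; rewrite in_itv /= => t01.
  by have [] := dF t t01.
move: t01; rewrite in_itv /= => t01; move: E; rewrite subr0 mulr1.
have -> : psi 1 - psi 0 = complex.Re (c * D).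
  rewrite /psi /F /D rmorph0 mul0r addr0 rmorph1 mul1r.
  move: (f (x + h)) (f x) (c) => [y1 y2] [z1 z2] [c1 c2]; case: (L) (h) (x) => [? ?] [? ?] [? ?].
  by rewrite /=; ring.
have -> : c * D = `|D| * `|D| by rewrite /c mulrC -normCK expr2.
move=> /(congr1 (fun r : R => r%:C : C)) E.
have : `|D| * `|D| <= `|D| * (e * `|h|).
  have -> : `|D| * `|D| = (dpsi t)%:C.
    by rewrite -E -normrM Re_normE.
  apply: le_trans (_ : `|dpsi t|%:C <= _); first by rewrite lecR ler_norm.
  apply: (le_trans (normc_ge_Re _)); rewrite !normrM norm_conjC ler_wpM2l //.
  by rewrite ler_wpM2r // be.
have [->|D0] := eqVneq D 0; first by rewrite normr0 mulr_ge0.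
by rewrite ler_pM2l // normr_gt0.
Qed.

End complex_mean_value.

Section second_order.
Variable R : realType.
Local Notation C := (Cx R).
Implicit Types (x : R) (X U w : C) (a b : nat).

Lemma norm_scale_le (t : R) (s : C) : 0 <= t <= 1 -> `|t%:C * s| <= `|s|.
Proof.
move=> /andP[t0 t1]; rewrite normrM normc_real (ger0_norm t0) ler_piMl //.
by rewrite -[X in _ <= X](rmorph1 (real_complex R)) lecR.
Qed.

(** The mean value inequality in U, then in X. The error is relative to |s| |t|, as needed to divide
    by both increments in the inner product of two difference quotients. *)
Lemma jetk_diff2 x a b X U (e : C) : 0 < x -> `|X| < 1 -> `|U| < 1 -> 0 < e ->
  exists2 d : C, 0 < d & forall s t : C, `|s| < d -> `|t| < d ->
    `|jetk x a b (X + s) (U + t) - jetk x a b (X + s) U - jetk x a b X (U + t)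
      + jetk x a b X U - jetk x a.+1 b.+1 X U * (s * t)| <= e * (`|s| * `|t|).
Proof.
move=> x0 X1 U1 e0; have [d d0 Hd] := jetk_continuous x a.+1 b.+1 X1 U1 e0.
exists d => // s t sd td; pose L := jetk x a.+1 b.+1 X U.
have scale (k : C) (r : R) : `|k| < d -> 0 <= r <= 1 -> `|r%:C * k| < d.
  by move=> kd r01; apply: le_lt_trans kd; apply: norm_scale_le.
have inner (r : R) : 0 <= r <= 1 ->
    `|jetk x a.+1 b (X + r%:C * s) (U + t) - jetk x a.+1 b (X + r%:C * s) U - L * t| <= e * `|t|.
  move=> r01.
  apply: (@complex_mvt _ _ (fun u => jetk x a.+1 b.+1 (X + r%:C * s) u)) => q q01.
    by have [? ? _] := Hd _ _ (scale s r sd r01) (scale t q td q01); apply: wder_jetkr.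
  by have [] := Hd _ _ (scale s r sd r01) (scale t q td q01).
have -> : jetk x a b (X + s) (U + t) - jetk x a b (X + s) U - jetk x a b X (U + t)
    + jetk x a b X U - L * (s * t) = (jetk x a b (X + s) (U + t) - jetk x a b (X + s) U) -
    (jetk x a b X (U + t) - jetk x a b X U) - (L * t) * s by ring.
rewrite [X in _ <= e * X]mulrC mulrA.
apply: (@complex_mvt _ (fun v => jetk x a b v (U + t) - jetk x a b v U)
  (fun v => jetk x a.+1 b v (U + t) - jetk x a.+1 b v U)) => r r01; last exact: inner.
have [Xs Ut _] := Hd _ _ (scale s r sd r01) td.
by rewrite -[0](subrr (0 : C)); apply: wderB; apply: wder_jetk.
Qed.

(** The move along the diagonal is split into a move in U at X = w and a move in X at the displaced
    U; the latter is controlled by joint continuity of the derivative. *)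
Lemma wder_jetk_diag x a b w : 0 < x -> `|w| < 1 ->
  wder (fun v => jetk x a b v (Num.conj v)) w
    (jetk x a.+1 b w (Num.conj w)) (jetk x a b.+1 w (Num.conj w)).
Proof.
move=> x0 w1; have u1 : `|Num.conj w| < 1 by rewrite norm_conjC.
apply: (@wder_le _ 2) => // e e0.
have [d d0 Hd] := jetk_continuous x a.+1 b w1 u1 e0.
have dn : \forall h \near (0 : C), `|h| < d by apply: nbhs0_lt.
have := wder_conj (wder_conj (wder_jetkr a b x0 w1 u1)); rewrite !conjCK => H.
have {}H : \forall h \near (0 : C), `|jetk x a b w (Num.conj w + Num.conj h) -
    jetk x a b w (Num.conj w) - jetk x a b.+1 w (Num.conj w) * Num.conj h| <= e * `|h|.
  have /nbhs_normP[r /= r0 Hr] := wder_jetkr a b x0 w1 u1 e0.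
  apply/nbhs_normP; exists r => // h /=; rewrite sub0r normrN => hr.
  have := Hr (Num.conj h); rewrite /= sub0r normrN norm_conjC mul0r addr0; exact.
apply: filterS2 dn H => h hd H.
rewrite rmorphD /=; set k := Num.conj h in H *; set u := Num.conj w in H *.
have kd : `|k| < d by rewrite norm_conjC.
have -> : jetk x a b (w + h) (u + k) - jetk x a b w u -
    (jetk x a.+1 b w u * h + jetk x a b.+1 w u * k) =
  (jetk x a b (w + h) (u + k) - jetk x a b w (u + k) - jetk x a.+1 b w u * h) +
  (jetk x a b w (u + k) - jetk x a b w u - jetk x a b.+1 w u * k) by ring.
rewrite mulr_natl mulr2n mulrDl; apply: (le_trans (ler_normD _ _)); apply: lerD => //.
have scale (r : R) : 0 <= r <= 1 -> `|r%:C * h| < d.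
  by move=> r01; apply: le_lt_trans hd; apply: norm_scale_le.
apply: (@complex_mvt _ (fun v => jetk x a b v (u + k)) (fun v => jetk x a.+1 b v (u + k))) => r r01.
  by have [? ? _] := Hd _ _ (scale r r01) kd; apply: wder_jetk.
by have [] := Hd _ _ (scale r r01) kd.
Qed.

(* Equality of the mixed second differences taken along h and ih. *)
Lemma wder_holomorphic (p q : C -> C) w c d :
  (\forall v \near w, wder p v (q v) 0) -> wder q w c d -> d = 0.
Proof.
move=> Hp Hq; apply/eqP; rewrite -normr_le0; apply/ler_addgt0Pl => e e0; rewrite addr0.
have e3 : 0 < e / 3 by rewrite divr_gt0.
have [r /= r0 Hr] := (nbhs_normP _ _).1 (filterI (near0_add Hp) (Hq _ e3)).
(* The function p (v + k) - p v has derivative q (v + k) - q v, which near w is c k + d conj k up to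
   e |k|. *)
have step (k l : C) : `|k| + `|l| < r -> `|k| = `|l| ->
    `|(p (w + l + k) - p (w + l)) - (p (w + k) - p w) - (c * k + d * Num.conj k) * l| <= e * `|k| * `|l|.
  move=> klr kl.
  have lr (t : R) : 0 <= t <= 1 -> `|t%:C * l| < r.
    move=> t01; apply: le_lt_trans (norm_scale_le l t01) _.
    by apply: le_lt_trans klr; rewrite lerDr.
  have lkr (t : R) : 0 <= t <= 1 -> `|t%:C * l + k| < r.
    move=> t01; apply: le_lt_trans klr; apply: (le_trans (ler_normD _ _)).
    by rewrite addrC lerD2l norm_scale_le.
  apply: (@complex_mvt _ (fun v => p (v + k) - p v) (fun v => q (v + k) - q v) w l) => t t01.
    rewrite -[X in wder _ _ _ X](subrr (0 : C)); apply: wderB.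
      have [|H _] := Hr (t%:C * l + k); first by rewrite /= sub0r normrN lkr.
      have {}H : wder p (w + t%:C * l + k) (q (w + t%:C * l + k)) 0 by rewrite -addrA.
      have sh : wder (fun v => v + k) (w + t%:C * l) 1 0.
        by have := wderD (wder_id (w + t%:C * l)) (wder_cst k (w + t%:C * l)); rewrite !addr0.
      by have := wder_comp sh H; rewrite mulr1 mulr0.
    by have [|H _] := Hr (t%:C * l); rewrite //= sub0r normrN lr.
  rewrite -(addrA w).
  have [|_ H1] := Hr (t%:C * l + k); first by rewrite /= sub0r normrN lkr.
  have [|_ H2] := Hr (t%:C * l); first by rewrite /= sub0r normrN lr.
  set A := q (w + (_ + _)) in H1 *; set B := q (w + _) in H2 *.
  have -> : A - B - (c * k + d * Num.conj k) =
      (A - q w - (c * (t%:C * l + k) + d * Num.conj (t%:C * l + k))) -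
      (B - q w - (c * (t%:C * l) + d * Num.conj (t%:C * l))) by rewrite !rmorphD; ring.
  apply: (le_trans (ler_normB _ _)).
  have -> : e * `|k| = e / 3 * (`|k| + `|k|) + e / 3 * `|k| by field.
  apply: lerD; [apply: (le_trans H1) | apply: (le_trans H2)]; rewrite ler_pM2l //.
    by apply: (le_trans (ler_normD _ _)); rewrite lerD2r kl norm_scale_le.
  by rewrite kl norm_scale_le.
have h0 : 0 < r / 3 by rewrite divr_gt0.
pose h := r / 3; have hn : `|h| = h by rewrite gtr0_norm.
have hc : Num.conj h = h by apply/CrealP; exact: gtr0_real.
have in1 : `|'i%R * h| = h by rewrite normrM normCi mul1r.
have rh : h + h < r.
  have -> : r = h + h + h by rewrite /h; field.
  by rewrite ltrDl.
have := step ('i%R * h) h; rewrite in1 hn => /(_ rh erefl) s1.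
have := step h ('i%R * h); rewrite in1 hn => /(_ rh erefl) s2.
have {}h0 : 0 < h := h0; clearbody h.
rewrite rmorphM /= in s1; rewrite (conjCi C) hc in s1; rewrite hc in s2.
(* The two second differences coincide, the terms in c cancel, and those in d add up, because
   conjugation changes the sign of i. *)
have : `|2 * 'i%R * d * (h * h)| <= 2 * e * (h * h).
  have -> : 2 * 'i%R * d * (h * h) =
   ((p (w + h + 'i%R * h) - p (w + h)) - (p (w + 'i%R * h) - p w) - (c * ('i%R * h) + d * (- 'i%R * h)) * h) -
   ((p (w + 'i%R * h + h) - p (w + 'i%R * h)) - (p (w + h) - p w) - (c * h + d * h) * ('i%R * h)).
    by rewrite (addrAC w h); ring.
  apply: (le_trans (ler_normB _ _)).
  have -> : 2 * e * (h * h) = e * h * h + e * h * h by ring.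
  exact: lerD.
rewrite !normrM normCi mulr1 hn (gtr0_norm (ltr0n _ 2)) ler_pM2r ?mulr_gt0 //.
by rewrite ler_pM2l.
Qed.

End second_order.

(** * Gram matrices of jets *)

Section reproducing_kernel_space.
Variables (R : realType) (T : Type) (K : T -> T -> Cx R) (H : rkhs K).
Local Notation C := (Cx R).
Local Notation "<< f , g >>" := (rk_inner H f g) (at level 0).
Implicit Types (f g h : T -> C) (c : C).

Lemma rk_spaceZ c f : rk_space H f -> rk_space H (fun x => c * f x).
Proof.
move=> Hf; have := rk_spaceP c Hf (rk_space0 H).
by congr (rk_space H); apply/funext => x; rewrite addr0.
Qed.

Lemma rk_spaceB f g : rk_space H f -> rk_space H g -> rk_space H (fun x => f x - g x).
Proof.
move=> Hf Hg; have := rk_spaceP (-1) Hg Hf.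
by congr (rk_space H); apply/funext => x; rewrite mulN1r addrC.
Qed.

Lemma rk_inner0l g : rk_space H g -> << (fun=> 0), g >> = 0.
Proof.
move=> Hg; have := rk_linear 1 (rk_space0 H) (rk_space0 H) Hg.
set z := << (fun=> 0), g >> => Hz; have {Hz} : z = z + z.
  rewrite -{2}[z]mul1r -Hz; congr (rk_inner H _ _).
  by apply/funext => x; rewrite mulr0 addr0.
by move=> /eqP; rewrite -subr_eq0 opprD addNKr oppr_eq0 => /eqP.
Qed.

Lemma rk_innerZl c f g : rk_space H f -> rk_space H g ->
  << (fun x => c * f x), g >> = c * << f, g >>.
Proof.
move=> Hf Hg; have := rk_linear c Hf (rk_space0 H) Hg; rewrite rk_inner0l // addr0 => <-.
by congr (rk_inner H _ _); apply/funext => x; rewrite addr0.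
Qed.

Lemma rk_innerBl f g h : rk_space H f -> rk_space H g -> rk_space H h ->
  << (fun x => f x - g x), h >> = << f, h >> - << g, h >>.
Proof.
move=> Hf Hg Hh; have := rk_linear (-1) Hg Hf Hh; rewrite mulN1r addrC => <-.
by congr (rk_inner H _ _); apply/funext => x; rewrite mulN1r addrC.
Qed.

Lemma rk_innerZr c f g : rk_space H f -> rk_space H g ->
  << f, (fun x => c * g x) >> = Num.conj c * << f, g >>.
Proof.
move=> Hf Hg; rewrite (rk_conj (rk_spaceZ c Hg) Hf) rk_innerZl // rmorphM /=.
by rewrite -(rk_conj Hg Hf).
Qed.

Lemma rk_innerBr f g h : rk_space H f -> rk_space H g -> rk_space H h ->
  << h, (fun x => f x - g x) >> = << h, f >> - << h, g >>.
Proof.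
move=> Hf Hg Hh; rewrite (rk_conj (rk_spaceB Hf Hg) Hh) rk_innerBl // rmorphB /=.
by rewrite -(rk_conj Hf Hh) -(rk_conj Hg Hh).
Qed.

Lemma rk_cauchy_schwarz f g : rk_space H f -> rk_space H g ->
  `|<< f, g >>| ^+ 2 <= << f, f >> * << g, g >>.
Proof.
move=> Hf Hg; have [g0|gn0] := eqVneq << g, g >> 0.
  rewrite (rk_conj Hg Hf) (rk_eq0 Hg g0) rk_inner0l // rmorph0 normr0 expr0n mulr_ge0 ?rk_ge0 //.
  exact: rk_space0.
have gg : 0 < << g, g >> by rewrite lt_def gn0 rk_ge0.
pose c := << f, g >> / << g, g >>.
have := rk_ge0 (rk_spaceB Hf (rk_spaceZ c Hg)).
rewrite rk_innerBl ?rk_innerBr ?rk_innerZl ?rk_innerZr //; try by [apply: rk_spaceZ | apply: rk_spaceB => //; apply: rk_spaceZ].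
rewrite (rk_conj Hf Hg) /c !rmorphM fmorphV /= (CrealP (gtr0_real gg)) normCK => h.
have {}h : 0 <= << f, f >> - << f, g >> * Num.conj << f, g >> / << g, g >>.
  by apply: (le_trans h); rewrite le_eqVlt; apply/orP; left; apply/eqP; field.
by rewrite -ler_pdivrMr // -subr_ge0.
Qed.

Definition seq_lim (s : nat -> C) (l : C) := forall e : C, 0 < e ->
  exists N : nat, forall i, (N <= i)%N -> `|s i - l| <= e.

(** Since |u_i - u_j|^2 is an alternating sum of four inner products, their convergence to one
    number L makes the sequence Cauchy, with no candidate for the limit. Weak convergence is enough
    to identify the limit afterwards. *)
Lemma rk_limit (u : nat -> T -> C) (L : C) : (forall i, rk_space H (u i)) ->
  (forall e : C, 0 < e -> exists N : nat, forall i j, (N <= i)%N -> (N <= j)%N ->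
    `|<< u i, u j >> - L| <= e) ->
  exists2 f, rk_space H f & forall g, rk_space H g -> seq_lim (fun i => << u i, g >>) << f, g >>.
Proof.
move=> Hu cu.
have [e e0|f Hf lf] := @rk_complete _ _ _ H u Hu.
  have e5 : 0 < (e / 5)%:C :> C by rewrite ltcR divr_gt0.
  have [N HN] := cu _ e5; exists N => i j Ni Nj.
  have -> : << (fun x => u i x - u j x), (fun x => u i x - u j x) >> =
     (<< u i, u i >> - L) - (<< u i, u j >> - L) - (<< u j, u i >> - L) + (<< u j, u j >> - L).
    by rewrite rk_innerBl ?rk_innerBr //; [ring | exact: rk_spaceB].
  set A := _ + _; have A0 : 0 <= A.
    have := rk_ge0 (rk_spaceB (Hu i) (Hu j)); rewrite rk_innerBl ?rk_innerBr //; last exact: rk_spaceB.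
    by congr (0 <= _); rewrite /A; ring.
  rewrite -(ger0_norm A0); apply: (@le_lt_trans _ _ (4%:R * (e / 5)%:C)).
    rewrite /A; have -> : 4%:R * (e / 5)%:C = (e / 5)%:C + (e / 5)%:C + (e / 5)%:C + (e / 5)%:C :> C by ring.
    apply: (le_trans (ler_normD _ _)); apply: lerD; last exact: HN.
    apply: (le_trans (ler_normB _ _)); apply: lerD; last exact: HN.
    by apply: (le_trans (ler_normB _ _)); apply: lerD; exact: HN.
  rewrite -(rmorph_nat (real_complex R)) -rmorphM ltcR; lra.
exists f => // g Hg e e0.
pose B := << g, g >> + 1; have B0 : 0 < B by rewrite ltr_wpDl // rk_ge0.
have e1 : 0 < e ^+ 2 / B by rewrite divr_gt0 ?exprn_gt0.
have [e2 eE] := cx_gt0E e1.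
have [N HN] := lf _ e2; exists N => i /HN; rewrite -eE => h.
rewrite -rk_innerBl // -(@ler_pXn2r _ 2) ?nnegrE ?(ltW e0) //.
apply: (le_trans (rk_cauchy_schwarz (rk_spaceB (Hu i) Hf) Hg)).
have -> : e ^+ 2 = e ^+ 2 / B * B by rewrite divfK // gt_eqF.
apply: ler_pM; rewrite ?rk_ge0 ?lerDl ?ler01 ?(ltW h) //; exact: rk_spaceB.
Qed.

Lemma seq_lim_unique (s : nat -> C) l l' : seq_lim s l -> seq_lim s l' -> l = l'.
Proof.
move=> H1 H2; apply/subr0_eq/eqP; rewrite -normr_le0; apply/ler_addgt0Pl => e e0.
rewrite addr0; have e2 : 0 < e / 2 by rewrite divr_gt0.
have [N HN] := H1 _ e2; have [N' HN'] := H2 _ e2.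
have -> : l - l' = (s (maxn N N') - l') - (s (maxn N N') - l) by ring.
apply: (le_trans (ler_normB _ _)); have -> : e = e / 2 + e / 2 by field.
by apply: lerD; [apply: HN'; apply: leq_maxr | apply: HN; apply: leq_maxl].
Qed.

End reproducing_kernel_space.

Section jet_vectors.
Variables (R : realType) (m : nat) (alpha : 'I_m -> R).
Hypothesis halpha : forall j, 0 < alpha j.
Variable M : Halpha alpha.
Local Notation C := (Cx R).
Local Notation T := (@polydisc R m).
Local Notation "<< f , g >>" := (rk_inner M f g) (at level 0).
Implicit Types (a b : 'I_m -> nat) (v : 'I_m -> C) (z : T).

Lemma conjc_realE (c : R) : Num.conj (c%:C : C) = c%:C.
Proof. exact: conjc_real. Qed.

Lemma jetk_conj x (p q : nat) (X U : C) : `|X| < 1 -> `|U| < 1 ->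
  Num.conj (jetk x p q X U) = jetk x p q (Num.conj X) (Num.conj U).
Proof.
move=> X1 U1; rewrite /jetk rmorphM /= cpow_conj ?Re_1subM_gt0 // rmorphB rmorph1 rmorphM /=.
congr (_ * _); rewrite rmorph_sum; apply: eq_bigr => k _.
by move: (gcoef _ _ _ _) => c; rewrite !rmorphM !rmorphXn /= conjc_realE.
Qed.

(** Jets at any point of the polydisc, not only on the diagonal: the difference quotients below move
    a single coordinate. *)
Definition jetf a v : T -> C := fun z => \prod_j jetk (alpha j) (a j) 0 (v j) (\val z ord0 j).

Definition jetg a b v v' : C :=
  \prod_j jetk (alpha j) (a j) (b j) (v j) (Num.conj (v' j)).

Lemma polydisc_lt1 z j : `|\val z ord0 j| < 1.
Proof. by have := set_mem (valP z); apply. Qed.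

Lemma polydisc_row v : (forall j, `|v j| < 1) -> (\row_j v j) \in T.
Proof. by move=> hv; apply/mem_set => j; rewrite mxE. Qed.

Definition polydisc_point v (hv : forall j, `|v j| < 1) : T :=
  exist _ (\row_j v j) (polydisc_row hv).

Lemma polydisc_pointE v (hv : forall j, `|v j| < 1) j : \val (polydisc_point hv) ord0 j = v j.
Proof. by rewrite mxE. Qed.

Lemma norm_conj_lt1 v : (forall j, `|v j| < 1) -> forall j, `|Num.conj (v j)| < 1.
Proof. by move=> hv j; rewrite norm_conjC. Qed.

Lemma jetf0 v (hv : forall j, `|v j| < 1) : jetf (fun=> 0%N) v =
  fun z => polydisc_kernel alpha (\val z) (\val (polydisc_point (norm_conj_lt1 hv))).
Proof.
apply/funext => z; apply: eq_bigr => j _.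
by rewrite jetk00 polydisc_pointE conjCK mulrC.
Qed.

Lemma jetf_conj a v (hv : forall j, `|v j| < 1) v' (hv' : forall j, `|v' j| < 1) :
  Num.conj (jetf a v (polydisc_point (norm_conj_lt1 hv'))) = jetg (fun=> 0%N) a v' v.
Proof.
rewrite rmorph_prod; apply: eq_bigr => j _.
by rewrite polydisc_pointE /= jetk_conj ?norm_conjC // conjCK jetkC.
Qed.

Definition upd (A : Type) (f : 'I_m -> A) j x : 'I_m -> A := fun i => if i == j then x else f i.

Lemma upd_id (A : Type) (f : 'I_m -> A) j : upd f j (f j) = f.
Proof. by apply/funext => i; rewrite /upd; case: eqP => [->|]. Qed.

Lemma jetf_upd a v j p y z : jetf (upd a j p) (upd v j y) z =
  jetk (alpha j) p 0 y (\val z ord0 j) *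
  \prod_(i | i != j) jetk (alpha i) (a i) 0 (v i) (\val z ord0 i).
Proof.
rewrite /jetf (bigD1 j) //= /upd eqxx; congr (_ * _).
by apply: eq_bigr => i /negbTE ->.
Qed.

Lemma jetg_upd a b v v' j p q y y' : jetg (upd a j p) (upd b j q) (upd v j y) (upd v' j y') =
  jetk (alpha j) p q y (Num.conj y') *
  \prod_(i | i != j) jetk (alpha i) (a i) (b i) (v i) (Num.conj (v' i)).
Proof.
rewrite /jetg (bigD1 j) //= /upd eqxx; congr (_ * _).
by apply: eq_bigr => i /negbTE ->.
Qed.

Lemma null_sequence (r : C) : 0 < r ->
  exists h : nat -> C, [/\ forall i, 0 < h i, forall i, h i < r & seq_lim h 0].
Proof.
move=> r0; exists (fun i => r / i.+2%:R); split=> [i|i|e e0].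
- by rewrite divr_gt0.
- by rewrite ltr_pdivrMr // ltr_pMr // ltr1n.
have [r1 rE] := cx_gt0E r0; have [e1 eE] := cx_gt0E e0.
set x := complex.Re r in r1 rE; set y := complex.Re e in e1 eE.
exists (Num.bound (x / y)) => i iN; rewrite subr0 normf_div !gtr0_norm //.
rewrite ler_pdivrMr // rE eE -(rmorph_nat (real_complex R)) -rmorphM lecR.
rewrite mulrC -ler_pdivrMr //; apply: ltW.
have /lt_le_trans := archi_boundP (ltW (divr_gt0 r1 e1)); apply.
by rewrite ler_nat (leq_trans iN) // -addn2 leq_addr.
Qed.

Lemma seq_lim_quotient (phi : C -> C) (P y l : C) (h : nat -> C) : wder phi y l 0 ->
  (forall i, 0 < h i) -> seq_lim h 0 ->
  seq_lim (fun i => (h i)^-1 * (P * phi (y + h i) - P * phi y)) (P * l).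
Proof.
move=> dphi h0 hl e e0; have P1 : 0 < `|P| + 1 by rewrite ltr_wpDl.
have [d /= d0 Hd] := (nbhs_normP _ _).1 (dphi _ (divr_gt0 e0 P1)).
have d2 : 0 < d / 2 by rewrite divr_gt0.
have [N HN] := hl _ d2; exists N => i /HN; rewrite subr0 => hi.
have := Hd (h i); rewrite /= sub0r normrN mul0r addr0 => H.
have {}H : `|phi (y + h i) - phi y - l * h i| <= e / (`|P| + 1) * `|h i|.
  by apply: H; rewrite (le_lt_trans hi) // ltr_pdivrMr // ltr_pMr // ltr1n.
have -> : (h i)^-1 * (P * phi (y + h i) - P * phi y) - P * l =
  P * ((h i)^-1 * (phi (y + h i) - phi y - l * h i)) by field; rewrite gt_eqF.
rewrite normrM normrM normfV; apply: (@le_trans _ _ (`|P| * (e / (`|P| + 1)))).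
  by rewrite ler_wpM2l // mulrC ler_pdivrMr // normr_gt0 gt_eqF.
by rewrite mulrA ler_pdivrMr // mulrC ler_pM2l // lerDl.
Qed.

Lemma upd_lt1 v j y : (forall i, `|v i| < 1) -> `|y| < 1 -> forall i, `|upd v j y i| < 1.
Proof. by move=> hv y1 i; rewrite /upd; case: eqP. Qed.

(** One more derivative in coordinate j is reached as a limit of difference quotients of jets of
    order [a]. The Cauchy criterion uses the known inner products of these jets with each other; the
    pairing with a jet of order [b] then passes to the limit. *)
Lemma jetf_step a j :
  (forall v, (forall i, `|v i| < 1) -> rk_space M (jetf a v)) ->
  (forall b v v', (forall i, `|v i| < 1) -> (forall i, `|v' i| < 1) ->
     rk_space M (jetf b v') -> << jetf a v, jetf b v' >> = jetg a b v v') ->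
  forall v, (forall i, `|v i| < 1) -> rk_space M (jetf (upd a j (a j).+1) v) /\
    forall b v', (forall i, `|v' i| < 1) -> rk_space M (jetf b v') ->
      << jetf (upd a j (a j).+1) v, jetf b v' >> = jetg (upd a j (a j).+1) b v v'.
Proof.
move=> Ha Fa v hv.
have r0 : 0 < 1 - `|v j| by rewrite subr_gt0.
have [h [h0 hr hl]] := null_sequence r0.
have vh i : `|v j + h i| < 1.
  by rewrite (le_lt_trans (ler_normD _ _)) // (gtr0_norm (h0 i)) addrC -ltrBrDr.
pose vv i := upd v j (v j + h i).
have hvv i : forall k, `|vv i k| < 1 by apply: upd_lt1.
pose u i : T -> C := fun z => (h i)^-1 * (jetf a (vv i) z - jetf a v z).
have Hd i : rk_space M (fun z => jetf a (vv i) z - jetf a v z) by apply: rk_spaceB; apply: Ha.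
have Hu i : rk_space M (u i) by exact: rk_spaceZ.
have conjh i : Num.conj (h i)^-1 = (h i)^-1.
  by rewrite fmorphV /= (CrealP (gtr0_real (h0 i))).
have avv i : jetf a (vv i) = jetf (upd a j (a j)) (vv i) by rewrite upd_id.
pose Q := \prod_(i | i != j) jetk (alpha i) (a i) (a i) (v i) (Num.conj (v i)).
(* The expected squared norm of the derivative serves as the common limit of the inner products. All
   coordinates but j contribute the fixed factor [Q]. *)
have [e e0|f Hf lf] := @rk_limit _ _ _ M u (jetg (upd a j (a j).+1) (upd a j (a j).+1) v v) Hu.
  have Q1 : 0 < `|Q| + 1 by rewrite ltr_wpDl.
  have cv : `|Num.conj (v j)| < 1 by rewrite norm_conjC.
  have [d d0 D] := jetk_diff2 (a j) (a j) (halpha j) (hv j) cv (divr_gt0 e0 Q1).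
  have d2 : 0 < d / 2 by rewrite divr_gt0.
  have [N HN] := hl _ d2; exists N => i k /HN hi /HN hk.
  have hd (n : nat) : `|h n - 0| <= d / 2 -> `|h n| < d.
    by rewrite subr0 => H; rewrite (le_lt_trans H) // ltr_pdivrMr // ltr_pMr // ltr1n.
  have := D (h i) (h k) (hd _ hi) (hd _ hk).
  rewrite rk_innerZl // rk_innerZr // rk_innerBl ?rk_innerBr //; try exact: Ha.
  rewrite !Fa //; try exact: Ha.
  have E y y' : jetg a a (upd v j y) (upd v j y') = jetk (alpha j) (a j) (a j) y (Num.conj y') * Q.
    by rewrite -{1 2}(upd_id a j) jetg_upd.
  have E1 y : jetg a a (upd v j y) v = jetk (alpha j) (a j) (a j) y (Num.conj (v j)) * Q.
    by rewrite -{2}(upd_id v j) E.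
  have E2 y : jetg a a v (upd v j y) = jetk (alpha j) (a j) (a j) (v j) (Num.conj y) * Q.
    by rewrite -{1}(upd_id v j) E.
  have E3 : jetg a a v v = jetk (alpha j) (a j) (a j) (v j) (Num.conj (v j)) * Q.
    by rewrite -{1}(upd_id v j) E1.
  have E4 : jetg (upd a j (a j).+1) (upd a j (a j).+1) v v =
      jetk (alpha j) (a j).+1 (a j).+1 (v j) (Num.conj (v j)) * Q.
    by rewrite -{1 2}(upd_id v j) jetg_upd.
  rewrite E E1 E2 E3 E4 conjh rmorphD /= (CrealP (gtr0_real (h0 k))).
  set D1 := _ - _ => HD.
  have -> : (h i)^-1 * ((h k)^-1 *
      (jetk (alpha j) (a j) (a j) (v j + h i) (Num.conj (v j) + h k) * Q -
       jetk (alpha j) (a j) (a j) (v j + h i) (Num.conj (v j)) * Q -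
       (jetk (alpha j) (a j) (a j) (v j) (Num.conj (v j) + h k) * Q -
        jetk (alpha j) (a j) (a j) (v j) (Num.conj (v j)) * Q))) -
      jetk (alpha j) (a j).+1 (a j).+1 (v j) (Num.conj (v j)) * Q =
      Q * (((h i)^-1 * (h k)^-1) * D1).
    by rewrite /D1; field; rewrite !gt_eqF.
  rewrite normrM; apply: (@le_trans _ _ (`|Q| * (e / (`|Q| + 1)))).
    rewrite ler_wpM2l // normrM -invfM normfV mulrC ler_pdivrMr ?normr_gt0 ?gt_eqF ?mulr_gt0 //.
    by rewrite normrM.
  by rewrite mulrA ler_pdivrMr // mulrC ler_pM2l // lerDl.
(* Weak convergence tested on the kernel sections is pointwise convergence, and the pointwise limit
   of the difference quotients is the derivative. *)
have fE : f = jetf (upd a j (a j).+1) v.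
  apply/funext => z; have := lf _ (rk_kernel M z); rewrite rk_reproducing //.
  move=> /seq_lim_unique; apply.
  pose P := \prod_(i | i != j) jetk (alpha i) (a i) 0 (v i) (\val z ord0 i).
  have := seq_lim_quotient P (wder_jetk (a j) 0 (halpha j) (hv j) (polydisc_lt1 z j)) h0 hl.
  have E p : jetf (upd a j p) v z = jetk (alpha j) p 0 (v j) (\val z ord0 j) * P.
    by rewrite -[in LHS](upd_id v j) jetf_upd.
  have E0 : jetf a v z = jetk (alpha j) (a j) 0 (v j) (\val z ord0 j) * P.
    by rewrite -E upd_id.
  rewrite E mulrC => H e /H[N HN]; exists N => i /HN.
  by rewrite rk_reproducing // /u avv jetf_upd E0 2!(mulrC P).
rewrite -fE; split=> // b v' hv' Hb.
have := lf _ Hb => /seq_lim_unique; apply.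
pose P := \prod_(i | i != j) jetk (alpha i) (a i) (b i) (v i) (Num.conj (v' i)).
have cv : `|Num.conj (v' j)| < 1 by rewrite norm_conjC.
have := seq_lim_quotient P (wder_jetk (a j) (b j) (halpha j) (hv j) cv) h0 hl.
have E p y : jetg (upd a j p) b (upd v j y) v' =
    jetk (alpha j) p (b j) y (Num.conj (v' j)) * P.
  by rewrite -{1}(upd_id b j) -{1}(upd_id v' j) jetg_upd.
have E0 p : jetg (upd a j p) b v v' = jetk (alpha j) p (b j) (v j) (Num.conj (v' j)) * P.
  by rewrite -[in LHS](upd_id v j) E.
have E1 w : jetg a b w v' = jetg (upd a j (a j)) b w v' by rewrite upd_id.
rewrite E0 mulrC => H e /H[N HN]; exists N => i /HN.
rewrite rk_innerZl // rk_innerBl //; try exact: Ha.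
by rewrite !Fa // !E1 E E0 2!(mulrC P).
Qed.

(** The induction is on the order of [a] only, [b] being arbitrary as soon as its jet is known to
    lie in the space; this avoids a double induction. The base case is the reproducing property. *)
Lemma jetf_inner a v : (forall i, `|v i| < 1) -> rk_space M (jetf a v) /\
  forall b v', (forall i, `|v' i| < 1) -> rk_space M (jetf b v') ->
    << jetf a v, jetf b v' >> = jetg a b v v'.
Proof.
have [n] := ubnP (\sum_i a i)%N; elim: n a v => // n IH a v /ltnSE an hv.
have [j aj|a0] := pickP (fun j => a j != 0%N); last first.
  have -> : a = (fun=> 0%N) by apply/funext => i; have /negbFE/eqP := a0 i.
  rewrite (jetf0 hv); split=> [|b v' hv' Hb]; first exact: rk_kernel.
  by rewrite (rk_conj Hb (rk_kernel M _)) rk_reproducing // jetf_conj.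
pose a' := upd a j (a j).-1.
have aE : a = upd a' j (a' j).+1.
  apply/funext => i; rewrite /a' /upd eqxx prednK ?lt0n //.
  by case: eqP => [->|].
have a'n : (\sum_i a' i < n)%N.
  apply: leq_trans an; rewrite (bigD1 j) //= [X in (_ < X)%N](bigD1 j) //=.
  rewrite /a' /upd eqxx; under eq_bigr => i /negbTE ij do rewrite ij.
  by rewrite ltn_add2r prednK ?lt0n.
rewrite aE; apply: jetf_step => // [w hw|b w w' hw hw' Hb].
  by have [] := IH a' w a'n hw.
by have [_ ->] := IH a' w a'n hw.
Qed.

Lemma jetf_gram a b v v' : (forall i, `|v i| < 1) -> (forall i, `|v' i| < 1) ->
  << jetf a v, jetf b v' >> = jetg a b v v'.
Proof.
by move=> hv hv'; have [_ ->] := jetf_inner a hv => //; have [] := jetf_inner b hv'.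
Qed.

End jet_vectors.

Lemma is_derive_coord (K : numFieldType) m (F : 'rV[K]_m -> K) v j (phi : K -> K) l :
  (\forall h \near (0 : K), F (h *: delta_mx ord0 j + v) = phi (v ord0 j + h)) ->
  is_derive (v ord0 j) 1 phi l -> is_derive v (delta_mx ord0 j) F l.
Proof.
move=> HF [dphi dE].
have c : h^-1 *: (phi (h *: (1 : K) + v ord0 j) - phi (v ord0 j)) @[h --> 0^'] --> l.
  by rewrite -dE; apply: dphi.
have F0 : F v = phi (v ord0 j).
  by have := nbhs_singleton HF; rewrite scale0r add0r addr0.
have {}c : h^-1 *: (F (h *: delta_mx ord0 j + v) - F v) @[h --> 0^'] --> l.
  apply: cvg_trans c; apply: near_eq_cvg; rewrite near_withinE.
  by apply: filterS HF => h -> _; rewrite F0 [h *: 1]mulr1 (addrC h).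
by split; [apply/cvg_ex; exists l | apply: cvg_lim].
Qed.

Section gram_matrices.
Variable R : realType.
Local Notation C := (Cx R).
Implicit Types (v w : C).

Lemma near_disc w : `|w| < 1 -> \forall v \near w, `|v| < 1.
Proof.
move=> w1; have r0 : 0 < 1 - `|w| by rewrite subr_gt0.
apply/nbhs_normP; exists (1 - `|w|) => // v /= vw.
have -> : v = w - (w - v) by ring.
by apply: (le_lt_trans (ler_normB _ _)); rewrite addrC -ltrBrDr.
Qed.

Lemma wderZl (c : C) f w a b : wder f w a b -> wder (fun v : C => f v * c) w (a * c) (b * c).
Proof.
rewrite ![_ * c]mulrC => /(wderZ c); apply: near_wder.
by apply: filterE => v; rewrite mulrC.
Qed.

Lemma derive1n_disc (f : C -> C) (g : nat -> C -> C) :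
  (forall i v, `|v| < 1 -> wder (g i) v (g i.+1 v) 0) ->
  (forall v, `|v| < 1 -> f v = g 0%N v) ->
  forall i v, `|v| < 1 -> f^`(i) v = g i v.
Proof.
move=> dg fg; elim=> [|i IH] v v1; first by rewrite derive1n0 fg.
rewrite derive1nS derive1E.
have /wder_is_derive[_ <-] // : wder f^`(i) v (g i.+1 v) 0.
by apply: near_wder (dg i v v1); apply: filterS (near_disc v1) => u u1; rewrite IH.
Qed.

Lemma jet_bundle2_gram (m n : nat) (alpha : 'I_m -> R) (l : levels m n) (c : R) r w i j :
  `|w| < 1 ->
  0 < \sum_(2 <= k < m.+1) entry 0 alpha k + 2 * (level_sum l)%:R ->
  hb_gram (jet_bundle2 (level_kernel alpha l c) r) w i j =
  c%:C * cpow (1 - w * Num.conj w) (- entry 0 alpha 1) *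
  jetk (\sum_(2 <= k < m.+1) entry 0 alpha k + 2 * (level_sum l)%:R) i j w (Num.conj w).
Proof.
move=> w1 b0; rewrite /= mxE; set b := \sum_(2 <= k < _) _ + _ in b0 *.
have u1 : `|Num.conj w| < 1 by rewrite norm_conjC.
set D := c%:C * _.
apply: (@derive1n_disc _ (fun k u => D * jetk b i k w u)) => // [k u ul|u ul].
  by have := wderZ D (wder_jetkr i k b0 w1 ul); rewrite mulr0.
apply: (@derive1n_disc _ (fun k v => D * jetk b k 0 v u)) => // [k v vl|v vl].
  by have := wderZ D (wder_jetk k 0 b0 vl ul); rewrite mulr0.
rewrite jetk00 /level_kernel /= !conjCK /D.
by rewrite (mulrC w) (mulrC v).
Qed.

Variables (m : nat) (alpha : 'I_m -> R).
Hypothesis halpha : forall j, 0 < alpha j.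
Local Notation T := (@polydisc R m).

Lemma pderiv_jetf (z : T) (j : 'I_m) (p : 'I_m -> nat) (F : 'rV[C]_m -> C) :
  (forall v : 'rV[C]_m, (forall i, `|v ord0 i| < 1) -> F v = jetf alpha p (v ord0) z) ->
  forall v : 'rV[C]_m, (forall i, `|v ord0 i| < 1) ->
    pderiv j F v = jetf alpha (upd p j (p j).+1) (v ord0) z.
Proof.
move=> HF v hv; rewrite /pderiv.
pose P := \prod_(i | i != j) jetk (alpha i) (p i) 0 (v ord0 i) (\val z ord0 i).
have E q y : jetf alpha (upd p j q) (upd (v ord0) j y) z =
  jetk (alpha j) q 0 y (\val z ord0 j) * P by rewrite jetf_upd.
have E0 q : jetf alpha (upd p j q) (v ord0) z =
  jetk (alpha j) q 0 (v ord0 j) (\val z ord0 j) * P.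
  by have := E q (v ord0 j); rewrite upd_id.
rewrite E0; apply: derive_val.
apply: (@is_derive_coord _ _ _ _ _ (fun y => jetk (alpha j) (p j) 0 y (\val z ord0 j) * P)); last first.
  apply/wder_is_derive; have := wderZl P (wder_jetk (p j) 0 (halpha j) (hv j) (polydisc_lt1 z j)).
  by rewrite mul0r.
apply: filterS (near0_add (near_disc (hv j))) => h hh.
have vE : (h *: delta_mx ord0 j + v) ord0 = upd (v ord0) j (v ord0 j + h).
  apply/funext => i; rewrite !mxE eqxx /= /upd; case: eqP => [->|_].
    by rewrite mulr1 addrC.
  by rewrite mulr0 add0r.
rewrite HF; last by move=> i; rewrite vE; apply: upd_lt1.
by rewrite vE -[in LHS](upd_id p j) E.
Qed.

Lemma iter_pderiv_jetf (z : T) (j : 'I_m) (p : 'I_m -> nat) (F : 'rV[C]_m -> C) k :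
  (forall v : 'rV[C]_m, (forall i, `|v ord0 i| < 1) -> F v = jetf alpha p (v ord0) z) ->
  forall v : 'rV[C]_m, (forall i, `|v ord0 i| < 1) ->
    iter k (pderiv j) F v = jetf alpha (upd p j (p j + k)%N) (v ord0) z.
Proof.
move=> HF; elim: k => [|k IH] v hv; first by rewrite /= addn0 upd_id HF.
have -> : upd p j (p j + k.+1)%N = upd (upd p j (p j + k)%N) j (upd p j (p j + k)%N j).+1.
  by apply/funext => i; rewrite /upd eqxx addnS; case: eqP.
by rewrite iterS; exact: pderiv_jetf.
Qed.

Lemma jet_vectorE n (a : transverse m n) (w : C) : `|w| < 1 ->
  jet_vector alpha a w = jetf alpha (fun j => val a j) (fun=> w).
Proof.
move=> w1; apply/funext => z; rewrite /jet_vector /mderiv.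
pose F (v : 'rV[C]_m) := polydisc_kernel alpha (\val z) (map_mx Num.conj v).
have F0 (v : 'rV[C]_m) : (forall i, `|v ord0 i| < 1) -> F v = jetf alpha (fun=> 0%N) (v ord0) z.
  move=> hv; rewrite /F /polydisc_kernel /jetf; apply: eq_bigr => i _.
  by rewrite jetk00 !mxE conjCK (mulrC (v ord0 i)).
(* The fold is treated for any duplicate-free list, the multi-index reached so far being supported
   on that list. *)
have H (s : seq 'I_m) : uniq s -> forall v : 'rV[C]_m, (forall i, `|v ord0 i| < 1) ->
    foldr (fun j G => iter (val a j) (pderiv j) G) F s v =
    jetf alpha (fun j => if j \in s then val a j : nat else 0%N) (v ord0) z.
  elim: s => [|x s IH] /=; first by move=> _ v hv; rewrite F0.
  move=> /andP[xs us] v hv.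
  have -> : (fun j => if j \in x :: s then val a j : nat else 0%N) =
    upd (fun j => if j \in s then val a j : nat else 0%N) x
      ((fun j => if j \in s then val a j : nat else 0%N) x + val a x)%N.
    apply/funext => i; rewrite /upd /= (negbTE xs) add0n in_cons.
    by case: eqP => [->|].
  by apply: iter_pderiv_jetf => //; apply: IH.
have Ea : (fun j => val a j : nat) = (fun j => if j \in enum 'I_m then val a j : nat else 0%N).
  by apply/funext => i; rewrite mem_enum.
have Ew : (fun=> w) = (const_mx w : 'rV[C]_m) ord0 by apply/funext => i; rewrite mxE.
rewrite Ea Ew; apply: (H (enum 'I_m) (enum_uniq _)) => i; by rewrite mxE.
Qed.

Lemma jet_bundle_gram (M : Halpha alpha) n w i j : `|w| < 1 ->
  hb_gram (jet_bundle M n) w i j =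
  \prod_k jetk (alpha k) (val (enum_val i) k) (val (enum_val j) k) w (Num.conj w).
Proof. by move=> w1; rewrite /= mxE !jet_vectorE // (jetf_gram halpha). Qed.

End gram_matrices.

(** * Transvectants *)

Section transvectants.
Variable R : realType.
Implicit Types (x y : R) (k i a b : nat).

Lemma sum_alt_bin (d : nat) : \sum_(e < d.+1) (-1) ^+ e * 'C(d, e)%:R = (d == 0%N)%:R :> R.
Proof.
have := exprBn (1 : R) 1 d; rewrite subrr expr0n => ->.
by apply: eq_bigr => e _; rewrite !expr1n !mulr1 mulr_natr.
Qed.

Lemma bin_factR (n k : nat) : (k <= n)%N -> 'C(n, k)%:R = n`!%:R / (k`!%:R * (n - k)`!%:R) :> R.
Proof.
move=> kn; rewrite -(bin_fact kn) !natrM mulfK // mulf_neq0 // pnatr_eq0 -lt0n fact_gt0 //.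
Qed.

(** What depends on [a] in the product of a transvectant coefficient of order 0 with two kernel
    coefficients, once the rising factorials of [a] and [k - a] have cancelled. *)
Definition trinom k a p q : R := (-1) ^+ a * 'C(k, a)%:R * 'C(a, p)%:R * 'C(k - a, q)%:R.

Lemma trinom_eq0 k a p q : ~~ [&& (a <= k)%N, (p <= a)%N & (q <= k - a)%N] -> trinom k a p q = 0.
Proof.
rewrite !negb_and -!ltnNge => /or3P[] H; rewrite /trinom (bin_small H) ?mulr0 ?mul0r //.
Qed.

(** The product of binomials equals C(k, p) C(k - p, q) C(k - p - q, a - p), so the sum over [a] is
    an alternating row of Pascal's triangle: it vanishes unless k = p + q. Orthogonality of the
    transvectants rests on this. *)
Lemma sum_trinom k p q N : (k < N)%N ->
  \sum_(a < N) trinom k a p q = ((p + q)%N == k)%:R * ((-1) ^+ p * 'C(k, p)%:R).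
Proof.
move=> kN; have [kpq|pqk] := ltnP k (p + q).
  rewrite (gtn_eqF kpq) mul0r big1 // => a _; apply: trinom_eq0.
  by apply: contraL kpq => /and3P[ak pa qk]; rewrite -leqNgt; lia.
have E a : trinom k a p q =
    if (p <= a <= k - q)%N then (-1) ^+ p * 'C(k, p)%:R * 'C(k - p, q)%:R *
      ((-1) ^+ (a - p) * 'C(k - p - q, a - p)%:R) else 0.
  case: ifPn => [/andP[pa aq]|H]; last first.
    by apply: trinom_eq0; apply: contra H => /and3P[ak -> qk] /=; lia.
  rewrite /trinom -[in (-1) ^+ a](subnK pa) exprD.
  rewrite !bin_factR; try lia.
  have -> : (k - p - q - (a - p) = k - a - q)%N by lia.
  by field; rewrite !pnatr_eq0 -!lt0n !fact_gt0.
under eq_bigr do rewrite E.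
rewrite -big_mkcond /= -(big_mkord (fun a => p <= a <= k - q)%N (fun a => (-1) ^+ p * 'C(k, p)%:R * 'C(k - p, q)%:R *
      ((-1) ^+ (a - p) * 'C(k - p - q, a - p)%:R))).
rewrite (big_cat_nat (n := p)) //=; last by lia.
rewrite big_nat_cond big1 ?add0r; last by move=> a; lia.
rewrite -{1}[p]add0n big_addn (big_cat_nat (n := (k - p - q).+1)) //=; last by lia.
rewrite [X in _ + X]big_nat_cond [X in _ + X]big1 ?addr0; last by move=> a; lia.
rewrite big_mkord (eq_bigl xpredT); last by move=> a; have := ltn_ord a; lia.
under eq_bigr do rewrite addnK.
rewrite -mulr_sumr sum_alt_bin.
have -> : (k - p - q == 0)%N = (p + q == k)%N by lia.
case: eqP => [e|]; last by rewrite mulr0 mul0r.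
have -> : q = (k - p)%N by lia.
by rewrite binn !mulr1 mul1r.
Qed.

(* Coefficients of the transvectant of order k, i.e. of the polynomial of
   degree k in the two transverse derivations that is killed by the lowering
   operators, multiplied by the i-th power of the sum of the derivations. *)
Fixpoint cg x y k i a : R :=
  match i with
  | 0 => (-1) ^+ a * 'C(k, a)%:R / (rising x a * rising y (k - a))
  | i'.+1 => cg x y k i' a + (if a is a'.+1 then cg x y k i' a' else 0)
  end.

Lemma cg_small x y k i a : (k + i < a)%N -> cg x y k i a = 0.
Proof.
elim: i a => [|i IH] a /=; first by rewrite addn0 => H; rewrite bin_small // mulr0 mul0r.
rewrite addnS; case: a => // a H; rewrite !IH ?addr0 //; lia.
Qed.

(** Squared norm of the transvectant at the origin, where jets of different orders are orthogonal
    and the jet of order p and weight x has squared norm p! (x)_p. *)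
Definition cnorm x y k : R := \sum_(p < k.+1)
  'C(k, p)%:R ^+ 2 * (p`!%:R * (k - p)`!%:R) / (rising x p * rising y (k - p)).

Lemma cnorm_gt0 x y k : 0 < x -> 0 < y -> 0 < cnorm x y k.
Proof.
move=> x0 y0; rewrite /cnorm big_ord_recl ltr_pwDl //.
  by rewrite bin0 divr_gt0 ?mulr_gt0 ?exprn_gt0 ?ltr0n ?fact_gt0 ?rising_gt0.
apply: sumr_ge0 => p _; rewrite divr_ge0 ?mulr_ge0 ?sqr_ge0 ?ler0n //; exact/ltW/rising_gt0.
Qed.

Local Notation C := (Cx R).
Implicit Types (X U : C).

(** One bound [N] serves all orders: the coefficients vanish beyond k + i, so raising i by
    differentiation does not alter the range. *)
Definition cgsum N x y k i k' i' X U : C := \sum_(a < N) \sum_(b < N)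
  (cg x y k i a)%:C * (cg x y k' i' b)%:C *
  (jetk x a b X U * jetk y (k + i - a) (k' + i' - b) X U).

Lemma cg_gcoef x y k k' a b p q : 0 < x -> 0 < y ->
  cg x y k 0 a * cg x y k' 0 b * (gcoef x a b p * gcoef y (k - a) (k' - b) q) =
  p`!%:R * q`!%:R / (rising x p * rising y q) * (trinom k a p q * trinom k' b p q).
Proof.
move=> x0 y0; rewrite /= /gcoef /trinom.
by field; rewrite !gt_eqF ?rising_gt0.
Qed.

Lemma cgsum00_term N x y k k' a b X U : 0 < x -> 0 < y -> `|X| < 1 -> `|U| < 1 ->
  (k < N)%N -> (k' < N)%N ->
  (cg x y k 0 a)%:C * (cg x y k' 0 b)%:C * (jetk x a b X U * jetk y (k - a) (k' - b) X U) =
  cpow (1 - X * U) (- (x + y + (k + k')%:R)) * \sum_(p < N) \sum_(q < N)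
    (p`!%:R * q`!%:R / (rising x p * rising y q))%:C *
    (U ^+ (k - p - q) * X ^+ (k' - p - q)) * ((trinom k a p q)%:C * (trinom k' b p q)%:C).
Proof.
move=> x0 y0 X1 U1 kN k'N.
have [ak|ak] := ltnP k a.
  rewrite [cg x y k 0 a]cg_small ?addn0 // !mul0r big1 ?mulr0 // => p _.
  rewrite big1 // => q _; rewrite trinom_eq0 ?mul0r ?mulr0 //; lia.
have [bk|bk] := ltnP k' b.
  rewrite [cg x y k' 0 b]cg_small ?addn0 // mulr0 !mul0r big1 ?mulr0 // => p _.
  rewrite big1 // => q _; rewrite [trinom k' b p q]trinom_eq0 ?mulr0 //; lia.
rewrite (@jetk_widen _ N x) ?(leq_ltn_trans ak) // (@jetk_widen _ N y); last by lia.
have -> : cpow (1 - X * U) (- (x + y + (k + k')%:R)) =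
  cpow (1 - X * U) (- (x + (a + b)%:R)) * cpow (1 - X * U) (- (y + (k - a + (k' - b))%:R)).
  rewrite -cpowD; congr cpow.
  have -> : (k + k' = (a + b) + (k - a + (k' - b)))%N by lia.
  by rewrite [in LHS]natrD; ring.
move: (cpow _ _) (cpow _ _) => A B.
rewrite (mulrACA B _ A) (mulrCA (_ * _) (B * A)); congr (_ * _).
rewrite big_distrlr mulr_sumr /=; apply: eq_bigr => p _; rewrite mulr_sumr; apply: eq_bigr => q _.
(* Inside this range the exponents of U and of X add up exactly. Outside it truncated subtraction
   would spoil them, but both sides have a zero coefficient. *)
have [H|H] := boolP [&& (p <= a)%N, (q <= k - a)%N, (p <= b)%N & (q <= k' - b)%N].
  case/and4P: H => pa qa pb qb.
  have -> : (k - p - q = (a - p) + (k - a - q))%N by lia.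
  have -> : (k' - p - q = (b - p) + (k' - b - q))%N by lia.
  rewrite !exprD.
  have E : (p`!%:R * q`!%:R / (rising x p * rising y q))%:C *
      ((trinom k a p q)%:C * (trinom k' b p q)%:C) = (cg x y k 0 a)%:C * (cg x y k' 0 b)%:C *
      ((gcoef x a b p)%:C * (gcoef y (k - a) (k' - b) q)%:C) :> C.
    by rewrite -!(rmorphM (real_complex R)) cg_gcoef.
  rewrite [RHS]mulrAC E.
  set c1 := (cg _ _ _ _ a)%:C; set c2 := (cg _ _ _ _ b)%:C.
  set c3 := (gcoef x _ _ _)%:C; set c4 := (gcoef y _ _ _)%:C.
  move: (U ^+ _) (U ^+ _) (X ^+ _) (X ^+ _) => e1 e2 e3 e4; ring.
have -> : (trinom k a p q)%:C * (trinom k' b p q)%:C = 0 :> C.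
  have : ~~ [&& (a <= k)%N, (p <= a)%N & (q <= k - a)%N] \/
    ~~ [&& (b <= k')%N, (p <= b)%N & (q <= k' - b)%N] by lia.
  by case=> /trinom_eq0 ->; rewrite ?mul0r ?mulr0.
have : gcoef x a b p = 0 \/ gcoef y (k - a) (k' - b) q = 0.
  have : (a < p)%N \/ (b < p)%N \/ (k - a < q)%N \/ (k' - b < q)%N by lia.
  by case=> [/gcoef_gtl|[/gcoef_gtr|[/gcoef_gtl|/gcoef_gtr]]] ->; [left|left|right|right].
by case=> ->; rewrite !(mul0r, mulr0).
Qed.

(** Summing over a and b first forces p + q = k and p + q = k'. Hence distinct orders are
    orthogonal, and for equal orders the exponents of X and U are 0: only a power of 1 - X U
    remains, which is again a kernel. *)
Lemma cgsum00 N x y k k' X U : 0 < x -> 0 < y -> `|X| < 1 -> `|U| < 1 ->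
  (k < N)%N -> (k' < N)%N ->
  cgsum N x y k 0 k' 0 X U =
  (k == k')%:R * (cnorm x y k)%:C * jetk (x + y + 2 * k%:R) 0 0 X U.
Proof.
move=> x0 y0 X1 U1 kN k'N; rewrite /cgsum.
under eq_bigr => a _ do under eq_bigr => b _ do rewrite !addn0 (@cgsum00_term N) //.
under eq_bigr => a _ do rewrite -mulr_sumr.
rewrite -mulr_sumr.
have -> : \sum_(a < N) \sum_(b < N) \sum_(p < N) \sum_(q < N)
    (p`!%:R * q`!%:R / (rising x p * rising y q))%:C *
    (U ^+ (k - p - q) * X ^+ (k' - p - q)) * ((trinom k a p q)%:C * (trinom k' b p q)%:C) =
  \sum_(p < N) \sum_(q < N) (p`!%:R * q`!%:R / (rising x p * rising y q))%:C *
    (U ^+ (k - p - q) * X ^+ (k' - p - q)) *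
    ((\sum_(a < N) trinom k a p q) * (\sum_(b < N) trinom k' b p q))%:C.
  under eq_bigr do rewrite exchange_big /=.
  rewrite exchange_big /=; apply: eq_bigr => p _.
  under eq_bigr do rewrite exchange_big /=.
  rewrite exchange_big /=; apply: eq_bigr => q _.
  rewrite [X in _ = _ * X](_ : _ =
    (\sum_(a < N) (trinom k a p q)%:C) * (\sum_(b < N) (trinom k' b p q)%:C)); last first.
    by rewrite rmorphM !rmorph_sum.
  rewrite big_distrlr /= mulr_sumr; apply: eq_bigr => a _.
  by rewrite mulr_sumr.
under eq_bigr => p _ do under eq_bigr => q _ do rewrite !sum_trinom //.
have [kk|kk] := eqVneq k k'; last first.
  rewrite !mul0r big1 ?mulr0 // => p _; rewrite big1 // => q _.
  have -> : ((p + q)%N == k)%:R * ((-1) ^+ p * 'C(k, p)%:R) *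
    (((p + q)%N == k')%:R * ((-1) ^+ p * 'C(k', p)%:R)) = 0 :> R.
    by case: eqP => [->|_]; rewrite ?(negbTE kk) !mul0r ?mulr0.
  by rewrite mulr0.
subst k'; rewrite mul1r jetk00 mulrC.
have -> : x + y + (k + k)%:R = x + y + 2 * k%:R by rewrite natrD; ring.
congr (_ * _).
rewrite /cnorm (big_ord_widen N (fun p => 'C(k, p)%:R ^+ 2 * (p`!%:R * (k - p)`!%:R) / (rising x p * rising y (k - p)) : R)) //.
rewrite rmorph_sum [RHS]big_mkcond /=; apply: eq_bigr => p _.
case: ifPn => [pk|pk]; last first.
  rewrite big1 // => q _; have -> : (p + q == k)%N = false by lia.
  by rewrite !mul0r rmorph0 mulr0.
have kpN : (k - p < N)%N by lia.
rewrite (bigD1 (Ordinal kpN)) //= [X in _ + X]big1 ?addr0; last first.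
  move=> q /eqP qk; have -> : (p + q == k)%N = false.
    by apply/eqP => H; apply: qk; apply/val_inj => /=; lia.
  by rewrite !mul0r rmorph0 mulr0.
have -> : (p + (k - p) == k)%N by lia.
have -> : (k - p - (k - p) = 0)%N by lia.
rewrite !expr0 !mulr1 !mul1r -rmorphM; congr (_%:C).
rewrite (mulrACA ((-1) ^+ p)) -exprD addnn -mul2n exprM sqrrN expr1n expr1n mul1r.
by rewrite -expr2 [LHS]mulrC [LHS]mulrA.
Qed.

(** The identity is differentiated in X. The Leibniz rule distributes the new derivative over the
    two factors, which is exactly the Pascal-type recursion of [cg] in i. *)
Lemma cgsum_step N x y k i k' i' : 0 < x -> 0 < y -> (k + i.+1 < N)%N ->
  (forall X U, `|X| < 1 -> `|U| < 1 -> cgsum N x y k i k' i' X U =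
    (k == k')%:R * (cnorm x y k)%:C * jetk (x + y + 2 * k%:R) i i' X U) ->
  forall X U, `|X| < 1 -> `|U| < 1 -> cgsum N x y k i.+1 k' i' X U =
    (k == k')%:R * (cnorm x y k)%:C * jetk (x + y + 2 * k%:R) i.+1 i' X U.
Proof.
move=> x0 y0 kN H X U X1 U1.
have b0 : 0 < x + y + 2 * k%:R by rewrite ltr_wpDr ?mulr_ge0 // addr_gt0.
have d1 := wderZ ((k == k')%:R * (cnorm x y k)%:C) (wder_jetk i i' b0 X1 U1).
have d2 : wder (fun v => cgsum N x y k i k' i' v U) X
  (\sum_(a < N) \sum_(b < N) (cg x y k i a)%:C * (cg x y k' i' b)%:C *
    (jetk x a.+1 b X U * jetk y (k + i - a) (k' + i' - b) X U +
     jetk x a b X U * jetk y (k + i - a).+1 (k' + i' - b) X U))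
  (\sum_(a < N) \sum_(b < N) 0).
  apply: wder_sum => a _; apply: wder_sum => b _.
  have := wderM (wder_jetk a b x0 X1 U1) (wder_jetk (k + i - a) (k' + i' - b) y0 X1 U1).
  by rewrite mul0r mulr0 addr0 => /(wderZ ((cg x y k i a)%:C * (cg x y k' i' b)%:C)); rewrite mulr0.
rewrite [X in wder _ _ _ X]big1 in d2; last by move=> a _; rewrite big1.
have [] := wder_unique d1 (near_wder _ d2).
  by apply: filterS (near_disc X1) => v v1; rewrite H.
move=> -> _; rewrite /cgsum.
under [RHS]eq_bigr => a _ do under eq_bigr => b _ do rewrite mulrDr.
under [RHS]eq_bigr => a _ do rewrite big_split /=.
rewrite big_split /=.
pose S (c : nat -> R) (a : nat) := \sum_(b < N) (c a)%:C * (cg x y k' i' b)%:C *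
  (jetk x a b X U * jetk y (k + i.+1 - a) (k' + i' - b) X U).
case: N kN {H d2} @S => // N kN S.
(* The index a is shifted by one; nothing is lost at the top, since the last coefficient is beyond k
   + i. *)
have -> : \sum_(a < N.+1) \sum_(b < N.+1) (cg x y k i a)%:C * (cg x y k' i' b)%:C *
    (jetk x a.+1 b X U * jetk y (k + i - a) (k' + i' - b) X U) =
    \sum_(a < N.+1) S (fun a => if a is a'.+1 then cg x y k i a' else 0) a.
  rewrite big_ord_recr [RHS]big_ord_recl /= [X in _ + X]big1; last first.
    by move=> b _; rewrite cg_small ?mul0r //; lia.
  rewrite [X in _ = X + _]/S [X in _ = X + _]big1; last by move=> b _; rewrite !mul0r.
  rewrite addr0 add0r; apply: eq_bigr => a _; apply: eq_bigr => b _.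
  by rewrite /bump /= add1n addnS subSS.
have -> : \sum_(a < N.+1) \sum_(b < N.+1) (cg x y k i a)%:C * (cg x y k' i' b)%:C *
    (jetk x a b X U * jetk y (k + i - a).+1 (k' + i' - b) X U) =
    \sum_(a < N.+1) S (cg x y k i) a.
  apply: eq_bigr => a _; apply: eq_bigr => b _.
  have [ak|ak] := leqP a (k + i); first by rewrite addnS (subSn ak).
  by rewrite cg_small // !mul0r.
rewrite addrC -big_split /=; apply: eq_bigr => a _; rewrite -big_split /=; apply: eq_bigr => b _.
by rewrite -!mulrDl -rmorphD.
Qed.

Lemma cgsumC N x y k i k' i' X U : cgsum N x y k i k' i' X U = cgsum N x y k' i' k i U X.
Proof.
rewrite /cgsum exchange_big; apply: eq_bigr => b _; apply: eq_bigr => a _.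
by rewrite [_%:C * _%:C]mulrC (jetkC _ a) (jetkC _ (k + i - a)).
Qed.

(** The derivatives in X raise i; exchanging X and U exchanges the two families, so the same step
    raises i' from the base case. *)
Lemma cgsumE N x y k i k' i' X U : 0 < x -> 0 < y -> (k + i < N)%N -> (k' + i' < N)%N ->
  `|X| < 1 -> `|U| < 1 -> cgsum N x y k i k' i' X U =
    (k == k')%:R * (cnorm x y k)%:C * jetk (x + y + 2 * k%:R) i i' X U.
Proof.
move=> x0 y0 + k'N X1 U1; elim: i X U X1 U1 => [|i IH] X U X1 U1 kN; last first.
  apply: cgsum_step => // V W V1 W1; apply: IH => //; lia.
rewrite cgsumC jetkC eq_sym.
suff : cgsum N x y k' i' k 0 U X = (k' == k)%:R * (cnorm x y k')%:C * jetk (x + y + 2 * k'%:R) i' 0 U X.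
  by move=> ->; case: eqP => [->|_] //; rewrite !mul0r.
elim: i' U X X1 U1 k'N => [|i' IH] U X X1 U1 k'N.
  by rewrite !addn0 in kN k'N; apply: cgsum00.
by apply: cgsum_step => // V W V1 W1; apply: IH => //; lia.
Qed.

End transvectants.

(** * Multi-indices and iterated coupling *)

Section multi_index_sums.

(** Multi-indices become sequences padded with 0, so that heads and tails can be taken in a
    recursion on the number of variables without changing types. *)
Definition zext (p N : nat) (a : {ffun 'I_p -> 'I_N}) (j : nat) : nat :=
  oapp (fun k => a k : nat) 0%N (insub j).

Lemma zext_ord p N (a : {ffun 'I_p -> 'I_N}) (j : 'I_p) : zext a j = a j.
Proof. by rewrite /zext valK. Qed.

Definition scons (x : nat) (a : nat -> nat) (j : nat) : nat := if j is j'.+1 then a j' else x.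

Definition fcons p (T : Type) (x : T) (a : {ffun 'I_p -> T}) : {ffun 'I_p.+1 -> T} :=
  [ffun j => oapp a x (unlift ord0 j)].

Lemma zext_fcons p N (x : 'I_N) (a : {ffun 'I_p -> 'I_N}) : zext (fcons x a) = scons x (zext a).
Proof.
apply/funext => -[|j].
  by rewrite -[0%N]/(nat_of_ord (ord0 : 'I_p.+1)) zext_ord ffunE unlift_none.
rewrite /scons; have [jp|pj] := ltnP j p; last first.
  have e : (j < p)%N = false by rewrite ltnNge pj.
  by rewrite /zext !insubF.
rewrite -[j]/(nat_of_ord (Ordinal jp)) zext_ord -lift0 zext_ord ffunE.
by rewrite liftK.
Qed.

Variable V : nmodType.

Definition multisum p N (F : (nat -> nat) -> V) : V :=
  \sum_(a : {ffun 'I_p -> 'I_N}) F (zext a).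

Lemma sum_ffun_recl p (T : finType) (F : {ffun 'I_p.+1 -> T} -> V) :
  \sum_a F a = \sum_(x : T) \sum_(a : {ffun 'I_p -> T}) F (fcons x a).
Proof.
rewrite pair_big /= (reindex (fun u : T * {ffun 'I_p -> T} => fcons u.1 u.2)) //=.
apply: onW_bij; exists (fun a : {ffun 'I_p.+1 -> T} => (a ord0, [ffun k : 'I_p => a (lift ord0 k)])) => [[x a]|a].
  by rewrite /= ffunE unlift_none; congr (_, _); apply/ffunP => k; rewrite !ffunE liftK.
by apply/ffunP => k; rewrite ffunE; case: unliftP => [j ->|->] //=; rewrite ffunE.
Qed.

Lemma multisum0 N F : multisum 0 N F = F (fun=> 0%N).
Proof.
pose a0 : {ffun 'I_0 -> 'I_N} := ffun0 (card_ord 0).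
rewrite /multisum (big_pred1 a0) => [|a]; last by apply/esym/eqP/ffunP => -[].
by congr F; apply/funext => j; rewrite /zext insubF.
Qed.

Lemma multisumS p N F : multisum p.+1 N F = \sum_(x < N) multisum p N (fun a => F (scons x a)).
Proof.
rewrite /multisum sum_ffun_recl; apply: eq_bigr => x _; apply: eq_bigr => a _.
by rewrite zext_fcons.
Qed.

Lemma eq_multisum p N F G : (forall a, F a = G a) -> multisum p N F = multisum p N G.
Proof. by move=> FG; apply: eq_bigr. Qed.

Lemma multisum_multisumS p q N (F : (nat -> nat) -> (nat -> nat) -> V) :
  multisum p N (fun a => multisum q.+1 N (F a)) =
  \sum_(x < N) multisum p N (fun a => multisum q N (fun b => F a (scons x b))).
Proof. by rewrite (eq_multisum _ _ (fun a => multisumS q N (F a))) /multisum exchange_big. Qed.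

Lemma multisum_eq0 p N F : (forall a, F a = 0) -> multisum p N F = 0.
Proof. by move=> F0; apply: big1. Qed.

End multi_index_sums.

Section iterated_transvectants.
Variable R : realType.
Local Notation C := (Cx R).
Implicit Types (g : nat -> R) (l a : nat -> nat) (p i : nat).

Definition stail (A : Type) (f : nat -> A) : nat -> A := fun j => f j.+1.

Lemma sum_stail p a : (\sum_(j < p.+1) a j = a 0 + \sum_(j < p) stail a j)%N.
Proof. by rewrite big_ord_recl. Qed.

(** Coupling weights x and y at order k produces weight x + y + 2 k; this is the result of p
    couplings of p + 1 variables. *)
Definition weight p g l : R := \sum_(j < p.+1) g j + 2 * (\sum_(j < p) l j)%N%:R.

(* The last two variables are coupled first; a coupled block behaves as one
   variable whose exponent is its weight. *)
Fixpoint cgm p g l i a : R :=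
  if p is p'.+1 then
    cg (g 0%N) (weight p' (stail g) (stail l)) (l 0%N) i (a 0%N) *
    cgm p' (stail g) (stail l) (l 0%N + i - a 0%N) (stail a)
  else (i == a 0%N)%:R.

Fixpoint cgm_norm p g l : R :=
  if p is p'.+1 then
    cnorm (g 0%N) (weight p' (stail g) (stail l)) (l 0%N) * cgm_norm p' (stail g) (stail l)
  else 1.

Lemma weightS p g l : weight p.+1 g l = g 0%N + weight p (stail g) (stail l) + 2 * (l 0%N)%:R.
Proof.
rewrite /weight [\sum_(j < p.+2) g j]big_ord_recl [(\sum_(j < p.+1) l j)%N]big_ord_recl.
by rewrite natrD /stail; ring.
Qed.

Lemma weight_gt0 p g l : (forall j, (j <= p)%N -> 0 < g j) -> 0 < weight p g l.
Proof.
move=> g0; rewrite /weight [\sum_(j < p.+1) g j]big_ord_recl -addrA ltr_pwDl ?g0 // addr_ge0 ?mulr_ge0 //.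
by apply: sumr_ge0 => j _; apply/ltW/g0; rewrite lift0.
Qed.

Lemma cgm_norm_gt0 p g l : (forall j, (j <= p)%N -> 0 < g j) -> 0 < cgm_norm p g l.
Proof.
elim: p g l => [|p IH] g l g0 //=; rewrite mulr_gt0 ?cnorm_gt0 ?g0 //.
  by apply: weight_gt0 => j jp; apply: g0.
by apply: IH => j jp; apply: g0.
Qed.

(** Homogeneity: the i-th derivative of the transvectant of level l has total order i plus the sum
    of l. It involves only jets of order below n exactly when i is below n minus that sum, which
    explains the order of each summand. *)
Lemma cgm_support p g l i a : cgm p g l i a != 0 ->
  (\sum_(j < p.+1) a j = \sum_(j < p) l j + i)%N.
Proof.
elim: p g l i a => [|p IH] g l i a /=.
  by rewrite pnatr_eq0 eqb0 negbK => /eqP ->; rewrite big_ord1 big_ord0.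
rewrite mulf_eq0 negb_or => /andP[c0 /IH].
rewrite !sum_stail => ->; have [H|H] := leqP (a 0%N) (l 0%N + i); first by lia.
by rewrite cg_small ?eqxx in c0.
Qed.

Lemma eq_weight p g l l' : (forall j : 'I_p, l j = l' j) -> weight p g l = weight p g l'.
Proof. by move=> ll; rewrite /weight (eq_bigr (fun j : 'I_p => l' j)). Qed.

(** By induction the last p + 1 variables act as a single kernel whose weight is that of the tail,
    differentiated to the order left over by the first variable; the two-variable identity then
    couples the first variable with it. *)
Lemma cgm_orthogonal p N g l i l' i' (X U : C) : (forall j, (j <= p)%N -> 0 < g j) ->
  (\sum_(j < p) l j + i < N)%N -> (\sum_(j < p) l' j + i' < N)%N ->
  `|X| < 1 -> `|U| < 1 ->
  multisum p.+1 N (fun a => multisum p.+1 N (fun b =>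
    (cgm p g l i a)%:C * (cgm p g l' i' b)%:C * \prod_(j < p.+1) jetk (g j) (a j) (b j) X U)) =
  [forall j : 'I_p, l j == l' j]%:R * (cgm_norm p g l)%:C * jetk (weight p g l) i i' X U.
Proof.
move=> g0 lN l'N X1 U1; elim: p g l i l' i' g0 lN l'N => [|p IH] g l i l' i' g0.
  rewrite !big_ord0 !add0n => iN i'N; rewrite multisumS.
  have -> : [forall j : 'I_0, l j == l' j] by apply/forallP => -[].
  rewrite /= !mul1r /weight big_ord1 big_ord0 mulr0 addr0.
  rewrite (bigD1 (Ordinal iN)) //= big1 ?addr0; last first.
    move=> x xi; rewrite multisum0; apply: multisum_eq0 => b; rewrite /= -val_eqE /= eq_sym in xi *.
    by rewrite (negbTE xi) !mul0r.
  rewrite multisum0 multisumS (bigD1 (Ordinal i'N)) //= big1 ?addr0; last first.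
    move=> x xi; rewrite multisum0; rewrite /= -val_eqE /= eq_sym in xi *.
    by rewrite (negbTE xi) mulr0 mul0r.
  by rewrite multisum0 /= !eqxx !mul1r big_ord1.
rewrite !sum_stail => lN l'N.
set y := weight p (stail g) (stail l); set y' := weight p (stail g) (stail l').
have y0 : 0 < y by apply: weight_gt0 => j jp; apply: g0.
have step x z : (x < N)%N -> (z < N)%N ->
    multisum p.+1 N (fun a => multisum p.+1 N (fun b =>
      (cgm p.+1 g l i (scons x a))%:C * (cgm p.+1 g l' i' (scons z b))%:C *
      \prod_(j < p.+2) jetk (g j) (scons x a j) (scons z b j) X U)) =
    [forall j : 'I_p, stail l j == stail l' j]%:R * (cgm_norm p (stail g) (stail l))%:C *
    ((cg (g 0%N) y (l 0%N) i x)%:C * (cg (g 0%N) y (l' 0%N) i' z)%:C *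
     (jetk (g 0%N) x z X U * jetk y (l 0%N + i - x) (l' 0%N + i' - z) X U)).
  (* When x exceeds the total order, the order left over is truncated and the induction says
     nothing; the coefficient [cg] is then 0. Likewise for z. *)
  move=> xN zN; have [xl|xl] := ltnP (l 0%N + i) x.
    rewrite (cg_small _ y xl) !mul0r mulr0; apply: multisum_eq0 => a; apply: multisum_eq0 => b /=.
    by rewrite -/y (cg_small _ y xl) !mul0r.
  have [zl|zl] := ltnP (l' 0%N + i') z.
    rewrite (cg_small _ y zl) mulr0 !mul0r mulr0; apply: multisum_eq0 => a; apply: multisum_eq0 => b /=.
    by rewrite -/y' (cg_small _ y' zl) mul0r mulr0 mul0r.
  have IHp := IH (stail g) (stail l) (l 0%N + i - x)%N (stail l') (l' 0%N + i' - z)%N.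
  transitivity ((cg (g 0%N) y (l 0%N) i x)%:C * (cg (g 0%N) y' (l' 0%N) i' z)%:C * jetk (g 0%N) x z X U *
    ([forall j : 'I_p, stail l j == stail l' j]%:R * (cgm_norm p (stail g) (stail l))%:C *
      jetk y (l 0%N + i - x) (l' 0%N + i' - z) X U)).
    rewrite -IHp; last 3 first.
    - by move=> j jp; apply: g0.
    - by move: lN; lia.
    - by move: l'N; lia.
    rewrite /multisum mulr_sumr; apply: eq_bigr => a _; rewrite mulr_sumr; apply: eq_bigr => b _.
    rewrite big_ord_recl /= !rmorphM -/y -/y' /stail.
    move: (\prod_(i < _) _) => Q; ring.
  (* The weights of the two tails need not agree, but they do when the tails of l and l' agree, and
     otherwise both sides are 0. *)
  have [/forallP H|_] := boolP [forall j : 'I_p, stail l j == stail l' j]; last by rewrite !mul0r !mulr0.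
  have -> : y' = y by apply/esym/eq_weight => j; apply/eqP.
  ring.
rewrite multisumS; under eq_bigr => x _ do rewrite multisum_multisumS.
under eq_bigr => x _ do under eq_bigr => z _ do rewrite step ?ltn_ord //.
under eq_bigr => x _ do rewrite -mulr_sumr.
rewrite -mulr_sumr.
have := @cgsumE R N (g 0%N) y (l 0%N) i (l' 0%N) i' X U (g0 0%N isT) y0.
rewrite /cgsum => -> //; try lia.
rewrite weightS -/y rmorphM.
have -> : [forall j : 'I_p.+1, l j == l' j] =
    (l 0%N == l' 0%N) && [forall j : 'I_p, stail l j == stail l' j].
  apply/forallP/andP => [H|[H0 /forallP H] j].
    by split; [exact: (H ord0) | apply/forallP => j; exact: (H (lift ord0 j))].
  by case: (unliftP ord0 j) => [k ->|->] //; exact: (H k).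
by case: eqP => _; case: [forall _, _]; rewrite /= ?mul0r ?mul1r ?mulr0 ?mul0r //; ring.
Qed.

End iterated_transvectants.

(** * Decomposition of the jet bundle *)

Section gram_invertible.
Variable R : realType.
Local Notation C := (Cx R).
Implicit Types (x : R) (w X U : C).

Definition jet_gram x r w : 'M[C]_r := \matrix_(i < r, j < r) jetk x i j w (Num.conj w).

Lemma trig_unit r (L : 'M[C]_r) : (forall i j : 'I_r, (i < j)%N -> L i j = 0) ->
  (forall i, L i i != 0) -> L \in unitmx.
Proof.
move=> H0 H1; rewrite unitmxE det_trig; last by apply/is_trig_mxP.
by rewrite unitfE; apply/prodf_neq0 => i _.
Qed.

(** The product form of [gcoef], with the power of 1 - X U split as -x, -i and -j, factors the Gram
    matrix as lower triangular times diagonal times upper triangular, all with nonzero diagonals. *)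
Lemma jet_gram_unit x r w : 0 < x -> `|w| < 1 -> jet_gram x r w \in unitmx.
Proof.
move=> x0 w1; set U := Num.conj w; set c := cpow (1 - w * U).
have cN0 a : c a != 0 := cpow_neq0 _ _.
have rN0 k : rising x k != 0 by rewrite gt_eqF // rising_gt0.
pose L (u : C) := \matrix_(i < r, k < r)
  (c (- i%:R) * ('C(i, k)%:R * rising x i / rising x k)%:C * u ^+ (i - k)).
have Lu u : L u \in unitmx.
  apply: trig_unit => [i j ij|i]; rewrite mxE.
    by rewrite bin_small // !mul0r rmorph0 mulr0 mul0r.
  by rewrite binn subnn expr0 mulr1 mul1r divff ?rN0 // rmorph1 mulr1 cN0.
pose D := \matrix_(i < r, k < r) ((c (- x) * (i`!%:R * rising x i)%:C) *+ (i == k)).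
have Du : D \in unitmx.
  apply: trig_unit => [i j ij|i]; rewrite mxE.
    by rewrite -val_eqE (ltn_eqF ij).
  rewrite eqxx mulr1n mulf_neq0 ?cN0 //.
  by rewrite fmorph_eq0 mulf_neq0 // pnatr_eq0 -lt0n fact_gt0.
suff -> : jet_gram x r w = L U *m D *m (L w)^T by rewrite !unitmx_mul unitmx_tr !Lu Du.
apply/matrixP => i j; rewrite !mxE (@jetk_widen _ r) //.
have -> : - (x + (i + j)%:R) = - x + (- i%:R + - j%:R) by rewrite natrD; ring.
rewrite !cpowD -/c mulr_sumr; apply: eq_bigr => k _; rewrite !mxE.
rewrite (bigD1 k) //= big1 ?addr0 => [|l lk]; last first.
  by rewrite !mxE (negbTE lk) /= mulr0n mulr0.
rewrite !mxE eqxx mulr1n.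
have -> : (gcoef x i j k)%:C = ('C(i, k)%:R * rising x i / rising x k)%:C *
    (k`!%:R * rising x k)%:C * ('C(j, k)%:R * rising x j / rising x k)%:C :> C.
  rewrite -!(rmorphM (real_complex R)); congr (_%:C).
  by rewrite /gcoef; field; exact: rN0.
set c1 := ('C(i, k)%:R * _ / _)%:C; set c2 := (k`!%:R * _)%:C; set c3 := ('C(j, k)%:R * _ / _)%:C.
rewrite -/U; move: (U ^+ _) (w ^+ _) => e1 e2; ring.
Qed.

Lemma mxdiag_unit q (p_ : 'I_q -> nat) (D : forall t, 'M[C]_(p_ t)) :
  (forall t, D t \in unitmx) -> \mxdiag_(t < q) D t \in unitmx.
Proof.
move=> Du; have H : (\mxdiag_(t < q) D t) *m (\mxdiag_(t < q) (invmx (D t))) = 1%:M; last by case: (mulmx1_unit H).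
rewrite {2}/mxdiag mul_mxdiag_mxblock -[RHS]mxdiagZ /mxdiag.
apply: eq_mxblock => i j; case: (eqVneq i j) => [->|_]; last by rewrite mulmx0.
by rewrite !conform_mx_id mulmxV.
Qed.

(** Invertibility of [B] is a conclusion: at 0 the product B G conj(B)^T is invertible and [B] is
    square, the ranks being equal. *)
Lemma hb_iso_const (E F : hbundle R) (B : 'M[C]_(hb_rank F, hb_rank E)) :
  hb_rank E = hb_rank F ->
  (forall w, disc w -> B *m hb_gram E w *m (B ^t*)%sesqui = hb_gram F w) ->
  hb_gram F 0 \in unitmx -> hb_iso E F.
Proof.
case: E F B => [r G] [r' H] /= B e; case: r' / e H B => H B BGB H0.
have d0 : disc (0 : C) by rewrite /disc /= normr0 ltr01.
have : B \in unitmx by move: H0; rewrite -BGB // !unitmx_mul => /andP[/andP[]].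
move=> Bu; exists (fun=> invmx B); split => [w dw i j|w dw|w dw].
- exact: derivable_cst.
- by exists B; rewrite ?mulmxV ?mulVmx.
rewrite /= -BGB // !mulmxA mulVmx // mul1mx -mulmxA.
have -> : (B ^t*)%sesqui *m ((invmx B) ^t*)%sesqui = 1%:M.
  by rewrite -map_mxM -trmx_mul mulVmx // trmx1 map_mx1.
by rewrite mulmx1.
Qed.

End gram_invertible.

Section index_counting.

Lemma sum_sig (V : nmodType) (T : finType) (P : pred T) (F : T -> V) :
  \sum_(x : {x | P x}) F (val x) = \sum_(x | P x) F x.
Proof.
rewrite [RHS](reindex_omap (val : {x | P x} -> T) insub) => [|x Px].
  by apply: eq_bigl => x; rewrite valK eqxx (valP x).
by rewrite insubT.
Qed.

(** Levels have entries up to n and derivative orders only up to n - 1; tuples of sum n carry a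
    bundle of rank 0. *)
Lemma multisum_widen (V : nmodType) p n (F : (nat -> nat) -> V) :
  (forall a : nat -> nat, (n <= \sum_(j < p) a j)%N -> F a = 0) -> multisum p n.+1 F = multisum p n F.
Proof.
elim: p F => [|p IH] F F0; first by rewrite !multisum0.
rewrite !multisumS big_ord_recr /= [X in _ + X]multisum_eq0 ?addr0 => [|a]; last first.
  by apply: F0; rewrite sum_stail leq_addr.
apply: eq_bigr => x _; apply: IH => a an; apply: F0.
by rewrite sum_stail (leq_trans an) // leq_addl.
Qed.

Variables (p n : nat).

(** The bound on the total order is traded for a summand that vanishes beyond it, so that the sum
    runs over a full box and can be split variable by variable. *)
Lemma sum_transverse (V : nmodType) (F : (nat -> nat) -> V) : (0 < n)%N ->
  (forall a, (n <= \sum_(j < p.+1) stail a j)%N -> F a = 0) ->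
  \sum_(a : transverse p.+2 n) F (zext (val a)) = multisum p.+1 n (fun a => F (scons 0%N a)).
Proof.
move=> n0 F0; rewrite (sum_sig _ (fun a => F (zext a))).
transitivity (multisum p.+2 n (fun a => if a 0%N == 0%N then F a else 0)).
  rewrite big_mkcond; apply: eq_bigr => a _.
  have e0 : zext a 0 = a ord0 by rewrite -[0%N]/(nat_of_ord (ord0 : 'I_p.+2)) zext_ord.
  have es : (\sum_j a j = a ord0 + \sum_(j < p.+1) stail (zext a) j)%N.
    by rewrite -e0 -(sum_stail p.+1 (zext a)); apply: eq_bigr => j _; rewrite zext_ord.
  rewrite e0 es; have [a0|a0] := eqVneq (a ord0 : nat) 0%N; last first.
    rewrite ifF //; apply/negP => /andP[/forallP/(_ ord0) /=].
    by rewrite (negbTE a0).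
  have -> : [forall j : 'I_p.+2, (j == 0 :> nat) ==> (a j == 0 :> nat)].
    apply/forallP => j; apply/implyP => /eqP j0.
    by have -> : j = ord0 by [apply/val_inj]; rewrite a0.
  by rewrite a0 add0n /=; case: ltnP => // /F0.
rewrite multisumS (bigD1 (Ordinal n0)) //= [X in _ + X]big1 ?addr0 // => x x0.
by apply: multisum_eq0 => a; rewrite /= ifF //; apply: contra_neqF x0 => /eqP x0; apply/val_inj.
Qed.

Lemma level_sumE (l : levels p.+2 n) : level_sum l = (\sum_(j < p) zext (val l) j)%N.
Proof. by rewrite /level_sum /= big_add1 big_mkord. Qed.

Lemma level_sum_ffun (f : {ffun 'I_(p.+2 - 2) -> 'I_n.+1}) :
  (\sum_i (f i : nat) = \sum_(j < p) zext f j)%N.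
Proof.
rewrite (eq_bigr (fun i : 'I_(p.+2 - 2) => zext f i)) => [|i _]; last by rewrite zext_ord.
by move: (zext f) => F; rewrite -!(big_mkord xpredT F) subn2.
Qed.

Lemma level_inj (l l' : levels p.+2 n) :
  (forall j : 'I_p, zext (val l) j = zext (val l') j) -> l = l'.
Proof.
move=> H; apply/val_inj/ffunP => i; apply/val_inj.
have ip : (i < p)%N by apply: leq_trans (ltn_ord i) _; rewrite subn2.
by have := H (Ordinal ip); rewrite /= !zext_ord.
Qed.

(** A transverse multi-index of sum below n amounts to a tuple l of p entries together with one more
    entry below n minus the sum of l. Counting suffices; no bijection compatible with the frames is
    needed. *)
Lemma card_transverse :
  #|{: transverse p.+2 n}| = (\sum_(t < #|{: levels p.+2 n}|) (n - level_sum (enum_val t)))%N.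
Proof.
rewrite -(big_enum_val (fun l : levels p.+2 n => n - level_sum l)%N) /=.
under [RHS]eq_bigr do rewrite level_sumE.
rewrite (sum_sig _ (fun f => n - \sum_(j < p) zext f j)%N) big_mkcond /=.
transitivity (multisum (p.+2 - 2) n.+1 (fun l => n - \sum_(j < p) l j)%N); last first.
  apply: eq_bigr => f _; rewrite level_sum_ffun; case: ifPn => //.
  by rewrite -ltnNge => /ltnW; rewrite -subn_eq0 => /eqP.
rewrite subn2 /= multisum_widen => [|a]; last by rewrite -subn_eq0 => /eqP.
have [n0|n0] := posnP n.
  rewrite /multisum [RHS]big1 => [|a _]; last by apply/eqP; rewrite subn_eq0; apply: (leq_trans (eq_leq n0)).
  apply/eqP; rewrite -leqn0 leqNgt; apply/negP => /card_gt0P[a _].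
  by have /andP[_ /leq_trans/(_ (eq_leq n0))] := valP a.
rewrite -sum1_card; transitivity (\sum_(a : transverse p.+2 n)
    (if \sum_(j < p.+1) stail (zext (val a)) j < n then 1 else 0))%N.
  apply: eq_bigr => a _; rewrite ifT //; have /andP[_] := valP a; apply: leq_trans.
  rewrite ltnS (eq_bigr (fun j : 'I_p.+2 => zext (val a) j)) => [|j _]; last by rewrite zext_ord.
  by rewrite (sum_stail p.+1) leq_addl.
rewrite (sum_transverse (F := fun a => if (\sum_(j < p.+1) stail a j < n)%N then 1%N else 0%N)) // => [|a an]; last by rewrite ltnNge an.
rewrite multisumS /multisum exchange_big; apply: eq_bigr => a _.
rewrite (eq_bigr (fun x : 'I_n => if (x < n - \sum_(j < p) zext a j)%N then 1 else 0)%N); last first.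
  by move=> x _; rewrite (sum_stail p) ltn_subRL addnC.
by rewrite -big_mkcond /= -(big_ord_widen n (fun=> 1%N)) ?leq_subr // sum_nat_const card_ord muln1.
Qed.

End index_counting.

Section decomposition.
Variables (R : realType) (p n : nat) (alpha : 'I_p.+2 -> R).
Hypothesis halpha : forall j, 0 < alpha j.
Local Notation C := (Cx R).

Let alf (j : nat) : R := entry 0 alpha j.+1.
Let g := stail alf.

Lemma entry_ord (j : 'I_p.+2) : alf j = alpha j.
Proof. by rewrite /alf /entry /= valK. Qed.

Lemma entry_gt0 j : (j < p.+2)%N -> 0 < alf j.
Proof. by move=> jp; rewrite -[j]/(nat_of_ord (Ordinal jp)) entry_ord. Qed.

Lemma weight_level (l : levels p.+2 n) : weight p g (zext (val l)) =
  \sum_(2 <= i < p.+3) entry 0 alpha i + 2 * (level_sum l)%:R.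
Proof.
rewrite /weight level_sumE; congr (_ + _).
by rewrite -[2%N]/(0 + 2)%N big_addn /= subn2 big_mkord; apply: eq_bigr => j _; rewrite /g /stail /alf addn2.
Qed.

(** No jet differentiates the first variable, so its power of 1 - |w|^2 comes out as a common
    factor. Homogeneity of the coefficients removes the bound n on the order. *)
Lemma transverse_gram (l l' : levels p.+2 n) i i' w :
  (i < n - level_sum l)%N -> (i' < n - level_sum l')%N -> `|w| < 1 ->
  \sum_(a : transverse p.+2 n) \sum_(b : transverse p.+2 n)
    (cgm p g (zext (val l)) i (stail (zext (val a))))%:C *
    (cgm p g (zext (val l')) i' (stail (zext (val b))))%:C *
    \prod_k jetk (alpha k) (val a k) (val b k) w (Num.conj w) =
  (l == l')%:R * (cgm_norm p g (zext (val l)))%:C *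
  (cpow (1 - w * Num.conj w) (- entry 0 alpha 1) *
   jetk (weight p g (zext (val l))) i i' w (Num.conj w)).
Proof.
move=> il il' w1; have n0 : (0 < n)%N by lia.
have u1 : `|Num.conj w| < 1 by rewrite norm_conjC.
have g0 j : (j <= p)%N -> 0 < g j by move=> jp; apply: entry_gt0.
pose F a b := (cgm p g (zext (val l)) i (stail a))%:C *
    (cgm p g (zext (val l')) i' (stail b))%:C *
    \prod_(k < p.+2) jetk (alf k) (a k) (b k) w (Num.conj w).
transitivity (\sum_(a : transverse p.+2 n) \sum_(b : transverse p.+2 n) F (zext (val a)) (zext (val b))).
  apply: eq_bigr => a _; apply: eq_bigr => b _; congr (_ * _).
  by apply: eq_bigr => k _; rewrite entry_ord !zext_ord.
have vanish (q : levels p.+2 n) k (a : nat -> nat) : (k < n - level_sum q)%N ->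
    (n <= \sum_(j < p.+1) stail a j)%N -> cgm p g (zext (val q)) k (stail a) = 0.
  move=> kq an; apply/eqP; apply: contraT => /cgm_support E.
  by move: an; rewrite E -level_sumE; lia.
under eq_bigr => a _.
  rewrite sum_transverse //; last first.
    by move=> b bn; rewrite /F (vanish l' i' b il' bn) rmorph0 mulr0 mul0r.
  over.
rewrite (sum_transverse (F := fun a => multisum p.+1 n (fun b => F a (scons 0%N b)))) //; last first.
  move=> a an; apply: multisum_eq0 => b.
  by rewrite /F (vanish l i a il an) rmorph0 !mul0r.
pose r := cpow (1 - w * Num.conj w) (- entry 0 alpha 1).
transitivity (r * multisum p.+1 n (fun a => multisum p.+1 n (fun b =>
    (cgm p g (zext (val l)) i a)%:C * (cgm p g (zext (val l')) i' b)%:C *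
    \prod_(j < p.+1) jetk (g j) (a j) (b j) w (Num.conj w)))).
  rewrite /multisum mulr_sumr; apply: eq_bigr => a _; rewrite mulr_sumr; apply: eq_bigr => b _.
  by rewrite /F big_ord_recl jetk00 -/r mulrCA.
have ls : (\sum_(j < p) zext (val l) j + i < n)%N by rewrite -level_sumE; lia.
have ls' : (\sum_(j < p) zext (val l') j + i' < n)%N by rewrite -level_sumE; lia.
rewrite cgm_orthogonal //.
have -> : [forall j : 'I_p, zext (val l) j == zext (val l') j] = (l == l').
  apply/forallP/eqP => [H|-> //]; apply: level_inj => j; exact/eqP.
by rewrite mulrCA.
Qed.

End decomposition.

Lemma sum_enum_val (V : nmodType) (T : finType) (F : T -> V) :
  \sum_(i < #|{: T}|) F (enum_val i) = \sum_x F x.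
Proof. by rewrite -(big_enum_val F); apply: eq_bigl => x; rewrite inE. Qed.

Section jet_bundle_iso.
Variables (R : realType) (p n : nat) (alpha : 'I_p.+2 -> R).
Hypothesis halpha : forall j, 0 < alpha j.
Local Notation C := (Cx R).
Local Notation L := (levels p.+2 n).
Variables (M : Halpha alpha) (c : L -> R).
Hypothesis c0 : forall l, 0 < c l.

Let g : nat -> R := stail (fun j => entry 0 alpha j.+1).

Lemma level_weight_gt0 (l : L) :
  0 < \sum_(2 <= k < p.+3) entry 0 alpha k + 2 * (level_sum l)%:R.
Proof.
by rewrite -weight_level weight_gt0 // => j jp; apply: entry_gt0.
Qed.

Definition level_bundle (l : L) : hbundle R :=
  jet_bundle2 (level_kernel alpha l (c l)) (n - level_sum l).

Lemma level_bundle_gram (l : L) w : `|w| < 1 ->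
  hb_gram (level_bundle l) w =
  ((c l)%:C * cpow (1 - w * Num.conj w) (- entry 0 alpha 1)) *:
  jet_gram (\sum_(2 <= k < p.+3) entry 0 alpha k + 2 * (level_sum l)%:R) (n - level_sum l) w.
Proof.
move=> w1; apply/matrixP => i j.
rewrite /level_bundle jet_bundle2_gram //; last exact: level_weight_gt0.
by rewrite !mxE.
Qed.

Definition level_frame (l : L) : 'M[C]_(n - level_sum l, #|{: transverse p.+2 n}|) :=
  \matrix_(i, j) (Num.sqrt (c l / cgm_norm p g (zext (val l))) *
     cgm p g (zext (val l)) i (stail (zext (val (enum_val j)))))%:C.

(** The right-hand side has the form of a block of [mxdiag], whose sizes depend on the indices;
    hence [conform_mx]. The square root in the frame occurs once on each side and so turns
    [cgm_norm] into [c l]. *)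
Lemma level_frame_gram (l l' : L) w : `|w| < 1 ->
  level_frame l *m hb_gram (jet_bundle M n) w *m ((level_frame l') ^t*)%sesqui =
  if l == l' then conform_mx 0 (hb_gram (level_bundle l) w) else 0.
Proof.
move=> w1; have nrm k : 0 < cgm_norm p g (zext (val k)).
  by apply: cgm_norm_gt0 => j jp; apply: entry_gt0.
pose s k := Num.sqrt (c k / cgm_norm p g (zext (val k))).
have E (i : 'I_(n - level_sum l)) (i' : 'I_(n - level_sum l')) :
  (level_frame l *m hb_gram (jet_bundle M n) w *m ((level_frame l') ^t*)%sesqui) i i' =
  (s l * s l')%:C * ((l == l')%:R * (cgm_norm p g (zext (val l)))%:C *
  (cpow (1 - w * Num.conj w) (- entry 0 alpha 1) *
   jetk (weight p g (zext (val l))) i i' w (Num.conj w))).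
  rewrite -(transverse_gram halpha (ltn_ord i) (ltn_ord i') w1).
  rewrite mxE; under eq_bigr => k _ do rewrite mxE mulr_suml.
  rewrite exchange_big /= mulr_sumr -[RHS]sum_enum_val; apply: eq_bigr => j _.
  rewrite mulr_sumr -[RHS]sum_enum_val; apply: eq_bigr => k _.
  rewrite (jet_bundle_gram halpha _ _ w1) !mxE conjc_realE !rmorphM.
  move: (\prod_(_ < _) _) => Q; ring.
case: eqP => [e|/eqP ll]; last first.
  by apply/matrixP => i j; rewrite E (negbTE ll) !mul0r mulr0 mxE.
case: l' / e E => E; apply/matrixP => i j; rewrite E conform_mx_id level_bundle_gram // !mxE eqxx mul1r.
rewrite weight_level mulrA -(rmorphM (real_complex R)) mulrA; congr (_ * _ * _).
rewrite -expr2 sqr_sqrtr ?divr_ge0 ?ltW //.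
by rewrite divfK // gt_eqF.
Qed.

Lemma jet_bundle_decomposition : hb_iso (jet_bundle M n) (hb_dsum level_bundle).
Proof.
apply: (@hb_iso_const R (jet_bundle M n) (hb_dsum level_bundle) (\mxcol_(t < #|{: L}|) level_frame (enum_val t))) => [|w w1|].
- exact: card_transverse.
- rewrite /= mxcol_mul.
  have -> : ((\mxcol_(t < #|{: L}|) level_frame (enum_val t)) ^t*)%sesqui =
    \mxrow_(t < #|{: L}|) ((level_frame (enum_val t)) ^t*)%sesqui.
    by apply/matrixP => i j; rewrite !mxE.
  rewrite mul_mxcol_mxrow /mxdiag; apply: eq_mxblock => i j.
  by rewrite level_frame_gram // (inj_eq enum_val_inj).
- apply: (@mxdiag_unit R #|{: L}| (fun t => n - level_sum (enum_val t))%N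
    (fun t => hb_gram (level_bundle (enum_val t)) 0)) => t; rewrite level_bundle_gram ?normr0 //.
  rewrite unitmxZ; first by apply: jet_gram_unit; rewrite ?normr0 ?level_weight_gt0.
  by rewrite unitfE mulf_neq0 ?cpow_neq0 // fmorph_eq0 gt_eqF.
Qed.

End jet_bundle_iso.

(** * Irreducibility *)

Section irreducibility.
Variables (R : realType) (x : R).
Hypothesis x0 : 0 < x.
Local Notation C := (Cx R).
Implicit Types (w X U : C) (q : nat).

(* Coordinates of the component of the r-th jet orthogonal to the jets of
   order less than r. *)
Definition topcoef r k X U : C :=
  (- (U / (1 - X * U))) ^+ (r - k) * ('C(r, k)%:R * rising x r / rising x k)%:C.

(** Expanding the kernel derivatives leaves, for each m < r, the alternating sum of [trinom r k m 0]
    over k, which is 0 because m differs from r. *)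
Lemma jetk_top r j X U : `|X| < 1 -> `|U| < 1 -> (j < r)%N ->
  \sum_(k < r.+1) topcoef r k X U * jetk x k j X U = 0.
Proof.
move=> X1 U1 jr; have rho0 := Re_1subM_gt0 X1 U1; set rho := 1 - X * U in rho0 *.
have rhoN0 : rho != 0 by apply: contraTneq rho0 => ->; rewrite ltxx.
pose K (m : nat) : C := (m`!%:R * 'C(j, m)%:R * rising x j * rising x r / rising x m)%:C *
   X ^+ (j - m) * U ^+ (r - m).
have E (k : 'I_r.+1) : topcoef r k X U * jetk x k j X U =
  cpow rho (- (x + j%:R)) / rho ^+ r * (-1) ^+ r * \sum_(m < r) K m * (trinom R r k m 0)%:C.
  have kr : (k <= r)%N by rewrite -ltnS.
  rewrite jetkC (@jetk_widen _ r) // (mulrC U X) -/rho.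
  have -> : - (x + (j + k)%:R) = - (x + j%:R) + - k%:R by rewrite natrD; ring.
  rewrite cpowD (cpowN _ k%:R) cpow_nat // /topcoef -/rho !mulr_sumr; apply: eq_bigr => m _.
  have [mk|km] := leqP m k; last first.
    by rewrite gcoef_gtr // trinom_eq0 ?rmorph0 ?mul0r ?mulr0 //; lia.
  have -> : (trinom R r k m 0)%:C = (-1) ^+ k * ('C(r, k)%:R * 'C(k, m)%:R)%:C :> C.
    by rewrite /trinom bin0 mulr1 -mulrA rmorphM rmorphXn rmorphN1.
  have Ur : U ^+ (r - m) = U ^+ (r - k) * U ^+ (k - m).
    by rewrite -exprD; congr (_ ^+ _); lia.
  have sr : (-1 : C) ^+ r = (-1) ^+ (r - k) * (-1) ^+ k by rewrite -exprD subnK.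
  have rr : rho ^+ r = rho ^+ (r - k) * rho ^+ k by rewrite -exprD subnK.
  have s1 : (-1 : C) ^+ k * (-1) ^+ k = 1.
    by rewrite -exprD addnn -mul2n exprM sqrrN expr1n expr1n.
  have cE : ('C(r, k)%:R * rising x r / rising x k)%:C * (gcoef x j k m)%:C =
     (m`!%:R * 'C(j, m)%:R * rising x j * rising x r / rising x m)%:C *
     ('C(r, k)%:R * 'C(k, m)%:R)%:C :> C.
    rewrite -!(rmorphM (real_complex R)); congr (_%:C); rewrite /gcoef.
    by field; rewrite !gt_eqF ?rising_gt0.
  have -> : (- (U / rho)) ^+ (r - k) = (-1) ^+ (r - k) * (U ^+ (r - k) * (rho ^+ (r - k))^-1).
    by rewrite [LHS]exprNn exprMn exprVn.
  rewrite /K Ur sr rr.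
  have key (A s t a b c1 c2 c3 c4 e1 e2 e3 : C) : a != 0 -> b != 0 -> t * t = 1 -> c1 * c2 = c3 * c4 ->
      s * (e1 * a^-1) * c1 * (A * b^-1 * (c2 * e3 * e2)) =
      A / (a * b) * (s * t) * (c3 * e3 * (e1 * e2) * (t * c4)).
    move=> a0 b0 tt cc.
    have -> : s * (e1 * a^-1) * c1 * (A * b^-1 * (c2 * e3 * e2)) =
      s * (e1 * a^-1) * (A * b^-1) * e3 * e2 * (c1 * c2) by ring.
    rewrite cc -[LHS]mulr1 -tt; by field; apply/andP.
  by apply: key => //; rewrite expf_neq0.
under eq_bigr => k _ do rewrite E.
rewrite -mulr_sumr exchange_big /= big1 ?mulr0 // => m _.
rewrite -mulr_sumr -rmorph_sum sum_trinom // addn0.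
by rewrite (ltn_eqF (ltn_ord m)) mul0r rmorph0 mulr0.
Qed.

End irreducibility.

Section parallel_projection.
Variables (R : realType) (x : R) (q : nat).
Hypothesis x0 : 0 < x.
Local Notation C := (Cx R).
Local Notation G := (jet_gram x q.+1).
Implicit Types (w : C) (P : C -> 'M[C]_q.+1).

Lemma topcoef_diag r (X U : C) : topcoef x r r X U = 1.
Proof. by rewrite /topcoef subnn expr0 binn !mul1r divff ?rmorph1 // gt_eqF // rising_gt0. Qed.

(** Effect on coordinates of raising the order of every jet by one: order 0 receives nothing, hence
    the 0; the jet leaving the frame at order q + 1 is treated apart. *)
Definition prevcol (A : 'M[C]_q.+1) (i k : 'I_q.+1) : C :=
  if (k : nat) is k'.+1 then A i (inord k') else 0.

(** P G = G conj(P)^T is differentiated in w alone, where conj(P) counts as constant and G has its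
    row orders raised by one. On the right this gives row i + 1 of the same relation, on the left a
    jet of order q + 1, eliminated by [jetk_top]. Then G is cancelled. *)
Lemma projection_deriv P (P' : 'M[C]_q.+1) w : `|w| < 1 ->
  (forall i j, wder (fun v => P v i j) w (P' i j) 0) ->
  (\forall v \near w, P v *m G v = G v *m ((P v) ^t*)%sesqui) ->
  forall i k : 'I_q.+1, (i < q)%N ->
    P' i k = P w (inord i.+1) k - prevcol (P w) i k +
      P w i ord_max * topcoef x q.+1 k w (Num.conj w).
Proof.
move=> w1 dP HP i k iq; set U := Num.conj w.
have U1 : `|U| < 1 by rewrite norm_conjC.
have Hw := nbhs_singleton HP.
pose y := \row_k (P' i k - (P w (inord i.+1) k - prevcol (P w) i k +
      P w i ord_max * topcoef x q.+1 k w U)).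
suff y0 : y = 0 by have /rowP/(_ k) := y0; rewrite !mxE => /subr0_eq.
suff yG : y *m G w = 0.
  by rewrite -[y](mulmxK (jet_gram_unit q.+1 x0 w1)) yG mul0mx.
apply/rowP => j; rewrite !mxE.
have d1 : wder (fun v => \sum_(k < q.+1) P v i k * jetk x k j v (Num.conj v) -
      \sum_(k < q.+1) jetk x i k v (Num.conj v) * Num.conj (P v j k)) w
    (\sum_(k < q.+1) (P' i k * jetk x k j w U + P w i k * jetk x k.+1 j w U) -
     \sum_(k < q.+1) jetk x i.+1 k w U * Num.conj (P w j k))
    (\sum_(k < q.+1) (P w i k * jetk x k j.+1 w U) -
     \sum_(k < q.+1) (jetk x i k.+1 w U * Num.conj (P w j k) + jetk x i k w U * Num.conj (P' j k))).
  apply: wderB; apply: wder_sum => l _.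
    by have := wderM (dP i l) (wder_jetk_diag l j x0 w1); rewrite mul0r add0r.
  by have := wderM (wder_jetk_diag i l x0 w1) (wder_conj (dP j l)); rewrite rmorph0 mulr0 addr0.
have [|D _] := wder0_eq0 _ d1.
  apply: filterS HP => v /matrixP/(_ i j); rewrite !mxE => H.
  apply/eqP; rewrite subr_eq0; apply/eqP.
  have -> : \sum_(k < q.+1) P v i k * jetk x k j v (Num.conj v) = \sum_(j0 < q.+1) P v i j0 * G v j0 j.
    by apply: eq_bigr => l _; rewrite mxE.
  by rewrite H; apply: eq_bigr => l _; rewrite !mxE.
have iE : (inord i.+1 : 'I_q.+1) = i.+1 :> nat by rewrite inordK.
(* Row i + 1 exists because i < q; the last row yields no such relation. *)
have E1 : \sum_(k < q.+1) jetk x i.+1 k w U * Num.conj (P w j k) = \sum_(k < q.+1) P w (inord i.+1) k * jetk x k j w U.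
  move: Hw => /matrixP/(_ (inord i.+1) j); rewrite !mxE => H.
  transitivity (\sum_(j0 < q.+1) G w (inord i.+1) j0 * (P w ^t*)%sesqui j0 j).
    by apply: eq_bigr => l _; rewrite !mxE iE.
  by rewrite -H; apply: eq_bigr => l _; rewrite !mxE.
pose p l := P w i (inord l); pose g l := jetk x l j w U.
have E2 : \sum_(k < q.+1) P w i k * jetk x k.+1 j w U = \sum_(k < q.+1) prevcol (P w) i k * g k + P w i ord_max * g q.+1.
  rewrite big_ord_recr [in RHS]big_ord_recl /= {2}/prevcol /= mul0r add0r; congr (_ + _).
  apply: eq_bigr => l _.
  rewrite add0n /g /bump /= add1n.
  have -> : inord l = widen_ord (leqnSn q) l by apply/val_inj; rewrite /= inordK // ltnS ltnW.
  by [].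
have := @jetk_top R x x0 q.+1 j w U w1 U1 (ltn_ord j).
rewrite big_ord_recr /= topcoef_diag mul1r => E3.
move: D; rewrite E1 big_split /= E2 => D.
transitivity (\sum_(k < q.+1) (P' i k * g k) + (\sum_(k < q.+1) prevcol (P w) i k * g k) -
   (\sum_(k < q.+1) P w (inord i.+1) k * g k) - P w i ord_max * \sum_(k < q.+1) topcoef x q.+1 k w U * g k).
  rewrite mulr_sumr -!sumrN -!big_split /=; apply: eq_bigr => l _; rewrite !mxE /g; ring.
have -> : \sum_(k < q.+1) topcoef x q.+1 k w U * g k = - g q.+1.
  by apply/eqP; rewrite -subr_eq0 opprK; apply/eqP.
rewrite -[RHS]D; rewrite /g; ring.
Qed.

Lemma wder_inv (u : C) : u != 0 -> wder (fun v => v^-1) u (- u ^- 2) 0.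
Proof.
move=> u0; apply/wder_is_derive; split; first exact: derivableV.
by rewrite (@deriveV _ _ id) // derive_id [_ *: _]mulr1.
Qed.

(** This coordinate is -(q + 1) (x + q) conj w / (1 - |w|^2), whose derivative in conj w is -(q + 1)
    (x + q) / (1 - |w|^2)^2. *)
Lemma wder_topcoef w : `|w| < 1 -> exists a b, b != 0 /\
  wder (fun v => topcoef x q.+1 q v (Num.conj v)) w a b.
Proof.
move=> w1; have U1 : `|Num.conj w| < 1 by rewrite norm_conjC.
have rho0 := Re_1subM_gt0 w1 U1.
have rhoN0 : 1 - w * Num.conj w != 0 by apply: contraTneq rho0 => ->; rewrite ltxx.
have dc := wder_conj (wder_id w); rewrite rmorph0 rmorph1 in dc.
have dr := wderB (wder_cst 1 w) (wderM (wder_id w) dc).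
have := wderZ (- (q.+1%:R * (x + q%:R))%:C) (wderM dc (wder_comp dr (wder_inv rhoN0))).
set a := _ * (_ + _); set b := _ * (_ + _) => H; exists a, b; split; last first.
  apply: near_wder H; apply: filterE => v.
  rewrite /topcoef subSnn expr1 binSn risingS.
  have -> : q.+1%:R * (rising x q * (x + q%:R)) / rising x q = q.+1%:R * (x + q%:R).
    by field; rewrite gt_eqF // rising_gt0.
  by move: (_%:C) => k; rewrite /=; ring.
rewrite /b mulf_neq0 // ?oppr_eq0.
  by rewrite fmorph_eq0 mulf_neq0 ?pnatr_eq0 // gt_eqF // ltr_wpDr.
have -> : 1 * (1 - w * Num.conj w)^-1 +
   Num.conj w * (- (1 - w * Num.conj w) ^- 2 * (0 - (0 * Num.conj w + w * 1))) =
   (1 - w * Num.conj w) ^- 2 by field.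
by rewrite invr_neq0 // expf_neq0.
Qed.

(** The corner entry gives l^2 = l. If l = 0 then 1 - A is triangular and invertible and kills A; if
    l = 1 then A is invertible and cancels. *)
Lemma trig_idempotent (n : nat) (A : 'M[C]_n.+1) (l : C) :
  (forall i j : 'I_n.+1, (i < j)%N -> A i j = 0) -> (forall i, A i i = l) ->
  A *m A = A -> A = 0 \/ A = 1%:M.
Proof.
move=> A0 Al AA; have : l * (1 - l) == 0.
  have /matrixP/(_ ord0 ord0) := AA; rewrite mxE (bigD1 ord0) //= big1 => [|k k0]; last first.
    by rewrite A0 ?mul0r // lt0n.
  by rewrite Al addr0 => e; rewrite mulrBr mulr1 e subrr.
rewrite mulf_eq0 subr_eq0 => /orP[/eqP l0|/eqP l1]; [left|right].
  have u : 1%:M - A \in unitmx.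
    apply: trig_unit => [i j ij|i]; rewrite !mxE.
      by rewrite A0 // -val_eqE (ltn_eqF ij) subrr.
    by rewrite eqxx Al l0 subr0 oner_eq0.
  by rewrite -[A](mulKmx u) mulmxBl mul1mx AA subrr mulmx0.
have u : A \in unitmx.
  by apply: trig_unit => // i; rewrite Al -l1 oner_eq0.
by rewrite -[A](mulKmx u) AA mulVmx.
Qed.

Lemma projection_trivial P (P' : C -> 'M[C]_q.+1) w0 : `|w0| < 1 ->
  (\forall w \near w0, forall i j, wder (fun v => P v i j) w (P' w i j) 0) ->
  (\forall w \near w0, P w *m G w = G w *m ((P w) ^t*)%sesqui) ->
  P w0 *m P w0 = P w0 -> P w0 = 0 \/ P w0 = 1%:M.
Proof.
move=> w01 Hd Hs Hi; have Hw := near_disc w01.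
have HA : \forall w \near w0, forall i k : 'I_q.+1, (i < q)%N ->
    P' w i k = P w (inord i.+1) k - prevcol (P w) i k +
      P w i ord_max * topcoef x q.+1 k w (Num.conj w).
  (* Identities have to be differentiated at every nearby point, so they are needed on a
     neighbourhood of each; [nbhs_interior] provides this. *)
  apply: filterS2 (filterI Hw Hd) (nbhs_interior Hs) => w [w1 dw] Hsw i k iq.
  exact: projection_deriv.
have dprev w i k : (forall i j, wder (fun v => P v i j) w (P' w i j) 0) ->
    wder (fun v => prevcol (P v) i k) w (prevcol (P' w) i k) 0.
  by move=> dw; rewrite /prevcol; case: (k : nat) => [|k'] //; exact: wder_cst.
have HB : \forall w \near w0, forall i : 'I_q.+1, (i < q)%N -> P w i ord_max = 0.
  apply: filterS2 (filterI Hw Hd) (filterI (nbhs_interior Hd) (nbhs_interior HA)) => w [w1 dw] [Hdw HAw] i iq.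
  (* P' is holomorphic while topcoef is not. *)
  have [a [b [b0 dt]]] := wder_topcoef w1.
  have d2 := wderD (wderB (dw (inord i.+1) ord_max) (dprev w i ord_max dw)) (wderM (dw i ord_max) dt).
  have d3 := near_wder (filterS (fun v Hv => esym (Hv i ord_max iq)) HAw) d2.
  have /wder_holomorphic H : \forall v \near w, wder (fun v => P v i ord_max) v (P' v i ord_max) 0.
    by apply: filterS Hdw => v; apply.
  have /eqP := H _ _ (d3 (nbhs_filter w)).
  by rewrite subrr add0r mul0r add0r mulf_eq0 (negbTE b0) orbF => /eqP.
have HC : \forall w \near w0, forall i k : 'I_q.+1, (i < q)%N ->
    P' w i k = P w (inord i.+1) k - prevcol (P w) i k.
  apply: filterS2 HA HB => w H1 H2 i k iq.
  by rewrite H1 // H2 // mul0r addr0.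
(* Columns are treated from the last to the first. Column k vanishes above the diagonal, so does its
   derivative, and the relation becomes P_(i, k-1) = P_(i+1, k) for i < k: this is 0 for i < k - 1
   and carries the diagonal entry along for i = k - 1. *)
have HD m : (m <= q)%N -> \forall w \near w0,
    (forall i : 'I_q.+1, (i < q - m)%N -> P w i (inord (q - m)) = 0) /\
    P w (inord (q - m)) (inord (q - m)) = P w ord_max ord_max.
  have im : (inord q : 'I_q.+1) = ord_max by apply/val_inj; rewrite /= inordK.
  elim: m => [|m IH] mq; first by rewrite subn0 im; apply: filterS HB.
  have {}IH := IH (ltnW mq); set k := (q - m)%N in IH.
  have k0 : (0 < k)%N by rewrite subn_gt0.
  have kq : (k < q.+1)%N by rewrite ltnS leq_subr.
  have -> : (q - m.+1 = k.-1)%N by rewrite subnS.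
  apply: filterS2 (filterI Hd HC) (filterI IH (nbhs_interior IH)) => w [dw HCw] [[z dg] IHw].
  have P'0 (i : 'I_q.+1) : (i < k)%N -> P' w i (inord k) = 0.
    move=> ik; have [] := wder0_eq0 _ (dw i (inord k)) => //.
    by apply: filterS IHw => v [+ _]; apply.
  have step (i : 'I_q.+1) : (i < k)%N -> P w i (inord k.-1) = P w (inord i.+1) (inord k).
    move=> ik; have iq : (i < q)%N by apply: leq_trans ik _; rewrite leq_subr.
    have := HCw i (inord k) iq; rewrite P'0 // => /esym/subr0_eq ->.
    by rewrite /prevcol inordK // -(ltn_predK k0) /=.
  split=> [i ik|].
    have ik' : (i < k)%N by apply: leq_trans ik _; rewrite leq_pred.
    rewrite step // z // inordK; first by rewrite -(ltn_predK k0) ltnS.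
    by rewrite ltnS (leq_trans ik') // leq_subr.
  have kk : (inord k.-1 : 'I_q.+1) = k.-1 :> nat by rewrite inordK // (leq_ltn_trans (leq_pred k)).
  by rewrite step kk ?ltn_predL // prednK.
have HE (k : 'I_q.+1) : (forall i : 'I_q.+1, (i < k)%N -> P w0 i k = 0) /\ P w0 k k = P w0 ord_max ord_max.
  have := nbhs_singleton (HD (q - k)%N (leq_subr _ _)).
  by rewrite subKn ?inord_val // -ltnS.
apply: (trig_idempotent (l := P w0 ord_max ord_max)) => // [i j|i]; first exact: (HE j).1.
exact: (HE i).2.
Qed.

End parallel_projection.

(** * Holomorphic projections from local frames *)

Section holomorphic_matrices.
Variable R : realType.
Local Notation C := (Cx R).
Implicit Types (f : C -> C) (w : C).

Lemma derivable_wder f w : derivable f w 1 -> wder f w ('D_1 f w) 0.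
Proof. by move=> /derivableP/wder_is_derive. Qed.

Lemma wder_derivable f w l : wder f w l 0 -> derivable f w 1.
Proof. by move=> /wder_is_derive[]. Qed.

Lemma derivable_mul f g w : derivable f w 1 -> derivable g w 1 ->
  derivable (fun v => f v * g v : C) w 1.
Proof.
move=> /derivable_wder Hf /derivable_wder Hg; have := wderM Hf Hg.
by rewrite mul0r mulr0 addr0; apply: wder_derivable.
Qed.

Lemma derivable_bigsum (I : Type) (r : seq I) (P : pred I) (f : I -> C -> C) w :
  (forall i, derivable (f i) w 1) -> derivable (fun v => \sum_(i <- r | P i) f i v) w 1.
Proof.
move=> H; have := wder_sum r (fun i (_ : P i) => derivable_wder (H i)).
by rewrite [X in wder _ _ _ X]big1 //; apply: wder_derivable.
Qed.

Lemma derivable_bigprod (I : Type) (r : seq I) (f : I -> C -> C) w :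
  (forall i, derivable (f i) w 1) -> derivable (fun v => \prod_(i <- r) f i v) w 1.
Proof.
move=> H; elim: r => [|i r IH].
  by rewrite [X in derivable X](_ : _ = cst 1) //; apply/funext => v; rewrite big_nil.
rewrite [X in derivable X](_ : _ = fun v => f i v * \prod_(j <- r) f j v).
  exact: (derivable_mul (H i) IH).
by apply/funext => v; rewrite big_cons.
Qed.

Lemma derivable_det n (A : C -> 'M[C]_n) w :
  (forall i j, derivable (fun v => A v i j) w 1) -> derivable (fun v => \det (A v)) w 1.
Proof.
move=> H; rewrite [X in derivable X](_ : _ =
  fun v => \sum_(s : 'S_n) (-1) ^+ s * \prod_i A v i (s i)) //.
have D (s : 'S_n) : derivable (fun v => (-1) ^+ s * \prod_i A v i (s i)) w 1.
  apply: (@derivable_mul (fun=> (-1) ^+ s) (fun v => \prod_i A v i (s i))); first exact: derivable_cst.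
  exact: (@derivable_bigprod _ (index_enum 'I_n) (fun i v => A v i (s i)) w (fun i => H i (s i))).
exact: (derivable_bigsum D).
Qed.

Lemma derivable_mulmx m n p (A : C -> 'M[C]_(m, n)) (B : C -> 'M[C]_(n, p)) w :
  (forall i j, derivable (fun v => A v i j) w 1) ->
  (forall i j, derivable (fun v => B v i j) w 1) ->
  forall i j, derivable (fun v => (A v *m B v) i j) w 1.
Proof.
move=> HA HB i j; rewrite [X in derivable X](_ : _ = fun v => \sum_k A v i k * B v k j).
  exact: (derivable_bigsum (fun k => derivable_mul (HA i k) (HB k j))).
by apply/funext => v; rewrite mxE.
Qed.

(** The inverse is written by Cramer's rule, whose entries are visibly holomorphic, whereas [invmx]
    is defined by cases. *)
Lemma derivable_invmul n p (Z : C -> 'M[C]_n) (K : C -> 'M[C]_(n, p)) w :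
  (forall i j, derivable (fun v => Z v i j) w 1) ->
  (forall i j, derivable (fun v => K v i j) w 1) -> Z w \in unitmx ->
  forall i j, derivable (fun v => ((\det (Z v))^-1 *: \adj (Z v) *m K v) i j) w 1.
Proof.
move=> HZ HK Zu.
suff HA i j : derivable (fun v => ((\det (Z v))^-1 *: \adj (Z v)) i j) w 1.
  exact: (derivable_mulmx HA HK).
rewrite [X in derivable X](_ : _ = fun v => (\det (Z v))^-1 * ((-1) ^+ (j + i) * \det (row' j (col' i (Z v))))); last first.
  by apply/funext => v; rewrite !mxE.
have d1 : derivable (fun v => (\det (Z v))^-1) w 1.
  by apply: derivableV; [move: Zu; rewrite unitmxE unitfE | exact: (derivable_det HZ)].
have d2 : derivable (fun v => \det (row' j (col' i (Z v)))) w 1.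
  apply: derivable_det => k l.
  rewrite [X in derivable X](_ : _ = fun v => Z v (lift j k) (lift i l)); first exact: HZ.
  by apply/funext => v; rewrite !mxE.
have d3 : derivable (fun v => (-1) ^+ (j + i) * \det (row' j (col' i (Z v)))) w 1.
  exact: (derivable_mul (wder_derivable (wder_cst ((-1) ^+ (j + i)) w)) d2).
exact: (derivable_mul d1 d3).
Qed.

End holomorphic_matrices.

Section frame_projection.
Variable (F : fieldType).

Lemma projection_split n (V W P : 'M[F]_n) : (V :&: W)%MS = 0 -> (P <= V)%MS -> (1%:M - P <= W)%MS ->
  [/\ P *m P = P, V *m P = V & W *m P = 0].
Proof.
move=> VW PV PW.
have key m (A : 'M[F]_(m, n)) : (A <= V)%MS -> (A <= W)%MS -> A = 0.
  by move=> AV AW; apply/eqP; rewrite -submx0 -VW sub_capmx AV.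
have VP : V *m P = V.
  apply/esym/eqP; rewrite -subr_eq0 -[X in X - _]mulmx1 -mulmxBr; apply/eqP/key.
    by rewrite mulmxBr mulmx1 addmx_sub // eqmx_opp mulmx_sub.
  exact: mulmx_sub.
split=> //.
  by have /submxP[D PE] := PV; rewrite {1}PE -mulmxA VP -PE.
apply: key; first exact: mulmx_sub.
have -> : W *m P = W - W *m (1%:M - P) by rewrite mulmxBr mulmx1 opprB addrC subrK.
by rewrite addmx_sub // eqmx_opp mulmx_sub.
Qed.

Definition frame_mx k k' r (e : (k + k')%N = r) (A : 'M[F]_(k, r)) (B : 'M[F]_(k', r)) : 'M[F]_r :=
  castmx (e, erefl) (col_mx A B).

Lemma frame_mxB k k' r (e : (k + k')%N = r) (A : 'M[F]_(k, r)) (B : 'M[F]_(k', r)) :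
  frame_mx e A B - frame_mx e A 0 = frame_mx e 0 B.
Proof.
apply/matrixP => i j; rewrite !mxE !castmxE !mxE; case: (fintype.split _) => l; rewrite ?mxE ?subrr ?subr0 //.
Qed.

End frame_projection.

Section hermitian_projection.
Variable R : realType.
Local Notation C := (Cx R).

(** Orthogonality of the images of P and 1 - P gives P H = P H conj(P)^T, and the right-hand side is
    hermitian. *)
Lemma hermitian_projection n (V W P H : 'M[C]_n) : (P <= V)%MS -> (1%:M - P <= W)%MS ->
  V *m H *m (W ^t*)%sesqui = 0 -> (H ^t*)%sesqui = H -> P *m H = H *m (P ^t*)%sesqui.
Proof.
move=> /submxP[D PE] /submxP[E QE] VHW HH.
have PHQ : P *m H *m ((1%:M - P) ^t*)%sesqui = 0.
  by rewrite QE PE trmx_mul map_mxM mulmxA -(mulmxA D V) -(mulmxA D) VHW mulmx0 mul0mx.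
have PHP : P *m H = P *m H *m (P ^t*)%sesqui.
  move: PHQ; rewrite linearB /= map_mxB trmx1 map_mx1 mulmxBr mulmx1.
  by move=> /subr0_eq.
have : (P *m H *m (P ^t*)%sesqui) = ((P *m H *m (P ^t*)%sesqui) ^t*)%sesqui.
  by rewrite !trmx_mul !map_mxM trmxCK HH mulmxA.
by rewrite -PHP trmx_mul map_mxM HH.
Qed.

End hermitian_projection.

Section irreducible_bundle.
Variable R : realType.
Local Notation C := (Cx R).

Lemma near_scale (h : C) (t : R) (Q : C -> Prop) : (\forall v \near (t%:C * h : C), Q v) ->
  \forall s \near t, Q (s%:C * h).
Proof.
move=> /nbhs_normP[d /= /cx_gt0E[d0 ->] Hd].
pose N := complex.Re `|h| + 1.
have N0 : 0 < N by rewrite ltr_wpDl // Re_norm_ge0.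
have hN : `|h| <= N%:C by rewrite /N rmorphD /= Re_normE lerDl ler01.
apply/nbhs_normP; exists (complex.Re d / N); first by rewrite /= divr_gt0.
move=> s /= st; apply: Hd => /=; rewrite -mulrBl normrM -rmorphB normc_real.
apply: (@le_lt_trans _ _ (`|t - s|%:C * N%:C)); first by rewrite ler_wpM2l // lecR.
by rewrite -rmorphM ltcR -ltr_pdivlMr.
Qed.

(** Connectedness is used along the radius from 0 to w only, where the set of parameters with a
    given value of b is open. *)
Lemma disc_locally_constant (b : C -> bool) :
  (forall w, `|w| < 1 -> \forall v \near w, b v = b w) ->
  forall w, `|w| < 1 -> b w = b 0.
Proof.
move=> Hb w w1.
have tw (t : R) : 0 <= t <= 1 -> `|t%:C * w| < 1.
  by move=> t01; apply: le_lt_trans w1; apply: norm_scale_le.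
pose S (c : bool) := [set t : R | `|t%:C * w| < 1 /\ b (t%:C * w) = c].
have oS c : open (S c).
  rewrite openE => t [t1 bt]; rewrite /interior.
  have /(near_scale (Q := fun v => `|v| < 1 /\ b v = c)) : \forall v \near (t%:C * w : C), `|v| < 1 /\ b v = c.
    by apply: filterS2 (near_disc t1) (Hb _ t1) => v v1 ->.
  by [].
have conn := @segment_connected R 0 1.
set I := (X in connected X) in conn.
have B1 : I `&` S (b 0) = I.
  apply: conn.
  - exists 0; split; first by rewrite /I /= in_itv /= lexx ler01.
    by rewrite /S /= rmorph0 mul0r normr0 ltr01.
  - by exists (S (b 0)).
  - exists (~` (S (~~ b 0))); first exact: open_closedC.
    apply/seteqP; split => t [t01] /=.
      move=> [_ bt]; split=> // -[_]; rewrite bt.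
      by case: (b 0).
    move=> nS; split=> //; have t1 : `|t%:C * w| < 1 by apply: tw; move: t01; rewrite /I /= in_itv.
    split=> //; apply/eqP; apply: contra_notT nS => nb; split=> //.
    by move: nb; case: (b _); case: (b 0).
have : I (1 : R) by rewrite /I /= in_itv /= ler01 lexx.
by rewrite -B1 => -[_ [_]]; rewrite rmorph1 mul1r.
Qed.

Variables (x : R) (q : nat).
Hypothesis x0 : 0 < x.
Variables (H : C -> 'M[C]_q.+1) (s : C -> C).
Hypothesis HE : forall w, `|w| < 1 -> H w = s w *: jet_gram x q.+1 w.
Hypothesis s0 : forall w, `|w| < 1 -> s w != 0.

Lemma jet_gram_hermitian r w : `|w| < 1 -> ((jet_gram x r w) ^t*)%sesqui = jet_gram x r w.
Proof.
move=> w1; apply/matrixP => i j; rewrite !mxE jetk_conj ?norm_conjC //.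
by rewrite conjCK jetkC.
Qed.

(** The idempotent is the projection onto V along W; it is holomorphic near w0 and is 0 or 1 at w0.
    Its rank is that of a local frame, so vanishing of V is a locally constant condition. *)
Lemma subbundle_dichotomy (V W : C -> 'M[C]_q.+1) w0 : `|w0| < 1 ->
  hol_subbundle V -> hol_subbundle W -> @Defs.orthogonal_split R (HBundle H) V W ->
  (V w0 = 0 \/ W w0 = 0) /\ \forall w \near w0, (V w == 0) = (V w0 == 0).
Proof.
move=> w01 HV HW VHW.
have VW w : `|w| < 1 -> [/\ (V w + W w :=: 1%:M)%MS, (V w :&: W w)%MS = 0 &
    V w *m H w *m ((W w) ^t*)%sesqui = 0] by move=> /VHW[/eqmxP].
have [k [F NF]] := HV w0 w01; have [k' [F' NF']] := HW w0 w01.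
have [_ frF eqF] := nbhs_singleton NF; have [_ frF' eqF'] := nbhs_singleton NF'.
have rkV A (w : C) : row_free (F w) -> (F w == A)%MS -> \rank A = k.
  by move=> /eqP fr /eqmxP <-.
have rkW A (w : C) : row_free (F' w) -> (F' w == A)%MS -> \rank A = k'.
  by move=> /eqP fr /eqmxP <-.
split; last first.
  apply: filterS NF => w [_ fr eq]; rewrite -!mxrank_eq0.
  by rewrite (rkV _ _ _ fr eq) (rkV _ _ _ frF eqF).
have e : (k + k')%N = q.+1.
  have [V1 V0 _] := VW w0 w01.
  have := mxrank_disjoint_sum V0; rewrite V1 mxrank1.
  by rewrite (rkV _ _ _ frF eqF) (rkW _ _ _ frF' eqF').
(* [Z] stacks the frames of V and W and [K] keeps those of V only, so the inverse of [Z] times [K]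
   fixes V and kills W. The cast is by [e], the ranks adding up only propositionally. *)
pose Z w := frame_mx e (F w) (F' w); pose K w := frame_mx e (F w) 0.
pose P w := (\det (Z w))^-1 *: \adj (Z w) *m K w.
have loc : \forall w \near w0, [/\ forall i j, derivable (fun v => P v i j) w 1,
    P w *m jet_gram x q.+1 w = jet_gram x q.+1 w *m ((P w) ^t*)%sesqui,
    P w *m P w = P w, V w *m P w = V w & W w *m P w = 0].
  apply: filterS2 (near_disc w01) (filterI NF NF') => w w1 [[dF fr /eqmxP eq] [dF' fr' /eqmxP eq']].
  have [V1 V0 VHWw] := VW w w1.
  have Zeq : (Z w :=: col_mx (F w) (F' w))%MS by apply: eqmx_cast.
  have Zu : Z w \in unitmx.
    rewrite -row_full_unit -sub1mx Zeq -addsmxE.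
    by rewrite -V1; apply: addsmxS; rewrite ?eq ?eq' submx_refl.
  have PE : P w = invmx (Z w) *m K w by rewrite /P /invmx Zu.
  have PV : (P w <= V w)%MS.
    rewrite PE (submx_trans (submxMl _ _)) // /K /frame_mx (eqmx_cast _ _) col_mx_sub sub0mx andbT.
    by rewrite eq.
  have PW : (1%:M - P w <= W w)%MS.
    rewrite PE -(mulVmx Zu) -mulmxBr frame_mxB (submx_trans (submxMl _ _)) //.
    by rewrite /frame_mx (eqmx_cast _ _) col_mx_sub sub0mx eq' submx_refl.
  have [PP VP WP] := projection_split V0 PV PW.
  split=> //.
    have dfr k1 k2 (e' : (k1 + k2)%N = q.+1) (A : C -> 'M[C]_(k1, q.+1)) (B : C -> 'M[C]_(k2, q.+1)) :
        (forall i j, derivable (fun v => A v i j) w 1) ->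
        (forall i j, derivable (fun v => B v i j) w 1) ->
        forall i j, derivable (fun v => frame_mx e' (A v) (B v) i j) w 1.
      move=> dA dB i j; case El : (fintype.split (cast_ord (esym e') i)) => [l|l].
        rewrite [X in derivable X](_ : _ = fun v => A v l j) //.
        by apply/funext => v; rewrite castmxE mxE El; congr (A v _ _); apply/val_inj.
      rewrite [X in derivable X](_ : _ = fun v => B v l j) //.
      by apply/funext => v; rewrite castmxE mxE El; congr (B v _ _); apply/val_inj.
    have d0 (i : 'I_k') (j : 'I_q.+1) : derivable (fun=> (0 : 'M[C]_(k', q.+1)) i j) w 1.
      exact: (wder_derivable (wder_cst _ w)).
    exact: (derivable_invmul (dfr _ _ e F F' dF dF') (dfr _ _ e F (fun=> 0) dF d0) Zu).
  apply: (hermitian_projection PV PW); last exact: jet_gram_hermitian.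
  (* The scalar factor from the undifferentiated variable is nonzero and drops out of the
     orthogonality. *)
  move: VHWw; rewrite HE // -scalemxAr -scalemxAl => /eqP.
  by rewrite scaler_eq0 (negbTE (s0 w1)) /= => /eqP.
have [_ _ PP VP WP] := nbhs_singleton loc.
have [||P0|P1] := @projection_trivial _ x q x0 P (fun w => \matrix_(i, j) 'D_1 (fun v => P v i j) w) w0 w01 _ _ PP.
- apply: filterS loc => w [dP _ _ _ _] i j; rewrite mxE; exact: derivable_wder.
- by apply: filterS loc => w [].
- by left; rewrite -VP P0 mulmx0.
- by right; rewrite -WP P1 mulmx1.
Qed.

(** At a point where W is nonzero the dichotomy makes V vanish, hence V vanishes on the whole disc,
    against its being nonzero somewhere. *)
Lemma jet_gram_irreducibleS : hb_irreducible (HBundle H).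
Proof.
move=> [V [W [HV HW [w1 w11 V1] [w2 w21 W2] VW]]].
have dich w w_1 := @subbundle_dichotomy V W w w_1 HV HW VW.
have const w : `|w| < 1 -> (V w == 0) = (V 0 == 0).
  by apply: (@disc_locally_constant (fun w => V w == 0)) => v v1; case: (dich v v1).
have [[V0|W0] _] := dich w2 w21; last by rewrite W0 eqxx in W2.
by move: V1; rewrite (const _ w11) -(const _ w21) V0 eqxx.
Qed.

End irreducible_bundle.

Lemma jet_gram_irreducible (R : realType) (x : R) r (H : Cx R -> 'M[Cx R]_r) (s : Cx R -> Cx R) :
  0 < x -> (forall w, `|w| < 1 -> H w = s w *: jet_gram x r w) ->
  (forall w, `|w| < 1 -> s w != 0) -> hb_irreducible (HBundle H).
Proof.
case: r H => [|q] H x0 HE s0; last exact: (jet_gram_irreducibleS x0 HE s0).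
(* In rank 0 no subbundle is nonzero, so there is nothing to split. *)
by move=> [V [W [_ _ [w _ /eqP[]]]]]; rewrite flatmx0.
Qed.

(** * The constants *)

Section level_constants.
Variables (R : realType) (p n : nat) (alpha : 'I_p.+2 -> R).
Hypothesis halpha : forall j, 0 < alpha j.
Local Notation C := (Cx R).
Local Notation L := (levels p.+2 n).

Lemma level_bundle_irreducible (c : L -> R) (l : L) : 0 < c l ->
  hb_irreducible (level_bundle alpha c l).
Proof.
move=> c0; pose x := \sum_(2 <= k < p.+3) entry 0 alpha k + 2 * (level_sum l)%:R.
have x0 : 0 < x by apply: level_weight_gt0.
pose s w : C := (c l)%:C * cpow (1 - w * Num.conj w) (- entry 0 alpha 1).
have s0 w : s w != 0 by rewrite mulf_neq0 ?cpow_neq0 // fmorph_eq0 gt_eqF.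
apply: (@jet_gram_irreducible R x _ (hb_gram (level_bundle alpha c l)) s) => // w w1.
exact: level_bundle_gram.
Qed.

Lemma sq_norm_gt0 (x y : R) k : 0 < x -> 0 < y -> 0 < sq_norm x y k.
Proof.
move=> x0 y0; rewrite mulr_gt0 ?ltr0n ?fact_gt0 //.
have T i : (i < k.+1)%N -> 0 < 'C(k, i)%:R *
    (rising x k ^+ 2 * rising y k ^+ 2 / (rising x (k - i) * rising y i)).
  move=> ik; apply: mulr_gt0; first by rewrite ltr0n bin_gt0.
  by rewrite divr_gt0 // mulr_gt0 // ?exprn_gt0 // rising_gt0.
rewrite big_nat_recl // ltr_wpDr ?T // big_nat; apply: sumr_ge0 => i /andP[_ ik].
exact/ltW/T.
Qed.

(** The prescribed quotient of consecutive constants. Read at j = 1 its level sum is empty and its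
    sum of exponents is the last one alone, so it is the prescribed C_1; the constants are therefore
    the products of these factors. *)
Let factor (l : L) j : R :=
  sq_norm (entry 0 alpha (p.+2 - j))
    (\sum_(p.+2 - j + 1 <= i < p.+3) entry 0 alpha i +
       2 * (\sum_(p.+2 - j <= i < p.+1) level l i)%N%:R)
    (level l (p.+2 - j - 1)).

Definition level_constant (l : L) (k : nat) : R := \prod_(1 <= j < k.+1) factor l j.

Lemma factor_gt0 l j : (0 < j < p.+2)%N -> 0 < factor l j.
Proof.
move=> /andP[j0 jp].
have E i : (0 < i < p.+3)%N -> 0 < entry 0 alpha i.
  by case: i => // i /= ip; apply: entry_gt0.
apply: sq_norm_gt0; first by apply: E; lia.
apply: ltr_pwDl; last by rewrite mulr_ge0 ?ler0n.
rewrite big_ltn; last lia.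
apply: ltr_pwDl; first by apply: E; lia.
rewrite big_nat; apply: sumr_ge0 => i /andP[i1 i2]; apply/ltW/E; lia.
Qed.

Lemma level_constant_gt0 l k : (k < p.+2)%N -> 0 < level_constant l k.
Proof.
move=> kp; rewrite /level_constant big_nat; apply: prodr_gt0 => j /andP[j0 jk].
by apply: factor_gt0; lia.
Qed.

Lemma level_constantP l : constants alpha l (level_constant l).
Proof.
split=> [|j /andP[j2 jp]].
  rewrite /level_constant big_nat1 /factor; congr sq_norm.
  by rewrite addn1 subn1 big_nat1 [X in 2 * X%:R]big_geq ?mulr0 ?addr0.
case: j j2 jp => // j j2 jp.
rewrite /level_constant /= big_nat_recr //= mulrAC divff ?mul1r // gt_eqF //.
by apply: level_constant_gt0; lia.
Qed.

End level_constants.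

Unset Implicit Arguments.
Close Scope complex_scope.
Close Scope classical_set_scope.

Theorem theorem4p8 (R : realType) (m n : nat) (hm : (3 <= m)%N)
    (alpha : 'I_m -> R) (halpha : forall j, 0 < alpha j) (M : Halpha alpha) :
  exists C : levels m n -> nat -> R,
    [/\ forall l, 0 < C l (m - 2)%N,
        forall l, constants alpha l (C l),
        hb_iso (jet_bundle M n)
          (hb_dsum (fun l : levels m n =>
             jet_bundle2 (level_kernel alpha l (C l (m - 2)%N)) (n - level_sum l)))
      & forall l : levels m n,
          hb_irreducible
            (jet_bundle2 (level_kernel alpha l (C l (m - 2)%N)) (n - level_sum l))].
Proof.
case: m hm alpha halpha M => [//|[//|p]] hm alpha halpha M.
have C0 l : 0 < level_constant (n := n) alpha l (p.+2 - 2) by apply: level_constant_gt0 => //; lia.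
exists (level_constant alpha); split=> // [l||l].
- exact: level_constantP.
- exact: (jet_bundle_decomposition halpha M C0).
- exact: (@level_bundle_irreducible R p n alpha halpha (fun l => level_constant alpha l (p.+2 - 2)) l (C0 l)).
Qed.
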